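(* Let $X$ be a finite set and $m\ge 0$ an integer. As maps $\mathcal A(\uparrow_X)\to\mathcal A^\circ(\emptyset)/(O_m,P_{m+1})$, the composition $\int^{(m)}\circ\,\sigma$ is equal to $j_m/(O_m,P_{m+1})$, i.e. to the Le–Murakami–Ohtsuki map $j_m:\mathcal A(\uparrow_X)\to\mathcal A^\circ(\emptyset)$ followed by the projection to the quotient by the relations $O_m$ and $P_{m+1}$.
   Context: **Diagram spaces** (over a ground field of characteristic $0$, e.g. $\mathbb Q$). Trivalent vertices of all diagrams are oriented (carry a cyclic ordering of their three incident half-edges). Degree is half the number of vertices (including univalent vertices and vertices on arrows). All spaces are completed with respect to degree. - $\mathcal A^\circ(\emptyset)$: spanned by (possibly disconnected or empty) trivalent graphs, which may also have components that are closed circles without vertices, modulo the standard AS and IHX relations. - $\mathcal B(X)$: spanned by uni-trivalent graphs whose univalent vertices (legs) are labeled by elements of $X$, modulo AS and IHX; product is disjoint union. - $\mathcal A(\uparrow_X)$: spanned by diagrams made of $|X|$ upward arrows labeled by $X$ and a uni-trivalent graph whose univalent vertices (legs) are attached to distinct points of the arrows, modulo STU: if legs $a,b$ are attached to adjacent points of an arrow, (diagram with $a$ before $b$ along the arrow) minus (diagram with $b$ before $a$) equals the diagram in which $a$ and $b$ merge at a new trivalent vertex whose third edge, the stem, is attached to the arrow, with cyclic order (stem, $b$, $a$). - $\chi:\mathcal B(X)\to\mathcal A(\uparrow_X)$ maps a diagram to the average of all ways of ordering and attaching its legs labeled $x$ to the arrow labeled $x$, for all $x\in X$. It is an isomorphism;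 $\sigma=\chi^{-1}$. **Relations.** $O_m$: disjoint union with a closed circle equals multiplication by $-2m$. $P_{m+1}$: for any diagram with $2m+2$ free stubs, the sum over all ways of joining these stubs in pairs is $0$. **Negative-dimensional integration.** $\int^{(m)}:\mathcal B(X)\to\mathcal A^\circ(\emptyset)/(O_m,P_{m+1})$ is $$\int^{(m)}G\,dX=\Big\langle\prod_{x\in X}\frac1{m!}\Big(\frac{{}_{\partial_x}\!\smile_{\partial_x}}{2}\Big)^m,\;G\Big\rangle_X\Big/(O_m,P_{m+1}),$$ where ${}_{\partial_x}\!\smile_{\partial_x}$ is the strut (a single edge without internal vertices) both of whose ends are labeled by the dual label $\partial_x$, and $\langle D_1,D_2\rangle_X$ is the sum of all ways of gluing the $\partial_x$-marked legs of $D_1$ to the $x$-marked legs of $D_2$ for all $x\in X$ ($0$ if the numbers of legs do not match). **The map $j_m$.** For $k\ge0$ define a combination $T_k$ of trees with $k$ leaves numbered $1,\dots,k$: $T_0=T_1=0$, $T_2$ is a single edge, and for $k\ge 3$, $T_k=\sum_{\tau\in S_{k-2}}\frac{(-1)^{r(\tau)}}{(k-1)\binom{k-2}{r(\tau)}}T_\tau$, where $r(\tau)=\#\{i:\tau(i)>\tau(i+1)\}$ and $T_\tau$ is the tree consisting of a path from leaf $1$ to leaf $k$ through trivalent vertices $v_1,\dots,v_{k-2}$ (in this order), with leaf $\tau(i)+1$ attached to $v_i$, and cyclic order at $v_i$: (edge towards leaf $1$, edge towards leaf $k$, edge to leaf $\tau(i)+1$). The map $j_m:\mathcal A(\uparrow_X)\to\mathcal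 A^\circ(\emptyset)$ is: remove all the arrows from the diagram; for each arrow, sum over all partitions of the set of stubs that were attached to it into $m$ unordered blocks, and glue to each block of size $k$ the combination $T_k$, with leaves numbered in the order of the stubs along the arrow. (It is a theorem of Le–Murakami–Ohtsuki that $j_m$ is well defined, i.e. respects STU.) *)

(* Defs.v *)
From HB Require Import structures.
From mathcomp Require Import all_boot all_order all_algebra.
From mathcomp Require Import fingroup perm generic_quotient ring_quotient.
From mathcomp Require Import boolp classical_sets.
From mathcomp Require Import finmap monalg ring.

Set Implicit Arguments.
Unset Strict Implicit.
Unset Printing Implicit Defensive.

Import GRing.Theory.
Import Quotient.

(** * Uni-trivalent graphs

    A graph is written like an abstract tensor.  Natural numbers name edges;
    [(a, b, c)] in [tri] is a trivalent vertex whose incident half-edges belong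
    to the edges [a], [b], [c], in this cyclic order; [(x, a)] in [leg] is a
    univalent vertex labelled [x] at an end of the edge [a]; [circ] counts the
    components that are circles without vertices.  In a well-formed graph every
    edge name that occurs does so exactly twice (once per end). *)
Record graph (X : Type) := Graph {
  tri : seq (nat * nat * nat);
  leg : seq (X * nat);
  circ : nat }.

Definition graph_code X (D : graph X) := (tri D, leg D, circ D).
Definition graph_decode X (c : seq (nat * nat * nat) * seq (X * nat) * nat) :=
  Graph c.1.1 c.1.2 c.2.
Lemma graph_codeK X : cancel (@graph_code X) (@graph_decode X).
Proof. by case. Qed.
HB.instance Definition _ (X : choiceType) :=
  Choice.copy (graph X) (can_type (@graph_codeK X)).

Definition tri_ends (t : seq (nat * nat * nat)) : seq nat :=
  flatten [seq [:: v.1.1; v.1.2; v.2] | v <- t].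

Definition ends X (D : graph X) : seq nat := tri_ends (tri D) ++ unzip2 (leg D).

Definition wf X (D : graph X) : bool :=
  all (fun a => count_mem a (ends D) == 2) (ends D).

(** [diag true X]: closed circles are allowed, as in A°;
    [diag false X]: they are not, as in B(X) and A(↑_X).
    In A(↑_X), the arrow [x] carries the legs labelled [x], in the order in
    which they appear in the list [leg D]. *)
Definition diag_ok (o : bool) X (D : graph X) := wf D && (o || (circ D == 0)).

Definition diag (o : bool) (X : choiceType) := {D : graph X | diag_ok o D}.
HB.instance Definition _ o X := Choice.on (diag o X).

(** Degree [d], i.e. [2 * d] vertices. *)
Definition has_deg X (d : nat) (D : graph X) : bool :=
  size (tri D) + size (leg D) == d.*2.

Section GraphOperations.
Variable X : Type.
Implicit Types D : graph X.

Definition map_tri (f : nat -> nat) (v : nat * nat * nat) :=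
  (f v.1.1, f v.1.2, f v.2).

Definition rename (f : nat -> nat) D :=
  Graph (map (map_tri f) (tri D)) [seq (l.1, f l.2) | l <- leg D] (circ D).

Definition bound D : nat := (\max_(a <- ends D) a).+1.

Definition dunion D1 D2 :=
  let D2' := rename (addn (bound D1)) D2 in
  Graph (tri D1 ++ tri D2') (leg D1 ++ leg D2') (circ D1 + circ D2).

Definition leg_label D (i : 'I_(size (leg D))) : X := (tnth (in_tuple (leg D)) i).1.
Definition leg_edge D (i : 'I_(size (leg D))) : nat := (tnth (in_tuple (leg D)) i).2.

Definition permute_legs D (s : 'S_(size (leg D))) :=
  Graph (tri D) [seq tnth (in_tuple (leg D)) (s i) | i <- enum 'I_(size (leg D))]
        (circ D).

(** Relabelling of the legs by their positions. *)
Definition number_legs D : graph 'I_(size (leg D)) :=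
  Graph (tri D) [seq (i, leg_edge i) | i <- enum 'I_(size (leg D))] (circ D).

(** The strut with ends [x], [y] for [s = [:: x; y]]. *)
Definition strut (s : seq X) : graph X := Graph [::] [seq (x, 0) | x <- s] 0.

End GraphOperations.

(** [(f, k)]: [f a] is the edge into which [a] has been merged so far, [k] the
    number of circles.  Gluing an end of [ab.1] to an end of [ab.2] merges two
    edges into one, or closes up a single edge into a circle. *)
Definition glue_step (fk : (nat -> nat) * nat) (ab : nat * nat) :=
  let f := fk.1 in
  if f ab.1 == f ab.2 then (f, fk.2.+1)
  else (fun n => if f n == f ab.2 then f ab.1 else f n, fk.2).

(** Each pair of [ps] stands for two univalent vertices, on the given edges,
    that are to be glued; [ps] has to exhaust the legs. *)
Definition join (ps : seq (nat * nat)) (t : seq (nat * nat * nat)) (k : nat)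
    : graph void :=
  let fk := foldl glue_step (id, k) ps in
  Graph (map (map_tri fk.1) t) [::] fk.2.

(** The ways of gluing all the legs of [D1] to all the legs of [D2], respecting
    the labels. *)
Definition gluing (X : eqType) (D1 D2 : graph X)
    (f : {ffun 'I_(size (leg D1)) -> 'I_(size (leg D2))}) : bool :=
  [&& injectiveb f, size (leg D1) == size (leg D2)
    & [forall i, leg_label (f i) == leg_label i]].

Definition glue X (D1 D2 : graph X)
    (f : {ffun 'I_(size (leg D1)) -> 'I_(size (leg D2))}) : graph void :=
  join [seq (leg_edge i, bound D1 + leg_edge (f i))%N
          | i <- enum 'I_(size (leg D1))]
       (tri (dunion D1 D2)) (circ D1 + circ D2).

(** The tree T_τ with [n.+2] leaves, leaf number [j.+1] being labelled by the
    [j]-th element of [ls].  The path from the first to the last leaf runs along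
    the edges [0, ..., n]; the edges [n.+1, ..., n + n] end in the leaves in
    between.  For [n = 0] this is a strut. *)
Definition comb X n (s : 'S_n) (ls : seq X) : graph X :=
  Graph [seq (nat_of_ord i, i.+1, n.+1 + s i)%N | i <- enum 'I_n]
        (zip ls (0 :: rcons (iota n.+1 n) n)) 0.

Definition descents n (s : 'S_n) : nat :=
  #|[set ij : 'I_n * 'I_n | (ij.2 == ij.1.+1 :> nat) && (s ij.2 < s ij.1)%N]|.

Section DiagramSpaces.
Local Open Scope ring_scope.
Local Open Scope quotient_scope.

Variable K : fieldType.

Definition linext (A : choiceType) (V : lmodType K) (f : A -> V)
    (v : {malg K[A]}) : V :=
  \sum_(a <- msupp v) v@_a *: f a.

(** [gen D] is the basis vector [D]; it is only used for well-formed [D]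
    (see the lemmas at the end), the value [0] being a dummy. *)
Definition gen (o : bool) (X : choiceType) (D : graph X)
    : {malg K[diag o X]} :=
  if insub D is Some D' then << D' >> else 0.

Definition dmul o (X : choiceType) (v w : {malg K[diag o X]})
    : {malg K[diag o X]} :=
  linext (fun D1 : diag o X =>
    linext (fun D2 : diag o X => gen o (dunion (val D1) (val D2))) w) v.

Definition dunit o (X : choiceType) : {malg K[diag o X]} :=
  gen o (Graph [::] [::] 0).

Definition dexp o (X : choiceType) (v : {malg K[diag o X]}) (n : nat) :=
  iter n (dmul v) (dunit o X).

(** ⟨D1, D2⟩_X, where the label [x] of [D1] stands for ∂_x. *)
Definition pairing o1 o2 (X : choiceType)
    (v : {malg K[diag o1 X]}) (w : {malg K[diag o2 X]})
    : {malg K[diag true void]} :=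
  linext (fun D1 : diag o1 X =>
    linext (fun D2 : diag o2 X =>
      \sum_(f | gluing f) gen true (@glue X (val D1) (val D2) f)) w) v.

(** ** Relations *)

Inductive span (V : lmodType K) (R : V -> Prop) : V -> Prop :=
| span0 : span R 0
| span_add c u v : R u -> span R v -> span R (c *: u + v).

Definition in_span (V : lmodType K) (R : V -> Prop) : {pred V} :=
  fun v => `[< span R v >].

Lemma in_span_closed (V : lmodType K) (R : V -> Prop) : zmod_closed (in_span R).
Proof.
split=> [|u v]; first by apply/asboolP; exact: span0.
move=> /asboolP hu /asboolP hv; apply/asboolP.
have {hv} : span R (- v).
  elim: hv => [|c w x Rw _ IH]; first by rewrite oppr0; exact: span0.
  by rewrite opprD -scaleNr; exact: span_add.
elim: hu => [|c w x Rw _ IH] hv; first by rewrite add0r.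
by rewrite -addrA; apply: span_add => //; exact: IH.
Qed.
HB.instance Definition _ (V : lmodType K) (R : V -> Prop) :=
  GRing.isZmodClosed.Build V (@in_span V R) (@in_span_closed V R).

(** The first three constructors identify isomorphic graphs (as far as edges and
    trivalent vertices are concerned).  In [IHX], [e] is the edge shared by
    the two displayed vertices: being well-formed, the graphs contain it nowhere
    else. *)
Inductive graph_rel o (X : choiceType) : {malg K[diag o X]} -> Prop :=
| Rename f (D D' : diag o X) :
    injective f -> val D' = rename f (val D) ->
    graph_rel (<< D >> - << D' >>)
| Reorder (D D' : diag o X) t t' ls k :
    val D = Graph t ls k -> val D' = Graph t' ls k -> perm_eq t t' ->
    graph_rel (<< D >> - << D' >>)
| Rotate (D D' : diag o X) a b c t ls k :
    val D = Graph ((a, b, c) :: t) ls k ->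
    val D' = Graph ((b, c, a) :: t) ls k ->
    graph_rel (<< D >> - << D' >>)
| AS (D D' : diag o X) a b c t ls k :
    val D = Graph ((a, b, c) :: t) ls k ->
    val D' = Graph ((b, a, c) :: t) ls k ->
    graph_rel (<< D >> + << D' >>)
| IHX (D1 D2 D3 : diag o X) a b c d e t ls k :
    val D1 = Graph [:: (a, b, e), (e, c, d) & t] ls k ->
    val D2 = Graph [:: (b, c, e), (e, a, d) & t] ls k ->
    val D3 = Graph [:: (c, a, e), (e, b, d) & t] ls k ->
    graph_rel (<< D1 >> + << D2 >> + << D3 >>).

Inductive relB (X : choiceType) : {malg K[diag false X]} -> Prop :=
| B_graph v : graph_rel v -> relB v
| B_legs (D D' : diag false X) t ls ls' k :
    val D = Graph t ls k -> val D' = Graph t ls' k -> perm_eq ls ls' ->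
    relB (<< D >> - << D' >>).

(** [A_legs]: only the order of the legs along each arrow matters.
    AS and IHX follow from STU when every component has a leg, and are imposed
    because of the components that have none.  In [STU], the stem [s] does not
    occur elsewhere, [D3] being well-formed. *)
Inductive relA (X : choiceType) : {malg K[diag false X]} -> Prop :=
| A_graph v : graph_rel v -> relA v
| A_legs (D D' : diag false X) t ls ls' k :
    val D = Graph t ls k -> val D' = Graph t ls' k ->
    (forall x, [seq l <- ls | l.1 == x] = [seq l <- ls' | l.1 == x]) ->
    relA (<< D >> - << D' >>)
| STU (D1 D2 D3 : diag false X) x a b s t ls1 ls2 k :
    val D1 = Graph t (ls1 ++ [:: (x, a), (x, b) & ls2]) k ->
    val D2 = Graph t (ls1 ++ [:: (x, b), (x, a) & ls2]) k ->
    val D3 = Graph ((s, b, a) :: t) (ls1 ++ (x, s) :: ls2) k ->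
    relA (<< D1 >> - << D2 >> - << D3 >>).

(** The sum over all ways of joining the legs of [D] in pairs. *)
Definition all_joins (D : diag true unit) : {malg K[diag true void]} :=
  let n := size (leg (val D)) in
  \sum_(Q : {set {set 'I_n}} |
        finset.partition Q [set: 'I_n] && [forall (B : {set 'I_n} | B \in Q), #|B| == 2%N])
    pairing (\big[@dmul false 'I_n/dunit false 'I_n]_(B in Q)
               gen false (strut (enum (B : {set _}))))
            (gen true (number_legs (val D))).

Definition relC : {malg K[diag true void]} -> Prop := @graph_rel true void.

Inductive relOP (m : nat) : {malg K[diag true void]} -> Prop :=
| OP_graph v : graph_rel v -> relOP m v
| OP_O (D D' : diag true void) t ls k :
    val D = Graph t ls k -> val D' = Graph t ls k.+1 ->
    relOP m (<< D' >> - (- (2 * m)%N%:R) *: << D >>)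
| OP_P (D : diag true unit) :
    size (leg (val D)) = (2 * m + 2)%N -> relOP m (all_joins D).

(** All relations being homogeneous, the degree [d] part of the space presented
    by the diagrams and the relations [R] is obtained by killing the diagrams of
    other degrees too. *)
Inductive at_deg o (X : choiceType) (R : {malg K[diag o X]} -> Prop) (d : nat)
    : {malg K[diag o X]} -> Prop :=
| Deg_rel v : R v -> at_deg R d v
| Deg_other (D : diag o X) : ~~ has_deg d (val D) -> at_deg R d << D >>.

Definition gr o X R d := {quot (in_span (@at_deg o X R d))}.

(** The completion with respect to the degree is the product of the homogeneous
    parts. *)
Definition completed o X R := forall d : nat, @gr o X R d.

(** B(X), A(↑_X), A°(∅) and A°(∅)/(O_m, P_{m+1}). *)
Definition spaceB (X : choiceType) := completed (@relB X).
Definition spaceA (X : choiceType) := completed (@relA X).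
Definition spaceC := completed relC.
Definition spaceCOP (m : nat) := completed (relOP m).

(** The map induced in each degree by a map which lowers degrees by [s]. *)
Definition induced o X R o' X' R' (s : nat)
    (F : {malg K[diag o X]} -> {malg K[diag o' X']})
    (G : @completed o X R) : @completed o' X' R' :=
  fun d => \pi_(gr R' d) (F (repr (G (d + s)%N))).
Arguments induced {o X R o' X' R'} s F G.

Definition projOP (m : nat) : spaceC -> spaceCOP m := induced 0 id.

Section Maps.
Variable X : finType.

Definition chi_diag (D : diag false X) : {malg K[diag false X]} :=
  let S := [set s : 'S_(size (leg (val D)))
             | [forall i, leg_label (s i) == leg_label i]] in
  (#|S|%:R)^-1 *: \sum_(s in S) gen false (permute_legs s).

Definition chi : spaceB X -> spaceA X := induced 0 (linext chi_diag).

(** The inverse of [chi], which is bijective. *)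
Definition sigma (D : spaceA X) : spaceB X := xget (fun=> 0) (fun G => chi G = D).

Definition nint_kernel (m : nat) : {malg K[diag false X]} :=
  \big[@dmul false X/dunit false X]_(x : X)
    ((m`!)%:R^-1 *: dexp (2%:R^-1 *: gen false (strut [:: x; x])) m).

(** The negative-dimensional integral ∫^(m).  Gluing with the [m] struts of each
    label removes [2 * m * #|X|] vertices. *)
Definition nint (m : nat) : spaceB X -> spaceCOP m :=
  induced (m * #|X|) (pairing (nint_kernel m)).

Definition lmo_tree (Y : choiceType) (ls : seq Y) : {malg K[diag false Y]} :=
  if size ls is n.+2 then
    \sum_(s : 'S_n)
       ((-1) ^+ descents s / (n.+1 * 'C(n, descents s))%:R) *: gen false (comb s ls)
  else 0.

(** [p x] is a partition of the set of legs on the arrow [x] (empty blocks may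
    be ignored, as T_0 = 0). *)
Definition jm_diag (m : nat) (D : diag false X) : {malg K[diag true void]} :=
  let n := size (leg (val D)) in
  \sum_(p : {ffun X -> {set {set 'I_n}}} |
        [forall x, finset.partition (p x) [set i | leg_label i == x]
                   && (#|p x| == m)])
    pairing (\big[@dmul false 'I_n/dunit false 'I_n]_(x : X)
               \big[@dmul false 'I_n/dunit false 'I_n]_(B in p x)
                 lmo_tree (enum (B : {set _})))
            (gen false (number_legs (val D))).

(** The map j_m of Le, Murakami and Ohtsuki.  A block of size [k] with
    its tree [T_k] changes the number of vertices from [k] to [k - 2]. *)
Definition jm (m : nat) : spaceA X -> spaceC :=
  induced (m * #|X|) (linext (jm_diag m)).

End Maps.
End DiagramSpaces.

(** * Well-formedness of the graphs to which [gen] is applied *)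

Lemma wfP X (D : graph X) :
  reflect (forall a, count_mem a (ends D) \in [:: 0; 2])%N (wf D).
Proof.
apply: (iffP allP) => [h a|h a aD].
  rewrite !inE; case: (boolP (a \in ends D)) => [/h ->|]; first by rewrite orbT.
  by move/count_memPn->.
have := h a; rewrite !inE => /orP[/eqP/count_memPn|//].
by rewrite aD.
Qed.

Lemma tri_ends_cat t1 t2 : tri_ends (t1 ++ t2) = tri_ends t1 ++ tri_ends t2.
Proof. by rewrite /tri_ends map_cat flatten_cat. Qed.

Lemma tri_ends_map f t : tri_ends (map (map_tri f) t) = map f (tri_ends t).
Proof. by elim: t => //= v t IH; rewrite /tri_ends /= -/(tri_ends _) IH. Qed.

Lemma wf_perm X Y (D : graph X) (D' : graph Y) :
  perm_eq (ends D) (ends D') -> wf D = wf D'.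
Proof.
move/seq.permP=> h; apply/wfP/wfP => H a; first by rewrite -h.
by rewrite h.
Qed.

Lemma ends_dunion X (D1 D2 : graph X) :
  perm_eq (ends (dunion D1 D2)) (ends D1 ++ map (addn (bound D1)) (ends D2)).
Proof.
rewrite /ends /= tri_ends_cat tri_ends_map /unzip2 !map_cat -!map_comp.
by rewrite -!catA perm_cat2l !catA perm_cat2r perm_catC.
Qed.

Lemma ends_lt X (D : graph X) a : a \in ends D -> (a < bound D)%N.
Proof. by move=> aD; rewrite ltnS (@leq_bigmax_seq _ _ _ id). Qed.

Lemma wf_dunion_ends X (D1 D2 : graph X) a : wf D1 -> wf D2 ->
  (count_mem a (ends D1 ++ map (addn (bound D1)) (ends D2)) \in [:: 0; 2])%N.
Proof.
move=> /wfP h1 /wfP h2; rewrite count_cat count_map.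
have [lt_a|le_a] := ltnP a (bound D1).
  rewrite [X in (_ + X)%N](_ : _ = 0%N) ?addn0 //.
  apply/eqP; rewrite -leqn0 leqNgt -has_count; apply/negP => /hasP[n _ /= /eqP].
  by move=> e; move: lt_a; rewrite -e ltnNge leq_addr.
rewrite (count_memPn _) ?add0n; last first.
  by apply/negP => /ends_lt; rewrite ltnNge le_a.
rewrite (eq_count (a2 := pred1 (a - bound D1)%N)) ?h2 // => n /=.
by rewrite -{1}(subnKC le_a) eqn_add2l.
Qed.

Lemma diag_ok_dunion o X (D1 D2 : graph X) :
  diag_ok o D1 -> diag_ok o D2 -> diag_ok o (dunion D1 D2).
Proof.
rewrite /diag_ok => /andP[w1 c1] /andP[w2 c2]; apply/andP; split; last first.
  by case: o c1 c2 => //= /eqP-> /eqP->.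
apply/wfP => a; rewrite (seq.permP (ends_dunion _ _)); exact: wf_dunion_ends.
Qed.

Lemma diag_ok_empty o X : diag_ok o (Graph [::] [::] 0 : graph X).
Proof. by rewrite /diag_ok orbT. Qed.

Lemma diag_ok_strut o X (x y : X) : diag_ok o (strut [:: x; y]).
Proof. by rewrite /diag_ok orbT. Qed.

Lemma leg_edges X (D : graph X) :
  [seq leg_edge i | i <- enum 'I_(size (leg D))] = unzip2 (leg D).
Proof.
have := congr1 (map snd) (map_tnth_enum (in_tuple (leg D))).
by rewrite -map_comp => e; exact: e.
Qed.

Lemma diag_ok_number_legs o X (D : graph X) :
  diag_ok o D -> diag_ok o (number_legs D).
Proof.
rewrite /diag_ok /=; have -> // : wf (number_legs D) = wf D.
by apply: wf_perm; rewrite /ends /= /unzip2 -map_comp leg_edges.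
Qed.

Lemma perm_enum_perm (T : finType) (s : {perm T}) :
  perm_eq (map s (enum T)) (enum T).
Proof.
apply: uniq_perm; rewrite ?(map_inj_uniq (@perm_inj _ s)) ?enum_uniq // => i.
rewrite mem_enum; apply/mapP.
by exists ((s^-1)%g i); rewrite ?mem_enum ?permKV.
Qed.

Lemma diag_ok_permute_legs o X (D : graph X) (s : 'S_(size (leg D))) :
  diag_ok o D -> diag_ok o (permute_legs s).
Proof.
rewrite /diag_ok /=; have -> // : wf (permute_legs s) = wf D.
apply: wf_perm; rewrite /ends /= perm_cat2l /unzip2 -map_comp.
rewrite -[map snd (leg D)]leg_edges (map_comp (@leg_edge X D) s) perm_map //.
exact: perm_enum_perm.
Qed.

Lemma perm_tri_ends (I : Type) (f g h : I -> nat) (r : seq I) :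
  perm_eq (tri_ends [seq (f i, g i, h i) | i <- r])
          (map f r ++ map g r ++ map h r).
Proof.
apply/seq.permP => p; elim: r => //= i r IH.
rewrite /tri_ends /= -/(tri_ends _) IH !count_cat /=.
rewrite !count_cat /=; ring.
Qed.

Lemma diag_ok_comb o X n (s : 'S_n) (ls : seq X) :
  size ls = n.+2 -> diag_ok o (comb s ls).
Proof.
move=> sz; rewrite /diag_ok orbT andbT.
pose E := iota 0 (n.+1 + n).
suff hE : perm_eq (ends (comb s ls)) (E ++ E).
  apply/wfP => a; rewrite (seq.permP hE) count_cat count_uniq_mem ?iota_uniq //.
  by case: (a \in E).
have es : perm_eq [seq n.+1 + s i | i <- enum 'I_n]%N (iota n.+1 n).
  have -> : iota n.+1 n = [seq (n.+1 + nat_of_ord i)%N | i <- enum 'I_n].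
    by rewrite -[in LHS](addn0 n.+1) iotaDl -val_enum_ord -map_comp.
  rewrite (map_comp (fun i : 'I_n => n.+1 + i)%N s) perm_map //.
  exact: perm_enum_perm.
have -> : ends (comb s ls) =
    tri_ends (tri (comb s ls)) ++ (0 :: rcons (iota n.+1 n) n)%N.
  congr (_ ++ _); apply: unzip2_zip.
  by rewrite sz /= size_rcons size_iota.
apply: perm_trans (perm_cat (perm_tri_ends _ _ _ _) (perm_refl _)) _.
rewrite val_enum_ord.
have -> : [seq (nat_of_ord i).+1 | i <- enum 'I_n] = iota 1 n.
  by rewrite -[1%N]addn0 iotaDl -val_enum_ord -map_comp.
apply/seq.permP => p.
have e1 : count p (iota 0 n.+1) = (p 0 + count p (iota 1 n))%N by [].
have e2 : count p (iota 0 n.+1) = (count p (iota 0 n) + p n)%N.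
  by rewrite -[n.+1]addn1 iotaD count_cat /= add0n addn0.
have eE : count p E = (count p (iota 0 n.+1) + count p (iota n.+1 n))%N.
  by rewrite /E iotaD count_cat.
rewrite !count_cat (seq.permP es) eE {1}e1 e2 -cats1 -cat1s !count_cat /= !addn0.
by ring.
Qed.

Definition inv_glue (f : nat -> nat) (L : seq nat) : Prop :=
  forall a, (count_mem a (map f L) \in [:: 0; 2])%N.

Definition pair_ends (ps : seq (nat * nat)) : seq nat :=
  flatten [seq [:: p.1; p.2] | p <- ps].

Lemma foldl_glue (L : seq nat) ps f k :
  inv_glue f (pair_ends ps ++ L) ->
  inv_glue (foldl glue_step (f, k) ps).1 L.
Proof.
elim: ps f k => //= -[a b] ps IH f k; rewrite /pair_ends /= -/(pair_ends ps) => h.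
rewrite /glue_step /=; case: eqP => [fab|/eqP fab]; apply: IH => c; have := h c;
  rewrite /= ?fab.
  by case: eqP => _; case: (count _ _) => [|[|[|?]]].
set r := fun n => if n == f b then f a else n.
have -> : [seq if f n == f b then f a else f n | n <- pair_ends ps ++ L]
    = map r (map f (pair_ends ps ++ L)) by rewrite -map_comp.
have := h (f a); have := h (f b); rewrite /= !eqxx (negPf fab) eq_sym (negPf fab).
move: (map f _) => M hb ha hc.
have ca : count_mem (f a) M = 1%N by move: ha; case: (count_mem _ _) => [|[|]].
have cb : count_mem (f b) M = 1%N by move: hb; case: (count_mem _ _) => [|[|]].
rewrite count_map.
have [->|ca'] := eqVneq c (f a).
  rewrite (eq_count (a2 := predU (pred1 (f a)) (pred1 (f b)))); last first.
    by move=> n; rewrite /r /= orbC; case: (n == f b); rewrite //= eqxx.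
  have := count_predUI (pred1 (f a)) (pred1 (f b)) M; rewrite ca cb.
  rewrite [X in (_ + X)%N](_ : _ = 0%N) ?addn0 => [-> //|].
  apply/eqP; rewrite -leqn0 leqNgt -has_count; apply/hasP => -[n _ /= /andP[/eqP-> e]].
  by rewrite e in fab.
have [->|cb'] := eqVneq c (f b).
  rewrite (eq_count (a2 := pred0)) ?count_pred0 //.
  by move=> n; rewrite /r /=; case: (eqVneq n (f b)) => [_|/negPf ne]; [exact: negPf|].
move: hc; rewrite eq_sym (negPf ca') eq_sym (negPf cb') !add0n => {}hc.
rewrite (@eq_count _ (preim r (pred1 c)) (pred1 c)) // => {hb ha} n.
rewrite /r /=; case: (eqVneq n (f b)) => // ->.
by rewrite eq_sym (negPf ca') eq_sym (negPf cb').
Qed.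

Lemma diag_ok_glue o1 o2 (X : eqType) (D1 D2 : graph X)
    (f : {ffun 'I_(size (leg D1)) -> 'I_(size (leg D2))}) :
  diag_ok o1 D1 -> diag_ok o2 D2 -> gluing f -> diag_ok true (glue f).
Proof.
move=> /andP[w1 _] /andP[w2 _] /and3P[/injectiveP f_inj /eqP sz _].
rewrite /diag_ok andbT; apply/wfP => a; rewrite /ends /= cats0 tri_ends_map.
apply: foldl_glue => {}a; rewrite map_id.
have := @wf_dunion_ends _ D1 D2 a w1 w2.
rewrite -(seq.permP (ends_dunion D1 D2)).
suff /seq.permP-> : perm_eq (ends (dunion D1 D2))
   (pair_ends [seq (leg_edge i, bound D1 + leg_edge (f i))%N
       | i <- enum 'I_(size (leg D1))] ++ tri_ends (tri (dunion D1 D2))) by [].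
rewrite /ends perm_catC perm_cat2r /= /unzip2 map_cat -map_comp.
set b := bound D1.
have -> : map (snd \o (fun l => (l.1, b + l.2)%N)) (leg D2)
    = map (addn b) (unzip2 (leg D2)) by rewrite -map_comp.
rewrite -/(unzip2 (leg D1)) -(leg_edges D1) -(leg_edges D2) -map_comp.
have pf : perm_eq (map f (enum 'I_(size (leg D1)))) (enum 'I_(size (leg D2))).
  apply: uniq_perm; rewrite ?(map_inj_uniq f_inj) ?enum_uniq // => i.
  rewrite mem_enum; apply/mapP.
  have le : (#|'I_(size (leg D2))| <= #|'I_(size (leg D1))|)%N by rewrite !card_ord sz.
  by have /codomP[j ->] := inj_card_onto f_inj le i; exists j; rewrite ?mem_enum.
rewrite perm_sym; apply: perm_trans (_ : perm_eq _ (map (@leg_edge _ D1) (enum 'I__) ++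
   map (fun i => b + leg_edge (f i))%N (enum 'I__))) _.
  elim: (enum _) => //= i r IH; rewrite /pair_ends /= -/(pair_ends _) perm_cons.
  by rewrite perm_sym perm_catC /= perm_cons perm_catC perm_sym.
rewrite perm_cat2l; have := perm_map (fun i => b + leg_edge i)%N pf.
by rewrite -map_comp => h; exact: h.
Qed.

(* Main.v *)
From HB Require Import structures.
From mathcomp Require Import all_boot all_order all_algebra.
From mathcomp Require Import fingroup perm generic_quotient ring_quotient.
From mathcomp Require Import boolp classical_sets.
From mathcomp Require Import finmap monalg ring zify.
Require Import Defs.

(** Let [cl] be a linear map on closed diagrams that respects the relations between
    graphs, for instance the projection onto a homogeneous part of the target.

    As [sigma] is a section of [chi], it is enough to compare, for one diagram [D]
    of B(X), the integral of [D] with [j_m] of its symmetrization.  In the latter,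
    a partition of the legs into unordered blocks may be replaced by a colouring
    with [m] colours for each label, up to a power of [m`!] ([jm_forest]).  For a fixed
    colouring, the average over all orders of the legs kills every block of size
    greater than two: each comb in [T_k] changes sign when its first leaf is
    exchanged with the next one along the path ([sum_block_forest0]).  Blocks of
    size less than two do not contribute, since [T_0 = T_1 = 0].  What remains is
    the sum over the arrangements of the legs of each label in [m] numbered pairs,
    which are joined by the struts [T_2] ([jm_chi]).  This is what gluing the kernel
    of the integral does: its [m] struts of each label are numbered as well, and the
    two directions of a strut make up for the factor [1/2] ([nint_jm_diag]).

    Passing to the spaces of diagrams needs three more facts.
    - The map [chi] is well defined and onto.  By STU a diagram does not depend on
      the order of its legs up to diagrams with fewer legs, so that it differs from
      its symmetrization by such diagrams only ([chi_onto]).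
    - The map [j_m] respects STU, a theorem of Le, Murakami and Ohtsuki.  It says
      that [T_k] with two neighbouring leaves exchanged differs from [T_k] by a
      [T_(k-1)] one of whose leaves is replaced by a fork ([lmo_ins_swap]).  The
      coefficients [coef n r] of [T_n.+1] satisfy
      [coef n.+1 r - coef n.+1 r.+1 = coef n r], and an exchange of two consecutive
      numbers changes the number of descents of a word only if they are neighbours
      in it; AS and IHX do the rest ([tree_sum_swap]).  The first leaf, which is
      always the leaf number 1 in the definition of [T_k], may be any other one
      except the last ([tree_sum_indep]), because the sum of the coefficients over
      the cyclic rotations of a word is zero; and by the symmetry of [T_k] under
      reversal, the last leaf behaves like the first one.
    - The map [j_m] lowers degrees by [m * #|X|] ([jm_at_deg]), as does the integral.

    Gluing is handled by contexts [G t ps] (see [good]), the values of a graph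
    with a hole: inserting a graph into the hole gives another context ([ins]).
    The product of trees in the definition of [j_m] becomes a sequence of insertions,
    and relations such as AS, IHX and the renaming of edges have to be checked for
    one inserted piece at a time. *)

Set Implicit Arguments.
Unset Strict Implicit.
Unset Printing Implicit Defensive.

Import GRing.Theory.
Import Quotient.
Local Open Scope ring_scope.
Local Open Scope quotient_scope.

(** * Quotient modules and linear extension *)

Section QuotientModule.
Variables (K : fieldType) (V : lmodType K) (R : V -> Prop).

(** The quotients of the definitions are additive groups only; as modules they can
    be the target of linear extensions. *)
Definition quo := {quot (in_span R)}.
HB.instance Definition _ := GRing.Zmodule.on quo.

Definition cls : V -> quo := \pi_quo.

Lemma cls_eq u v : (cls u = cls v) <-> span R (u - v).
Proof.
split=> [/eqP e|h].
  by apply/asboolP; move: e; rewrite /cls -idealrBE.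
by apply/eqP; rewrite /cls -idealrBE; apply/asboolP.
Qed.

Lemma cls_repr x : cls (repr x) = x.
Proof. exact: reprK. Qed.

Lemma spanZ c v : span R v -> span R (c *: v).
Proof.
elim=> [|d u w Ru _ IH]; first by rewrite scaler0; exact: span0.
by rewrite scalerDr scalerA; apply: span_add.
Qed.

Definition qscale (c : K) (x : quo) : quo := cls (c *: repr x).

Lemma qscaleE c v : qscale c (cls v) = cls (c *: v).
Proof.
apply/cls_eq; rewrite -scalerBr; apply: spanZ.
by apply/cls_eq; rewrite cls_repr.
Qed.

Lemma clsD : {morph cls : x y / x + y}.
Proof. exact: raddfD. Qed.

Fact qscaleA c d x : qscale c (qscale d x) = qscale (c * d) x.
Proof. by rewrite -[x]cls_repr !qscaleE scalerA. Qed.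
Fact qscale1 : left_id 1 qscale.
Proof. by move=> x; rewrite -[x]cls_repr !qscaleE scale1r. Qed.
Fact qscaleDr : right_distributive qscale +%R.
Proof. by move=> c x y; rewrite -[x]cls_repr -[y]cls_repr -clsD !qscaleE scalerDr clsD. Qed.
Fact qscaleDl x : {morph qscale^~ x : c d / c + d}.
Proof. by move=> c d; rewrite -[x]cls_repr !qscaleE scalerDl clsD. Qed.

HB.instance Definition _ :=
  GRing.Zmodule_isLmodule.Build K quo qscaleA qscale1 qscaleDr qscaleDl.

Lemma cls_linear : linear cls.
Proof. by move=> c u v; rewrite clsD -qscaleE. Qed.
HB.instance Definition _ := GRing.isLinear.Build K V quo _ cls cls_linear.

Lemma cls_eq0 v : R v -> cls v = 0.
Proof.
move=> Rv; rewrite -(linear0 cls); apply/cls_eq; rewrite subr0.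
by rewrite -[v]addr0 -[v]scale1r; apply: span_add => //; exact: span0.
Qed.

Lemma span_kernel (W : lmodType K) (f : {linear V -> W}) v :
  (forall u, R u -> f u = 0) -> span R v -> f v = 0.
Proof.
move=> h; elim=> [|c u w Ru _ IH]; first exact: linear0.
by rewrite linearP IH h // scaler0 addr0.
Qed.

End QuotientModule.

Section LinearExtension.
Variables (K : fieldType) (A : choiceType) (V : lmodType K).
Implicit Types (f g : A -> V) (v : {malg K[A]}).

Lemma linextEw f v (S : {fset A}) : (msupp v `<=` S)%fset ->
  linext f v = \sum_(a <- S) v@_a *: f a.
Proof.
move=> sub; rewrite /linext (big_fset_incl _ sub) // => a _ /mcoeff_outdom ->.
by rewrite scale0r.
Qed.

Lemma linext_linear f : linear (linext f).
Proof.
move=> c u v; pose S := (msupp u `|` msupp v `|` msupp (c *: u + v))%fset.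
rewrite !(@linextEw f _ S); last 3 first.
- by rewrite /S fsubsetU // fsubsetUr.
- by rewrite /S fsubsetU // fsubsetUl.
- by rewrite /S fsubsetUr.
rewrite scaler_sumr -big_split /=; apply: eq_bigr => a _.
by rewrite mcoeffD mcoeffZ scalerDl scalerA.
Qed.
HB.instance Definition _ f :=
  GRing.isLinear.Build K {malg K[A]} V _ (linext f) (linext_linear f).

Lemma linextU f a : linext f << a >> = f a.
Proof. by rewrite /linext msuppU oner_eq0 big_seq_fset1 mcoeffUU scale1r. Qed.

Lemma eq_linext f g v : f =1 g -> linext f v = linext g v.
Proof. by move=> e; apply: eq_bigr => a _; rewrite e. Qed.

Lemma malg_expand v : v = \sum_(a <- msupp v) v@_a *: << a >>.
Proof.
rewrite {1}[v]monalgE; apply: eq_bigr => a _.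
apply/malgP => b; rewrite mcoeffZ !mcoeffU; case: (a == b); rewrite ?mulr1n ?mulr1 //.
by rewrite !mulr0n mulr0.
Qed.

Lemma linear_linext (F : {linear {malg K[A]} -> V}) v :
  F v = linext (fun a => F << a >>) v.
Proof.
rewrite {1}[v]malg_expand linear_sum; apply: eq_bigr => a _.
by rewrite linearZ.
Qed.

End LinearExtension.

Lemma linext_comp (K : fieldType) (A : choiceType) (V W : lmodType K)
  (F : {linear V -> W}) (f : A -> V) (v : {malg K[A]}) :
  F (linext f v) = linext (F \o f) v.
Proof. by rewrite /linext linear_sum; apply: eq_bigr => a _; rewrite linearZ. Qed.

Lemma gen_val (K : fieldType) o (X : choiceType) (D : diag o X) :
  gen K o (val D) = << D >>.
Proof. by rewrite /gen valK. Qed.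

(** * Renaming and gluing of edges *)

Section Names.
Local Open Scope nat_scope.
Implicit Types (t : seq (nat * nat * nat)) (ps : seq (nat * nat)).

Definition map_pair (h : nat -> nat) (p : nat * nat) := (h p.1, h p.2).

Lemma eq_in_map_tri f g t :
  {in tri_ends t, f =1 g} -> map (map_tri f) t = map (map_tri g) t.
Proof.
elim: t => //= -[[a b] c] t IH h; rewrite IH => [|x xt]; last first.
  by apply: h; rewrite /tri_ends /= !inE xt !orbT.
by rewrite /map_tri /= !h // /tri_ends /= !inE eqxx ?orbT.
Qed.

Lemma map_tri_comp f g t :
  map (map_tri f) (map (map_tri g) t) = map (map_tri (f \o g)) t.
Proof. by rewrite -map_comp. Qed.

Lemma eq_map_tri f g t : f =1 g -> map (map_tri f) t = map (map_tri g) t.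
Proof. by move=> e; apply: eq_in_map_tri => a _. Qed.

Lemma map_pair_comp f g ps :
  map (map_pair f) (map (map_pair g) ps) = map (map_pair (f \o g)) ps.
Proof. by rewrite -map_comp. Qed.

Lemma eq_in_map_pair f g ps :
  {in pair_ends ps, f =1 g} -> map (map_pair f) ps = map (map_pair g) ps.
Proof.
elim: ps => //= -[a b] ps IH h; rewrite IH => [|x xt]; last first.
  by apply: h; rewrite /pair_ends /= !inE xt !orbT.
by rewrite /map_pair /= !h // /pair_ends /= !inE eqxx ?orbT.
Qed.

Lemma eq_map_pair f g ps : f =1 g -> map (map_pair f) ps = map (map_pair g) ps.
Proof. by move=> e; apply: eq_in_map_pair => a _. Qed.

Lemma map_tri_id_in f t : {in tri_ends t, forall a, f a = a} -> map (map_tri f) t = t.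
Proof.
move=> h; rewrite (@eq_in_map_tri f id) // -[RHS]map_id.
by apply: eq_map => -[[]].
Qed.

Lemma map_pair_id_in f ps : {in pair_ends ps, forall a, f a = a} -> map (map_pair f) ps = ps.
Proof.
move=> h; rewrite (@eq_in_map_pair f id) // -[RHS]map_id.
by apply: eq_map => -[].
Qed.

Lemma pair_ends_map h ps : pair_ends (map (map_pair h) ps) = map h (pair_ends ps).
Proof. by elim: ps => //= p ps IH; rewrite /pair_ends /= -/(pair_ends _) IH. Qed.

Lemma pair_ends_cat ps ps' : pair_ends (ps ++ ps') = pair_ends ps ++ pair_ends ps'.
Proof. by rewrite /pair_ends map_cat flatten_cat. Qed.

Lemma leq_bigmax_mem (s : seq nat) a : a \in s -> a <= \max_(b <- s) b.
Proof. by move=> h; rewrite (@leq_bigmax_seq _ _ _ id). Qed.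

Lemma inj_extend (S : seq nat) h : {in S &, injective h} ->
  exists2 h' : nat -> nat, injective h' & {in S, h' =1 h}.
Proof.
move=> hI; pose B := (\max_(a <- map h S) a).+1.
have hB a : a \in S -> h a < B.
  by move=> aS; rewrite ltnS leq_bigmax_mem ?map_f.
(* Outside of [S] the values exceed those of [h] on [S]. *)
exists (fun n => if n \in S then h n else B + n) => [a b|a -> //].
case: ifP => aS; case: ifP => bS.
- exact: hI.
- by move=> e; move: (hB a aS); rewrite e ltnNge leq_addr.
- by move=> e; move: (hB b bS); rewrite -e ltnNge leq_addr.
- by move/addnI.
Qed.

Lemma inj_left_inverse (h : nat -> nat) : injective h -> exists g, cancel h g.
Proof.
move=> hI; exists (fun n => xget 0 [set a | h a = n]) => a.
by case: xgetP => [b _ /= /hI //|/(_ a) /= []].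
Qed.

End Names.

Section Gluing.
Local Open Scope nat_scope.
Implicit Types (t : seq (nat * nat * nat)) (ps : seq (nat * nat)).

Definition identifies (g : nat -> nat) ps := all (fun p => g p.1 == g p.2) ps.

Lemma identifies_cons g p ps :
  identifies g (p :: ps) = (g p.1 == g p.2) && identifies g ps.
Proof. by []. Qed.

Definition glues ps := foldl glue_step (id, 0) ps.

Lemma glue_stepE f k a b : glue_step (f, k) (a, b) =
  if f a == f b then (f, k.+1) else (fun n => if f n == f b then f a else f n, k).
Proof. by []. Qed.

Lemma foldl_glue_comp ps f g k l :
  foldl glue_step (g \o f, k + l) ps =
  ((foldl glue_step (g, l) (map (map_pair f) ps)).1 \o f,
   k + (foldl glue_step (g, l) (map (map_pair f) ps)).2).
Proof.
elim: ps g l => //= -[a b] ps IH g l; rewrite !glue_stepE /=.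
by case: ifP => _; rewrite -?addnS -IH.
Qed.

Lemma foldl_glue_identifies ps f k :
  identifies (foldl glue_step (f, k) ps).1 ps /\
  forall a b, f a = f b ->
    (foldl glue_step (f, k) ps).1 a = (foldl glue_step (f, k) ps).1 b.
Proof.
elim: ps f k => // -[a b] ps IH f k; rewrite identifies_cons [foldl _ _ _]/= !glue_stepE.
case: (eqVneq (f a) (f b)) => [fab|fab].
  case: (IH f k.+1) => h1 h2; rewrite h1 andbT; split=> [|c d]; last exact: h2.
  by apply/eqP/h2.
set f' := fun n => _; case: (IH f' k) => h1 h2; rewrite h1 andbT; split=> [|c d e]; last by apply: h2; rewrite /f' e.
by apply/eqP/h2; rewrite /f' eqxx (negPf fab).
Qed.

Lemma foldl_glue_sub ps f k g :
  identifies g ps -> (forall n, g (f n) = g n) ->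
  forall n, g ((foldl glue_step (f, k) ps).1 n) = g n.
Proof.
elim: ps f k => // -[a b] ps IH f k; rewrite identifies_cons => /andP[/eqP gab gps] gf.
rewrite [foldl _ _ _]/= glue_stepE; case: ifP => fab; apply: IH => //= n.
by case: eqP => e; rewrite ?gf // gab -[g b]gf -e gf.
Qed.

Lemma glues_identifies ps : identifies (glues ps).1 ps.
Proof. by case: (foldl_glue_identifies ps id 0). Qed.

(** Thus [(glues ps).1] is initial among the maps that identify the pairs, which
    characterizes it up to renaming. *)
Lemma glues_sub ps g : identifies g ps -> forall n, g ((glues ps).1 n) = g n.
Proof. by move=> h n; apply: foldl_glue_sub. Qed.

Lemma size_undup_merge (L : seq nat) a b : a \in L -> b \in L -> a != b ->
  (size (undup [seq if n == b then a else n | n <- L])).+1 = size (undup L).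
Proof.
move=> aL bL ab.
have -> : size (undup L) = (size (rem b (undup L))).+1.
  rewrite size_rem ?mem_undup // prednK // lt0n size_eq0.
  by apply/eqP => e; move: aL; rewrite -mem_undup e.
congr _.+1; apply: perm_size; apply: uniq_perm; rewrite ?undup_uniq //.
  by rewrite rem_uniq ?undup_uniq.
move=> n; rewrite mem_undup mem_rem_uniq ?undup_uniq // !inE mem_undup.
apply/mapP/andP => [[m mL ->]|[nb nL]]; last by exists n; rewrite // (negPf nb).
by case: (eqVneq m b) => [_|mb].
Qed.

(** Each pair either merges two classes of names or closes up a circle. *)
Lemma foldl_glue_count (S : seq nat) ps f k : {subset pair_ends ps <= S} ->
  size (undup (map (foldl glue_step (f, k) ps).1 S)) + size ps + k =
  (foldl glue_step (f, k) ps).2 + size (undup (map f S)).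
Proof.
elim: ps f k => [|[a b] ps IH] f k h; first by rewrite /= addn0 addnC.
have aS : a \in S by apply: h; rewrite /pair_ends /= !inE eqxx.
have bS : b \in S by apply: h; rewrite /pair_ends /= !inE eqxx orbT.
have hS : {subset pair_ends ps <= S}.
  by move=> n nps; apply: h; rewrite /pair_ends /= !inE nps !orbT.
rewrite [foldl _ _ _]/= !glue_stepE; case: ifP => [fab|/negbT fab].
  by rewrite -IH //=; lia.
set f' := fun n => _.
have := @size_undup_merge (map f S) (f a) (f b).
rewrite -map_comp !map_f // => /(_ isT isT fab) e.
have e' : (size (undup (map f' S))).+1 = size (undup (map f S)) by [].
by rewrite -e' addnS -IH //=; lia.
Qed.

Lemma size_undup_ker (S : seq nat) (f g : nat -> nat) :
  (forall a b, (f a == f b) = (g a == g b)) ->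
  size (undup (map f S)) = size (undup (map g S)).
Proof.
move=> e; elim: S => //= a S IH.
have -> : (f a \in map f S) = (g a \in map g S).
  by apply/mapP/mapP => -[b bS /eqP h]; exists b => //; apply/eqP; rewrite ?e // -e.
by case: ifP => //= _; rewrite IH.
Qed.

(** The number of circles is determined by the partition of the names that the
    gluing generates: gluing never changes [classes + pairs - circles]. *)
Lemma glues_count ps ps' : size ps = size ps' ->
  (forall a b, ((glues ps).1 a == (glues ps).1 b) =
               ((glues ps').1 a == (glues ps').1 b)) ->
  (glues ps).2 = (glues ps').2.
Proof.
move=> sz e; pose S := pair_ends ps ++ pair_ends ps'.
have h1 : {subset pair_ends ps <= S} by move=> n; rewrite mem_cat => ->.
have h2 : {subset pair_ends ps' <= S} by move=> n; rewrite mem_cat orbC => ->.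
have := foldl_glue_count id 0 h1; have := foldl_glue_count id 0 h2.
rewrite -!/(glues _) -(size_undup_ker S e) sz => -> /eqP.
by rewrite eqn_add2r => /eqP.
Qed.

End Gluing.

Lemma wf_rename X (D : graph X) h : injective h -> wf (rename h D) = wf D.
Proof.
move=> hI; rewrite /wf.
have -> : ends (rename h D) = map h (ends D).
  by rewrite /ends /= tri_ends_map map_cat /unzip2 -!map_comp.
rewrite all_map; apply: eq_all => a /=; congr (_ == _).
by rewrite count_map; apply: eq_count => b /=; rewrite inj_eq.
Qed.

Section Values.
Variables (K : fieldType) (V : lmodType K) (o : bool) (X : choiceType).
Variable cl : {linear {malg K[diag o X]} -> V}.
Implicit Types (t : seq (nat * nat * nat)) (ls : seq (X * nat)).

(** Ill-formed graphs have the value [0], and relations between graphs hold for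
    them too, as all the graphs in a relation are ill-formed together. *)
Definition value t ls k : V := cl (gen K o (Graph t ls k)).

Lemma value_ok t ls k (D : diag o X) : val D = Graph t ls k -> value t ls k = cl << D >>.
Proof. by move=> e; rewrite /value -e gen_val. Qed.

Lemma value_nok t ls k : ~~ diag_ok o (Graph t ls k) -> value t ls k = 0.
Proof. by move=> h; rewrite /value /gen insubN ?linear0. Qed.

Lemma value_okP t ls k :
  {D : diag o X | val D = Graph t ls k} + {~~ diag_ok o (Graph t ls k)}.
Proof.
case: (boolP (diag_ok o (Graph t ls k))) => h; last by right.
by left; exists (Sub (Graph t ls k) h); rewrite SubK.
Qed.

Lemma diag_ok_perm t t' ls ls' k :
  perm_eq (tri_ends t) (tri_ends t') -> perm_eq ls ls' ->
  diag_ok o (Graph t ls k) = diag_ok o (Graph t' ls' k).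
Proof.
move=> ht hl; rewrite /diag_ok; congr (_ && _); apply: wf_perm.
by apply: perm_cat => //; apply: perm_map.
Qed.

Lemma value_eq t t' ls ls' k : diag_ok o (Graph t ls k) = diag_ok o (Graph t' ls' k) ->
  (forall D D' : diag o X, val D = Graph t ls k -> val D' = Graph t' ls' k ->
     cl (<< D >> - << D' >>) = 0) ->
  value t ls k = value t' ls' k.
Proof.
move=> ok h.
case: (value_okP t ls k) => [[D e]|n]; last by rewrite !value_nok // -ok.
case: (value_okP t' ls' k) => [[D' e']|n]; last by rewrite !value_nok // ok.
rewrite (value_ok e) (value_ok e'); apply/eqP; rewrite -subr_eq0 -linearB /=.
by rewrite h.
Qed.

Hypothesis cl_rel : forall v, graph_rel v -> cl v = 0.

Lemma value_perm t t' ls k : perm_eq t t' -> value t ls k = value t' ls k.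
Proof.
move=> h; apply: value_eq => [|D D' e e'].
  by apply: diag_ok_perm => //; apply: perm_flatten; apply: perm_map.
by apply: cl_rel; apply: (Reorder K e e').
Qed.

Lemma value_ren t ls k h : {in ends (Graph t ls k) &, injective h} ->
  value (map (map_tri h) t) [seq (l.1, h l.2) | l <- ls] k = value t ls k.
Proof.
move=> /inj_extend[g gI e].
rewrite -(eq_in_map_tri (f := g)) => [|a ta]; last by apply: e; rewrite mem_cat ta.
have -> : [seq (l.1, h l.2) | l <- ls] = [seq (l.1, g l.2) | l <- ls].
  apply/eq_in_map => l lls; rewrite e // mem_cat; apply/orP; right; exact: map_f.
apply/esym/value_eq => [|D D' eD eD'].
  by rewrite /diag_ok; congr (_ && _); exact/esym/(wf_rename (Graph t ls k)).
by apply: cl_rel; apply: (Rename K gI); rewrite eD eD'.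
Qed.

Lemma value_rot a b c t ls k : value ((a, b, c) :: t) ls k = value ((b, c, a) :: t) ls k.
Proof.
apply: value_eq => [|D D' e e']; last by apply: cl_rel; apply: (Rotate K e e').
by apply: diag_ok_perm => //; rewrite /tri_ends /=; apply/seq.permP => p /=; ring.
Qed.

Lemma value_as a b c t ls k : value ((a, b, c) :: t) ls k = - value ((b, a, c) :: t) ls k.
Proof.
have ok : diag_ok o (Graph ((a, b, c) :: t) ls k) = diag_ok o (Graph ((b, a, c) :: t) ls k).
  by apply: diag_ok_perm => //; rewrite /tri_ends /=; apply/seq.permP => p /=; ring.
case: (value_okP ((a, b, c) :: t) ls k) => [[D e]|n]; last by rewrite !value_nok ?oppr0 // -ok.
case: (value_okP ((b, a, c) :: t) ls k) => [[D' e']|n]; last by rewrite !value_nok ?oppr0 // ok.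
rewrite (value_ok e) (value_ok e'); apply/eqP; rewrite -addr_eq0 -linearD /=.
by rewrite cl_rel //; apply: (AS K e e').
Qed.

Lemma value_ihx a b c d e t ls k :
  value [:: (a, b, e), (e, c, d) & t] ls k + value [:: (b, c, e), (e, a, d) & t] ls k
  + value [:: (c, a, e), (e, b, d) & t] ls k = 0.
Proof.
have ok2 : diag_ok o (Graph [:: (b, c, e), (e, a, d) & t] ls k) =
          diag_ok o (Graph [:: (a, b, e), (e, c, d) & t] ls k).
  by apply: diag_ok_perm => //; rewrite /tri_ends /=; apply/seq.permP => p /=; ring.
have ok3 : diag_ok o (Graph [:: (c, a, e), (e, b, d) & t] ls k) =
          diag_ok o (Graph [:: (a, b, e), (e, c, d) & t] ls k).
  by apply: diag_ok_perm => //; rewrite /tri_ends /=; apply/seq.permP => p /=; ring.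
case: (value_okP [:: (a, b, e), (e, c, d) & t] ls k) => [[D1 e1]|n]; last first.
  by rewrite !value_nok ?ok2 ?ok3 // !addr0.
case: (value_okP [:: (b, c, e), (e, a, d) & t] ls k) => [[D2 e2]|n]; last first.
  by rewrite !value_nok ?ok3 -?ok2 // !addr0.
case: (value_okP [:: (c, a, e), (e, b, d) & t] ls k) => [[D3 e3]|n]; last first.
  by rewrite !value_nok ?ok2 -?ok3 // !addr0.
rewrite (value_ok e1) (value_ok e2) (value_ok e3) -!linearD /=.
by rewrite cl_rel //; apply: (IHX K e1 e2 e3).
Qed.

End Values.

Section Evaluation.
Variables (K : fieldType) (V : lmodType K).
Variable cl : {linear {malg K[diag true void]} -> V}.
Hypothesis cl_rel : forall v, graph_rel v -> cl v = 0.
Implicit Types (t : seq (nat * nat * nat)) (ps : seq (nat * nat)).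

(** Edges that meet no vertex occur in [ps] only; circles arise when they close
    up. *)
Definition ev t ps : V := value cl (map (map_tri (glues ps).1) t) [::] (glues ps).2.

Lemma ev_equiv t ps h t' ps' :
  t' = map (map_tri h) t -> size ps = size ps' ->
  identifies ((glues ps').1 \o h) ps ->
  (forall a b, (glues ps').1 (h a) = (glues ps').1 (h b) ->
               (glues ps).1 a = (glues ps).1 b) ->
  (glues ps).2 = (glues ps').2 ->
  ev t ps = ev t' ps'.
Proof.
move=> -> sz id_ps inj ek; rewrite /ev ek map_tri_comp.
rewrite -(@eq_map_tri (((glues ps').1 \o h) \o (glues ps).1) _ t (glues_sub id_ps)).
rewrite -map_tri_comp; apply/esym; apply: (value_ren cl_rel (ls := [::])).
move=> x y; rewrite /ends /= !cats0 tri_ends_map => /mapP[a _ ->] /mapP[b _ ->] /=.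
have := glues_sub id_ps a; have := glues_sub id_ps b => /= -> ->; exact: inj.
Qed.

(** The equivalence relation generated by the pairs determines the merged edges up
    to renaming, and also the number of circles. *)
Lemma ev_ker t ps ps' : size ps = size ps' ->
  (forall g, identifies g ps = identifies g ps') -> ev t ps = ev t ps'.
Proof.
move=> sz e.
have h1 : identifies (glues ps').1 ps by rewrite e glues_identifies.
have h2 : identifies (glues ps).1 ps' by rewrite -e glues_identifies.
have inj a b : (glues ps').1 a = (glues ps').1 b -> (glues ps).1 a = (glues ps).1 b.
  by move=> eab; rewrite -(glues_sub h2 a) eab glues_sub.
have inj' a b : (glues ps).1 a = (glues ps).1 b -> (glues ps').1 a = (glues ps').1 b.
  by move=> eab; rewrite -(glues_sub h1 a) eab glues_sub.
apply: (@ev_equiv _ _ id) => //; first by rewrite -[LHS]map_id; apply: eq_map => -[[]].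
apply: glues_count => // a b.
by apply/eqP/eqP; [exact: inj'|exact: inj].
Qed.

Lemma ev_ren h t ps : injective h ->
  ev (map (map_tri h) t) (map (map_pair h) ps) = ev t ps.
Proof.
move=> hI; set ps' := map _ ps.
have [g gK] := inj_left_inverse hI.
have h1 : identifies ((glues ps').1 \o h) ps.
  by have := glues_identifies ps'; rewrite /identifies all_map.
have h2 : identifies ((glues ps).1 \o g) ps'.
  rewrite /identifies all_map; apply/allP => p pps /=; rewrite !gK.
  exact: (allP (glues_identifies ps)).
have inj a b : (glues ps').1 (h a) = (glues ps').1 (h b) -> (glues ps).1 a = (glues ps).1 b.
  move=> eab; have := glues_sub h2 (h a); have := glues_sub h2 (h b).
  by rewrite /= eab !gK => -> ->.
have inj' a b : (glues ps).1 a = (glues ps).1 b -> (glues ps').1 (h a) = (glues ps').1 (h b).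
  move=> eab; have := glues_sub h1 a; have := glues_sub h1 b.
  by rewrite /= eab => -> ->.
apply/esym/(@ev_equiv _ _ h) => //; first by rewrite size_map.
pose S := pair_ends ps.
have hS' : {subset pair_ends ps' <= map h S} by rewrite pair_ends_map.
have := foldl_glue_count id 0 hS'.
have := @foldl_glue_count S ps id 0 (fun=> id).
rewrite -!/(glues _) -!map_comp /ps' size_map -/ps'.
rewrite (@size_undup_ker _ ((glues ps').1 \o h) (glues ps).1) => [|a b]; last first.
  by apply/eqP/eqP; [exact: inj|exact: inj'].
rewrite (@size_undup_ker _ h id) => [|a b]; last by rewrite inj_eq.
by move=> -> /eqP; rewrite eqn_add2r => /eqP.
Qed.

End Evaluation.

(** * Contexts and the insertion of graphs *)

Definition subst (a b n : nat) := if n == a then b else n.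
Definition names (t : seq (nat * nat * nat)) (ps : seq (nat * nat)) : seq nat :=
  tri_ends t ++ pair_ends ps.

Lemma names_map h t ps :
  names (map (map_tri h) t) (map (map_pair h) ps) = map h (names t ps).
Proof. by rewrite /names tri_ends_map pair_ends_map map_cat. Qed.

Section Contexts.
Variables (K : fieldType) (V : lmodType K).
Implicit Types (t : seq (nat * nat * nat)) (ps : seq (nat * nat)).
Implicit Types G : seq (nat * nat * nat) -> seq (nat * nat) -> V.

(** A context [G] is a closed graph with a hole: [G t ps] is its value when the
    vertices [t] are added and the ends of edges [ps] are glued. The names in [E0]
    belong to the fixed part of the graph; all the other ones are dummies. *)
Record good (E0 : seq nat) G : Prop := Good {
  g_ren : forall h t ps, injective h -> {in E0, forall a, h a = a} ->
    G (map (map_tri h) t) (map (map_pair h) ps) = G t ps;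
  g_t : forall t t' ps, perm_eq t t' -> G t ps = G t' ps;
  g_ps : forall t ps ps', perm_eq ps ps' -> G t ps = G t ps';
  g_sw : forall t a b ps, G t ((a, b) :: ps) = G t ((b, a) :: ps);
  g_rot : forall a b c t ps, G ((a, b, c) :: t) ps = G ((b, c, a) :: t) ps;
  g_as : forall a b c t ps, G ((a, b, c) :: t) ps = - G ((b, a, c) :: t) ps;
  g_ihx : forall a b c d e t ps,
    G [:: (a, b, e), (e, c, d) & t] ps + G [:: (b, c, e), (e, a, d) & t] ps
    + G [:: (c, a, e), (e, b, d) & t] ps = 0;
  g_elim : forall t a b ps, a \notin E0 -> a != b ->
    G t ((a, b) :: ps) =
    G (map (map_tri (subst a b)) t) (map (map_pair (subst a b)) ps) }.

Lemma good_sub E0 E1 G : {subset E0 <= E1} -> good E0 G -> good E1 G.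
Proof.
move=> h [h1 h2 h3 h4 h5 h6 h7 h8]; split=> //.
  by move=> f t ps fI fE; apply: h1 => // a /h; exact: fE.
by move=> t a b ps aE; apply: h8; apply: contra aE => /h.
Qed.

Lemma ev_good (cl : {linear {malg K[diag true void]} -> V}) :
  (forall v, graph_rel v -> cl v = 0) -> good [::] (ev cl).
Proof.
move=> cl_rel.
have sw t a b ps : ev cl t ((a, b) :: ps) = ev cl t ((b, a) :: ps).
  by apply: ev_ker => //= g; rewrite eq_sym.
split=> [h t ps hI _|t t' ps h|t ps ps' h|//|a b c t ps|a b c t ps|a b c d e t ps|].
- exact: ev_ren.
- by apply: value_perm => //; apply: perm_map.
- by apply: ev_ker => //; [exact: perm_size|move=> g; exact: perm_all].
- exact: value_rot.
- exact: value_as.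
- exact: value_ihx.
move=> t a b ps _ ab; rewrite sw /ev /glues [foldl _ _ (_ :: _)]/= glue_stepE /=.
rewrite eq_sym (negPf ab).
rewrite (@foldl_glue_comp ps (subst a b) id 0 0) add0n map_tri_comp //.
Qed.

Lemma good0 E0 : good E0 (fun _ _ => 0).
Proof. by split=> *; rewrite ?oppr0 ?addr0. Qed.

Lemma good_add E0 G H : good E0 G -> good E0 H -> good E0 (fun t ps => G t ps + H t ps).
Proof.
move=> [g1 g2 g3 g4 g5 g6 g7 g8] [h1 h2 h3 h4 h5 h6 h7 h8].
split=> [h t ps hI hE|t t' ps h|t ps ps' h|t a b ps|a b c t ps|a b c t ps|a b c d e t ps|t a b ps aE ab].
- by rewrite g1 // h1.
- by rewrite (g2 _ _ _ h) (h2 _ _ _ h).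
- by rewrite (g3 _ _ _ h) (h3 _ _ _ h).
- by rewrite g4 h4.
- by rewrite g5 h5.
- by rewrite g6 h6 opprD.
- rewrite -[RHS](addr0 0) -{1}(g7 a b c d e t ps) -(h7 a b c d e t ps) [in RHS]addrACA; congr (_ + _); exact: addrACA.
- by rewrite g8 // h8.
Qed.

Lemma good_scale E0 c G : good E0 G -> good E0 (fun t ps => c *: G t ps).
Proof.
move=> [g1 g2 g3 g4 g5 g6 g7 g8].
split=> [h t ps hI hE|t t' ps h|t ps ps' h|t a b ps|a b c' t ps|a b c' t ps|a b c' d e t ps|t a b ps aE ab].
- by rewrite g1.
- by rewrite (g2 _ _ _ h).
- by rewrite (g3 _ _ _ h).
- by rewrite g4.
- by rewrite g5.
- by rewrite g6 scalerN.
- by rewrite /= -!scalerDr g7 scaler0.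
- by rewrite g8.
Qed.

Lemma good_sum E0 I (r : seq I) (P : pred I) (F : I -> _) :
  (forall i, P i -> good E0 (F i)) -> good E0 (fun t ps => \sum_(i <- r | P i) F i t ps).
Proof.
move=> h; pose S r' t ps := \sum_(i <- r' | P i) F i t ps.
suff: good E0 (S r) by [].
elim: r => [|i r IH].
  have -> : S [::] = fun _ _ => 0 by apply/funext => t; apply/funext => ps; rewrite /S big_nil.
  exact: good0.
have -> : S (i :: r) = fun t ps => (if P i then F i t ps else 0) + S r t ps.
  by apply/funext => t; apply/funext => ps; rewrite /S big_cons; case: ifP; rewrite ?add0r.
apply: good_add => //; case: (boolP (P i)) => [/h //|_]; exact: good0.
Qed.

(** * Insertion of a graph whose legs are labelled by edges of the context *)

Definition labs (E : graph nat) : seq nat := unzip1 (leg E).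

(** A leg of [E] is glued to the edge of the context that is its label; [rho]
    keeps the edges of [E] apart from those of the context. *)
Definition attach rho (E : graph nat) G t ps : V :=
  G (map (map_tri rho) (tri E) ++ t) ([seq (rho l.2, l.1) | l <- leg E] ++ ps).

Definition fresh (rho : nat -> nat) (E : graph nat) (A : seq nat) : Prop :=
  {in ends E &, injective rho} /\ {in ends E, forall a, rho a \notin A}.

Definition avoid E0 (E : graph nat) t ps := E0 ++ labs E ++ names t ps.

Lemma leg_ends (E : graph nat) l : l \in leg E -> l.2 \in ends E.
Proof. by move=> h; rewrite /ends mem_cat; apply/orP; right; apply: map_f. Qed.

Lemma leg_labs (E : graph nat) l : l \in leg E -> l.1 \in labs E.
Proof. by move=> h; apply: map_f. Qed.

Lemma attach_map h rho (E : graph nat) G t ps : {in labs E, forall a, h a = a} ->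
  attach (h \o rho) E G (map (map_tri h) t) (map (map_pair h) ps) =
  G (map (map_tri h) (map (map_tri rho) (tri E) ++ t))
    (map (map_pair h) ([seq (rho l.2, l.1) | l <- leg E] ++ ps)).
Proof.
move=> hl; rewrite /attach !map_cat -!map_comp; congr (G (_ ++ _) (_ ++ _)).
by apply/eq_in_map => l /leg_labs/hl; rewrite /map_pair /= => ->.
Qed.

Lemma attach_indep E0 G E t ps rho rho' : good E0 G ->
  fresh rho E (avoid E0 E t ps) -> fresh rho' E (avoid E0 E t ps) ->
  attach rho E G t ps = attach rho' E G t ps.
Proof.
set A := avoid _ _ _ _ => gG [inj fr] [inj' fr'].
pose h n := if n \in A then n else
  rho' (nth 0%N (ends E) (index n (map rho (ends E)))).
have hA a : a \in A -> h a = a by rewrite /h => ->.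
have hr a : a \in ends E -> h (rho a) = rho' a.
  move=> aE; rewrite /h (negPf (fr _ aE)); congr rho'.
  have ra : rho a \in map rho (ends E) by apply: map_f.
  apply: inj => //; first by rewrite mem_nth // -(size_map rho) index_mem.
  by rewrite -(nth_map 0%N 0%N) ?nth_index // -(size_map rho) index_mem.
have /inj_extend[h' hI eh] : {in A ++ map rho (ends E) &, injective h}.
  move=> a b; rewrite !(mem_cat _ A) => /orP[aA|/mapP[a' a'E ->]] /orP[bA|/mapP[b' b'E ->]].
  - by move=> e; rewrite -(hA a aA) -(hA b bA).
  - by rewrite hA // hr // => e; move: (fr' _ b'E); rewrite -e aA.
  - by rewrite [h b]hA // hr // => e; move: (fr' _ a'E); rewrite e bA.
  - by rewrite !hr // => /inj' ->.
have e1 a : a \in A -> h' a = a by move=> aA; rewrite eh ?hA // mem_cat aA.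
have e2 a : a \in ends E -> h' (rho a) = rho' a.
  by move=> aE; rewrite eh ?hr // mem_cat map_f ?orbT.
rewrite /attach -(g_ren gG (h := h')) //; last first.
  by move=> a aE; apply: e1; rewrite /A /avoid mem_cat aE.
rewrite !map_cat -!map_comp; congr (G (_ ++ _) (_ ++ _)).
- rewrite -[LHS]/(map (map_tri h' \o map_tri rho) (tri E)).
  rewrite (@eq_in_map_tri (h' \o rho) rho' (tri E)) // => a aE.
  by rewrite /= e2 // /ends mem_cat aE.
- by apply: map_tri_id_in => a aE; apply: e1; rewrite /A /avoid /names !mem_cat aE !orbT.
- apply/eq_in_map => l lE; rewrite /map_pair /= e2 ?leg_ends // e1 //.
  by rewrite /A /avoid !mem_cat leg_labs ?orbT.
- by apply: map_pair_id_in => a aE; apply: e1; rewrite /A /avoid /names !mem_cat aE !orbT.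
Qed.

Definition below (N : nat) (A : seq nat) := all (fun a => a < N)%N A.

Lemma below_cat N A B : below N (A ++ B) = below N A && below N B.
Proof. exact: all_cat. Qed.

Lemma belowP (A : seq nat) : exists N, below N A.
Proof.
by exists (\max_(a <- A) a).+1; apply/allP => a aA; rewrite ltnS leq_bigmax_mem.
Qed.

Lemma below_le N M A : (N <= M)%N -> below N A -> below M A.
Proof. by move=> h; apply: sub_all => a /leq_trans; apply. Qed.

Lemma fresh_addn N E A : below N A -> fresh (addn N) E A.
Proof.
move=> /allP h; split=> [a b _ _ /addnI //|a _].
by apply/negP => /h; rewrite ltnNge leq_addr.
Qed.

(** Any choice of fresh names for the edges of [E] gives the same result; taking
    the one for all large shifts avoids a choice that depends on [G]. *)
Definition ins (E : graph nat) G t ps : V :=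
  xget 0 [set v | exists N0, forall N, (N0 <= N)%N -> attach (addn N) E G t ps = v].

Lemma ins_any E0 G E t ps rho : good E0 G -> fresh rho E (avoid E0 E t ps) ->
  ins E G t ps = attach rho E G t ps.
Proof.
move=> gG fr; have [N0 hN0] := belowP (avoid E0 E t ps).
have e N : (N0 <= N)%N -> attach (addn N) E G t ps = attach rho E G t ps.
  by move=> h; apply: attach_indep gG _ fr; apply: fresh_addn (below_le h hN0).
rewrite /ins; case: xgetP => [v _ [N1 hv]|/(_ (attach rho E G t ps))[]]; last by exists N0.
by rewrite -(e (maxn N0 N1)) ?leq_maxl // hv ?leq_maxr.
Qed.

Lemma ins_below E0 G E t ps N : good E0 G -> below N (avoid E0 E t ps) ->
  ins E G t ps = attach (addn N) E G t ps.
Proof. by move=> gG h; apply: ins_any gG (fresh_addn _ h). Qed.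

Lemma map_tri_subst_id a b t : a \notin tri_ends t -> map (map_tri (subst a b)) t = t.
Proof.
move=> h.
by apply: map_tri_id_in => c ct; rewrite /subst; case: eqP => // e; rewrite -e ct in h.
Qed.

Lemma good_ins E0 G E : good E0 G -> good (labs E ++ E0) (ins E G).
Proof.
move=> gG; split=> [h t ps hI hE|t t' ps h|t ps ps' h|t a b ps|a b c t ps|a b c t ps
   |a b c d e t ps|t a b ps].
- have [N hN] := belowP (avoid E0 E t ps).
  have [inj fr] := fresh_addn E hN.
  have hl : {in labs E, forall a, h a = a} by move=> a aE; apply: hE; rewrite mem_cat aE.
  have hE0 : {in E0, forall a, h a = a} by move=> a aE; apply: hE; rewrite mem_cat aE orbT.
  rewrite (ins_below gG hN) (ins_any (rho := h \o addn N) gG); last first.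
    split=> [a b aE bE /hI|a aE /=]; first exact: inj.
    have -> : avoid E0 E (map (map_tri h) t) (map (map_pair h) ps) = map h (avoid E0 E t ps).
      rewrite /avoid names_map !map_cat; congr (_ ++ _); last congr (_ ++ _).
        by rewrite -[LHS]map_id; apply/eq_in_map => b /hE0 ->.
      by rewrite -[LHS]map_id; apply/eq_in_map => b /hl ->.
    by rewrite mem_map //; exact: fr.
  rewrite attach_map // (g_ren gG) //.
- have [N] := belowP (avoid E0 E t ps ++ avoid E0 E t' ps).
  rewrite below_cat => /andP[h1 h2].
  rewrite (ins_below gG h1) (ins_below gG h2); apply: (g_t gG).
  by rewrite perm_cat2l.
- have [N] := belowP (avoid E0 E t ps ++ avoid E0 E t ps').
  rewrite below_cat => /andP[h1 h2].
  rewrite (ins_below gG h1) (ins_below gG h2); apply: (g_ps gG).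
  by rewrite perm_cat2l.
- have [N] := belowP (avoid E0 E t ((a, b) :: ps) ++ avoid E0 E t ((b, a) :: ps)).
  rewrite below_cat => /andP[h1 h2].
  rewrite (ins_below gG h1) (ins_below gG h2) /attach.
  have pe (p : nat * nat) r s : perm_eq (r ++ p :: s) (p :: r ++ s).
    by rewrite -cat1s perm_catCA.
  by rewrite !(g_ps gG _ (pe _ _ _)) (g_sw gG).
- have [N] := belowP (avoid E0 E ((a, b, c) :: t) ps ++ avoid E0 E ((b, c, a) :: t) ps).
  rewrite below_cat => /andP[h1 h2].
  rewrite (ins_below gG h1) (ins_below gG h2) /attach.
  have pe (p : nat * nat * nat) r s : perm_eq (r ++ p :: s) (p :: r ++ s).
    by rewrite -cat1s perm_catCA.
  by rewrite !(g_t gG _ (pe _ _ _)) (g_rot gG).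
- have [N] := belowP (avoid E0 E ((a, b, c) :: t) ps ++ avoid E0 E ((b, a, c) :: t) ps).
  rewrite below_cat => /andP[h1 h2].
  rewrite (ins_below gG h1) (ins_below gG h2) /attach.
  have pe (p : nat * nat * nat) r s : perm_eq (r ++ p :: s) (p :: r ++ s).
    by rewrite -cat1s perm_catCA.
  by rewrite !(g_t gG _ (pe _ _ _)) (g_as gG).
- have [N] := belowP (avoid E0 E [:: (a, b, e), (e, c, d) & t] ps ++
     avoid E0 E [:: (b, c, e), (e, a, d) & t] ps ++ avoid E0 E [:: (c, a, e), (e, b, d) & t] ps).
  rewrite below_cat => /andP[h1]; rewrite below_cat => /andP[h2 h3].
  rewrite (ins_below gG h1) (ins_below gG h2) (ins_below gG h3) /attach.
  have pe (p q : nat * nat * nat) r s : perm_eq (r ++ [:: p, q & s]) [:: p, q & r ++ s].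
    by rewrite -[[:: p, q & s]]/([:: p; q] ++ s) perm_catCA.
  by rewrite !(g_t gG _ (pe _ _ _ _)) (g_ihx gG).
- rewrite mem_cat negb_or => /andP[al aE] ab.
  set t' := map _ t; set ps' := map _ ps.
  have [N] := belowP (a :: avoid E0 E t ((a, b) :: ps) ++ avoid E0 E t' ps').
  rewrite -[_ :: _]cat1s below_cat => /andP[/andP[aN _]]; rewrite below_cat => /andP[h1 h2].
  rewrite (ins_below gG h1) (ins_below gG h2) /attach.
  have pe (p : nat * nat) r s : perm_eq (r ++ p :: s) (p :: r ++ s).
    by rewrite -cat1s perm_catCA.
  rewrite (g_ps gG _ (pe _ _ _)) (g_elim gG) // !map_cat -!map_comp.
  congr (G (_ ++ _) (_ ++ _)).
    rewrite -[LHS]map_tri_comp map_tri_subst_id // tri_ends_map.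
    by apply/mapP => -[x _ e]; move: aN; rewrite e ltnNge leq_addr.
  apply/eq_in_map => l lE; rewrite /map_pair /subst /=.
  have [e|_] := eqVneq (N + l.2)%N a; first by move: aN; rewrite -e ltnNge leq_addr.
  by have [e|//] := eqVneq l.1 a; move: al; rewrite -e leg_labs.
Qed.

Lemma names_attach rho (F : graph nat) t ps :
  {subset names (map (map_tri rho) (tri F) ++ t) ([seq (rho l.2, l.1) | l <- leg F] ++ ps)
   <= names t ps ++ map rho (ends F) ++ labs F}.
Proof.
move=> a; rewrite /names tri_ends_cat pair_ends_cat tri_ends_map /ends map_cat !mem_cat.
case/or3P => [/orP[->|->]|h|->]; rewrite ?orbT //.
have : a \in map rho (unzip2 (leg F)) ++ labs F.
  rewrite /labs; elim: (leg F) h => //= l s IH.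
  rewrite /pair_ends /= -/(pair_ends _) !inE !mem_cat inE => /or3P[->//|/eqP->|/IH].
    by rewrite eqxx !orbT.
  by rewrite mem_cat => /orP[] ->; rewrite !orbT.
by rewrite mem_cat => /orP[->|->]; rewrite ?orbT.
Qed.

Lemma ins_comm E0 G E E' : good E0 G -> ins E (ins E' G) = ins E' (ins E G).
Proof.
move=> gG; apply/funext => t; apply/funext => ps.
have gE := good_ins E gG; have gE' := good_ins E' gG.
pose A := E0 ++ labs E ++ labs E' ++ names t ps.
have [N hN] := belowP A.
have [M hM] := belowP (map (addn N) (ends E)).
pose L := maxn N M.
have hL : below L A by apply: below_le hN; rewrite leq_maxl.
have hML : below L (map (addn N) (ends E)) by apply: below_le hM; rewrite leq_maxr.
have sub1 : {subset avoid (labs E' ++ E0) E t ps <= A}.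
  by move=> a; rewrite !mem_cat => /or4P[/orP[]|||] ->; rewrite ?orbT.
have sub2 : {subset avoid (labs E ++ E0) E' t ps <= A}.
  by move=> a; rewrite !mem_cat => /or4P[/orP[]|||] ->; rewrite ?orbT.
have belowS B C (l : nat) : {subset B <= C} -> below l C -> below l B.
  by move=> h /allP hC; apply/allP => a /h/hC.
rewrite (ins_any gE' (fresh_addn _ (belowS _ _ _ sub1 hN))).
rewrite (ins_any gE (fresh_addn _ (belowS _ _ _ sub2 hL))) /attach.
rewrite (ins_any (rho := addn L) gG); last first.
  apply: fresh_addn; apply: (belowS _ (A ++ map (addn N) (ends E))).
    move=> a; rewrite mem_cat => /orP[aE|]; first by rewrite !mem_cat aE.
    rewrite mem_cat => /orP[aE|/names_attach]; first by rewrite !mem_cat aE !orbT.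
    by rewrite !mem_cat => /or3P[/orP[]||] ->; rewrite ?orbT.
  by rewrite below_cat; apply/andP.
rewrite (ins_any (rho := addn N) gG); last first.
  split=> [a b _ _ /addnI //|a aE]; apply/negP.
  have /allP hN' := hN; have hNA : (N + a)%N \notin A.
    by apply/negP => /hN'; rewrite ltnNge leq_addr.
  have hNa : (N + a < L)%N by apply: (allP hML); apply: map_f.
  rewrite mem_cat => /orP[h|]; first by rewrite mem_cat h in hNA.
  rewrite mem_cat => /orP[h|/names_attach]; first by rewrite !mem_cat h !orbT in hNA.
  rewrite !mem_cat => /or3P[h|/mapP[b _ e]|h].
  - by move: hNA; rewrite /A !mem_cat h !orbT.
  - by move: hNa; rewrite e ltnNge leq_addr.
  - by move: hNA; rewrite /A !mem_cat h !orbT.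
rewrite /attach (g_t gG (t' := map (map_tri (addn N)) (tri E) ++ map (map_tri (addn L)) (tri E') ++ t)).
  by apply: (g_ps gG); rewrite perm_catCA.
by rewrite perm_catCA.
Qed.

End Contexts.

(** * Combs *)

Section Paths.
Variables (K : fieldType) (V : lmodType K).
Implicit Types (t : seq (nat * nat * nat)) (ps : seq (nat * nat)).
Implicit Types G : seq (nat * nat * nat) -> seq (nat * nat) -> V.

Definition substs (s1 s2 : seq nat) (n : nat) := nth n s2 (index n s1).

Lemma substs_id s1 s2 n : size s1 = size s2 -> n \notin s1 -> substs s1 s2 n = n.
Proof. by move=> sz h; rewrite /substs memNindex // nth_default ?sz. Qed.

Lemma g_elims E0 G t s1 s2 ps : good E0 G -> size s1 = size s2 -> uniq s1 ->
  {in s1, forall a, (a \notin E0) && (a \notin s2)} ->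
  G t (zip s1 s2 ++ ps) =
  G (map (map_tri (substs s1 s2)) t) (map (map_pair (substs s1 s2)) ps).
Proof.
move=> gG; elim: s1 s2 t ps => [|a s1 IH] [|b s2] //= t ps.
  move=> _ _ _; rewrite (@eq_map_tri _ id) ?(@eq_map_pair _ id) //.
  by congr G; rewrite -[LHS]map_id; apply: eq_map; [case=> -[]|case].
move=> [sz] /andP[as1 us1] h.
have /andP[aE] := h a (mem_head _ _); rewrite inE negb_or => /andP[ab as2].
rewrite (g_elim gG) // map_cat.
have -> : map (map_pair (subst a b)) (zip s1 s2) = zip s1 s2.
  rewrite -[RHS]map_id; apply/eq_in_map => -[c d] cd.
  have c1 : c \in s1 by rewrite -(unzip1_zip (_ : size s1 <= size s2)%N) ?sz // (map_f fst cd).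
  have d2 : d \in s2 by rewrite -(unzip2_zip (_ : size s2 <= size s1)%N) ?sz // (map_f snd cd).
  rewrite /map_pair /subst /=; have [e|_] := eqVneq c a; first by rewrite -e c1 in as1.
  by have [e|//] := eqVneq d a; rewrite -e d2 in as2.
rewrite IH // => [|c c1]; last first.
  by have := h c; rewrite inE c1 orbT inE negb_or => /(_ isT)/andP[-> /andP[_ ->]].
have bs1 : b \notin s1.
  apply/negP => /[dup] b1 bs; have := h b; rewrite inE b1 orbT => /(_ isT)/andP[_].
  by rewrite inE eqxx.
have e : substs s1 s2 \o subst a b =1 substs (a :: s1) (b :: s2).
  move=> n; rewrite /= /substs /subst /=; have [->|na] := eqVneq n a.
    by rewrite memNindex // nth_default ?sz.
  by [].
by rewrite map_tri_comp map_pair_comp (eq_map_tri _ e) (eq_map_pair _ e).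
Qed.

(** The trivalent vertices of a path that starts with the edge [x], continues
    along [fs], and has the edges [cs] attached to it. *)
Definition comb_path x (fs cs : seq nat) : seq (nat * nat * nat) :=
  zip (zip (x :: fs) fs) cs.

Lemma comb_path_cat x fs fs' cs cs' : size fs = size cs ->
  comb_path x (fs ++ fs') (cs ++ cs') = comb_path x fs cs ++ comb_path (last x fs) fs' cs'.
Proof.
elim: fs cs x => [|f fs IH] [|c cs] //= x [sz].
rewrite /comb_path /= -/(comb_path _ _ _) -/(comb_path f fs cs); congr (_ :: _).
exact: IH.
Qed.

Lemma comb_pathE x fs cs n : size fs = n -> size cs = n ->
  comb_path x fs cs = [seq (nth 0%N (x :: fs) i, nth 0%N fs i, nth 0%N cs i) | i <- iota 0 n].
Proof.
elim: fs cs x n => [|f fs IH] [|c cs] x [|n] //= [s1] [s2].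
rewrite /comb_path /= -/(comb_path _ _ _) (IH _ _ n) //; congr (_ :: _).
by rewrite -[1%N]addn0 iotaDl -map_comp; apply: eq_map => i.
Qed.

Lemma tri_ends_path_sub x fs cs a : a \in tri_ends (comb_path x fs cs) ->
  a \in x :: fs ++ cs.
Proof.
elim: fs cs x => [|f fs IH] [|c cs] x //=.
rewrite /comb_path /= -/(comb_path _ _ _) /tri_ends /= -/(tri_ends _) !inE.
move=> /or4P[->|->|/eqP->|/IH]; rewrite ?orbT //; first by rewrite mem_cat inE eqxx !orbT.
by rewrite !inE !mem_cat inE => /or3P[] ->; rewrite ?orbT.
Qed.

Definition enclose x bs z : seq nat := x :: rcons bs z.

Lemma labs_comb n (s : 'S_n) (l : seq nat) : size l = n.+2 -> labs (comb s l) = l.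
Proof.
by move=> sz; rewrite /labs; apply: unzip1_zip; rewrite sz /= size_rcons size_iota.
Qed.

Lemma ins_comb E0 G n (s : 'S_n) x bs z fs t ps : good E0 G -> size bs = n ->
  size fs = n -> uniq fs ->
  {in fs, forall a, a \notin E0 ++ enclose x bs z ++ names t ps} ->
  ins (comb s (enclose x bs z)) G t ps =
  G (comb_path x fs [seq nth 0%N bs (s i) | i <- enum 'I_n] ++ t) ((last x fs, z) :: ps).
Proof.
move=> gG sb sf uf ff; have sl : size (enclose x bs z) = n.+2 by rewrite /= size_rcons sb.
have [M] := belowP (fs ++ E0 ++ enclose x bs z ++ names t ps).
rewrite below_cat => /andP[/allP Mf /allP MA].
(* The inner edges of the comb become [fs]. The edges at the leaves get names
   above [M] and are eliminated below. *)
pose rho i := if i is j.+1 then if (j < n)%N then nth 0%N fs j else (M + i)%N else M.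
have rho_f i : (i < n)%N -> rho i.+1 \in fs.
  by move=> h; rewrite /rho h mem_nth ?sf.
have rho_hi i : (n <= i)%N -> rho i.+1 = (M + i.+1)%N by rewrite leqNgt /rho => /negPf->.
have rho_big i : rho i \notin fs -> (M <= rho i)%N.
  case: i => [|i] //; case: (ltnP i n) => h; first by rewrite rho_f.
  by rewrite rho_hi // leq_addr.
have rho_inj : injective rho.
  have aux i : rho i.+1 != rho 0%N.
    case: (ltnP i n) => h; last by rewrite rho_hi //= -[X in _ != X]addn0 eqn_add2l.
    by apply: contraTneq (Mf _ (rho_f _ h)) => ->; rewrite ltnn.
  move=> [|i] [|j] // /eqP; first by rewrite eq_sym (negPf (aux j)).
    by rewrite (negPf (aux i)).
  case: (ltnP i n) => hi; case: (ltnP j n) => hj.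
  - by rewrite /rho hi hj nth_uniq ?sf // => /eqP->.
  - by rewrite (rho_hi j) // => /eqP e; have := Mf _ (rho_f _ hi); rewrite e ltnNge leq_addr.
  - by rewrite (rho_hi i) // => /eqP e; have := Mf _ (rho_f _ hj); rewrite -e ltnNge leq_addr.
  - by rewrite !rho_hi // eqn_add2l => /eqP.
have fr : fresh rho (comb s (enclose x bs z)) (avoid E0 (comb s (enclose x bs z)) t ps).
  split=> [a b _ _|a _]; first exact: rho_inj.
  rewrite /avoid labs_comb //; case: (boolP (rho a \in fs)) => [/ff//|/rho_big h].
  by apply/negP => /MA; rewrite ltnNge h.
rewrite (ins_any gG fr) /attach.
pose s1 := map rho (0%N :: iota n.+1 n).
have us1 : uniq s1 by rewrite map_inj_uniq //= iota_uniq mem_iota.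
have sz1 : size s1 = size (x :: bs) by rewrite /= size_map size_iota sb.
have s1M a : a \in s1 -> (M <= a)%N.
  case/mapP => i; rewrite inE => /orP[/eqP-> -> //|]; rewrite mem_iota => /andP[].
  by case: i => // i hi _ ->; rewrite rho_hi // leq_addr.
have -> : [seq (rho l.2, l.1) | l <- leg (comb s (enclose x bs z))] =
    zip s1 (x :: bs) ++ [:: (rho n, z)].
  rewrite /= /enclose; congr (_ :: _); rewrite -!cats1 zip_cat ?size_iota //.
  rewrite map_cat /=; congr (_ ++ _); move: (iota _ _) => r.
  by elim: bs r {sb sl ff fr sz1 MA} => [|b bs' IH] [|c r] //=; rewrite IH.
rewrite -catA (g_elims _ _ gG) //; last first.
  move=> a /s1M aM; apply/andP; split; apply/negP => h.
    by have := MA a; rewrite mem_cat h => /(_ isT); rewrite ltnNge aM.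
  have := MA a; rewrite !mem_cat /enclose inE mem_rcons inE.
  move: h; rewrite inE => /orP[] ->; rewrite !orbT => /(_ isT); rewrite ltnNge aM //.
have idA a : (a < M)%N -> substs s1 (x :: bs) a = a.
  by move=> h; apply: substs_id => //; apply/negP => /s1M; rewrite leqNgt h.
rewrite map_cat /=.
have -> : map (map_pair (substs s1 (x :: bs))) ps = ps.
  by apply: map_pair_id_in => a h; apply: idA; apply: MA; rewrite !mem_cat h !orbT.
have -> : map (map_tri (substs s1 (x :: bs))) t = t.
  by apply: map_tri_id_in => a h; apply: idA; apply: MA; rewrite !mem_cat h !orbT.
have r0 : substs s1 (x :: bs) (rho 0%N) = x by rewrite /substs /= eqxx.
have rf i : (i < n)%N -> substs s1 (x :: bs) (rho i.+1) = nth 0%N fs i.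
  by move=> h; rewrite idA ?Mf ?rho_f // /rho h.
have rl i : (i < n)%N -> substs s1 (x :: bs) (rho (n.+1 + i)%N) = nth 0%N bs i.
  move=> h; rewrite /substs /s1 index_map //.
  have -> : index (n.+1 + i)%N (0%N :: iota n.+1 n) = i.+1.
    rewrite /=; congr _.+1.
    by rewrite -[X in index X _](@nth_iota 0 n.+1 n i) // index_uniq ?size_iota ?iota_uniq.
  by rewrite /=; apply: set_nth_default; rewrite sb.
have -> : map_pair (substs s1 (x :: bs)) (rho n, z) = (last x fs, z).
  congr (_, _) => /=.
    case: (n) sf rf => [/size0nil-> //|n' sf rf]; rewrite rf // -nth_last sf.
    by apply: set_nth_default; rewrite sf.
  by apply: idA; apply: MA; rewrite !mem_cat /enclose inE mem_rcons mem_head !orbT.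
congr (G (_ ++ _)).
pose cs := [seq nth 0%N bs (s i) | i <- enum 'I_n].
have csE (i : 'I_n) : nth 0%N bs (s i) = nth 0%N cs i.
  by rewrite (nth_map i) ?size_enum_ord // nth_ord_enum.
have sc : size cs = n by rewrite size_map size_enum_ord.
rewrite -/cs (comb_pathE _ sf sc) -val_enum_ord -map_comp -map_comp -[RHS]map_comp.
apply/eq_in_map => i _; rewrite /map_tri /=.
rewrite rf // rl // csE; congr (_, _, _).
case: i => -[|i] hi; first exact: r0.
by apply: rf; apply: ltnW.
Qed.

(** The comb with the first leaf [x], the last leaf [z] and the others [bs] in
    their order along the path. *)
Definition spine x bs z G := ins (comb (1%g : 'S_(size bs)) (enclose x bs z)) G.

Lemma spine_path E0 G x bs z fs t ps : good E0 G -> size fs = size bs -> uniq fs ->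
  {in fs, forall a, a \notin E0 ++ enclose x bs z ++ names t ps} ->
  spine x bs z G t ps = G (comb_path x fs bs ++ t) ((last x fs, z) :: ps).
Proof.
move=> gG sf uf ff; rewrite /spine (@ins_comb E0 _ _ _ _ _ _ fs) //.
congr (G (comb_path x fs _ ++ t)).
rewrite -[RHS](mkseq_nth 0%N) /mkseq -val_enum_ord -map_comp.
by apply: eq_map => i /=; rewrite perm1.
Qed.

Lemma fresh_seq n (A : seq nat) :
  exists fs, [/\ size fs = n, uniq fs & {in fs, forall a, a \notin A}].
Proof.
have [N /allP hN] := belowP A; exists (iota N n); rewrite size_iota iota_uniq.
split=> // a; rewrite mem_iota => /andP[h _]; apply/negP => /hN.
by rewrite ltnNge h.
Qed.

Lemma ins_comb_spine E0 G n (s : 'S_n) x bs z : good E0 G -> size bs = n ->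
  ins (comb s (enclose x bs z)) G = spine x [seq nth 0%N bs (s i) | i <- enum 'I_n] z G.
Proof.
move=> gG sb; apply/funext => t; apply/funext => ps.
have [fs [sf uf ff]] := fresh_seq n (E0 ++ enclose x bs z ++ names t ps).
have sc : size [seq nth 0%N bs (s i) | i <- enum 'I_n] = n by rewrite size_map size_enum_ord.
rewrite (ins_comb _ gG sb sf uf ff) (spine_path (fs := fs) gG) ?sc //.
move=> a /ff; apply: contra; rewrite !mem_cat /enclose !inE !mem_rcons !inE.
case/or3P => [->|/or3P[->|->|/mapP[i _ ->]]|->]; rewrite ?orbT //.
by rewrite mem_nth ?orbT // sb.
Qed.

End Paths.

(** * Relations between combs *)

Ltac mem_cases := rewrite /enclose /names ?(mem_cat, inE, mem_rcons, mem_rev);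
  repeat (match goal with
    | |- context [?a \in ?s] => case: (a \in s)
    | |- context [?a == ?b] => case: (a == b)
    end; rewrite /= ?orbT ?orbF //).

Section PathRelations.
Variables (K : fieldType) (V : lmodType K).
Variables (E0 : seq nat) (G : seq (nat * nat * nat) -> seq (nat * nat) -> V).
Hypothesis gG : good E0 G.
Implicit Types (t : seq (nat * nat * nat)) (ps : seq (nat * nat)).

Lemma tri_move p (r s : seq (nat * nat * nat)) ps : G (r ++ p :: s) ps = G (p :: r ++ s) ps.
Proof. by apply: (g_t gG); rewrite -cat1s perm_catCA. Qed.

Lemma tri_swap p q (s : seq (nat * nat * nat)) ps : G [:: p, q & s] ps = G [:: q, p & s] ps.
Proof. exact: (tri_move _ [:: p]). Qed.

(** AS at the first vertex. *)
Lemma spine_antisym x b bs z t ps :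
  spine x (b :: bs) z G t ps = - spine b (x :: bs) z G t ps.
Proof.
have [fs [sf uf ff]] := fresh_seq (size bs).+1 (E0 ++ enclose x (b :: bs) z ++ names t ps).
rewrite (spine_path (fs := fs) gG) // (spine_path (fs := fs) gG) //; last first.
  by move=> a /ff; apply: contra; mem_cases.
case: fs sf {uf ff} => // f fs [sf]; rewrite /comb_path /= -/(comb_path _ _ _).
by rewrite (g_rot gG) (g_as gG) -(g_rot gG) (g_rot gG) (g_rot gG).
Qed.

(** This only reads the first vertex of the path as a part of [t]. *)
Lemma spine_first s a b bs z t ps : s \notin E0 ++ enclose a (b :: bs) z ++ names t ps ->
  spine a (b :: bs) z G t ps = spine s bs z G ((s, b, a) :: t) ps.
Proof.
move=> sf.
have [fs [zf uf ff]] := fresh_seq (size bs) (s :: E0 ++ enclose a (b :: bs) z ++ names t ps).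
rewrite (spine_path (fs := s :: fs) gG) /=; last first.
- move=> c; rewrite inE => /orP[/eqP-> //|/ff]; by rewrite inE negb_or => /andP[].
- by rewrite uf andbT; apply/negP => /ff; rewrite mem_head.
- by rewrite zf.
rewrite (spine_path (fs := fs) gG) //; last first.
  move=> c /ff; apply: contra; rewrite !mem_cat /names /tri_ends /= -/(tri_ends _).
  by mem_cases.
by rewrite tri_move /comb_path /= -/(comb_path _ _ _) (g_rot gG).
Qed.

(** IHX at the edge between the two vertices. *)
Lemma spine_comm s x u a b v z t ps :
  s \notin E0 ++ enclose x (u ++ a :: b :: v) z ++ names t ps ->
  spine x (u ++ a :: b :: v) z G t ps - spine x (u ++ b :: a :: v) z G t ps =
  spine x (u ++ s :: v) z G ((s, b, a) :: t) ps.
Proof.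
move=> sf; set A := E0 ++ enclose x (u ++ a :: b :: v) z ++ names t ps in sf.
have [fs [zf uf ff]] := fresh_seq (size u + (size v).+1) (s :: A).
have [fu [g [fv [efs zu zv]]]] : exists fu g fv,
    [/\ fs = fu ++ g :: fv, size fu = size u & size fv = size v].
  exists (take (size u) fs), (nth 0%N fs (size u)), (drop (size u).+1 fs).
  have h : (size u < size fs)%N by rewrite zf addnS ltnS leq_addr.
  rewrite -drop_nth // cat_take_drop size_takel ?(ltnW h) // size_drop zf; split=> //.
  by rewrite addnS subSS addKn.
have memA c : (c \in A) = [|| c \in E0, c == x, c == z, c \in u, c == a, c == b, c \in v | c \in names t ps].
  by rewrite /A; mem_cases.
have memA2 : E0 ++ enclose x (u ++ b :: a :: v) z ++ names t ps =i A.
  by move=> c; rewrite memA; mem_cases.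
have memA3 c : c \in E0 ++ enclose x (u ++ s :: v) z ++ names ((s, b, a) :: t) ps ->
    c \in s :: A.
  rewrite inE memA /names /tri_ends /= -/(tri_ends _); by mem_cases.
have u2 : uniq (fu ++ [:: s, g & fv]).
  rewrite -cat1s uniq_catCA /= -efs uf andbT.
  by apply/negP => /ff; rewrite mem_head.
have ff2 : {in fu ++ [:: s, g & fv], forall c, c \notin A}.
  move=> c h; have : (c == s) || (c \in fs) by move: h; rewrite efs; mem_cases.
  by case/orP => [/eqP-> //|/ff]; rewrite inE negb_or => /andP[].
have z2 w : size w = (size v).+2 -> size (fu ++ [:: s, g & fv]) = size (u ++ w).
  by move=> zw; rewrite !size_cat /= zw zu zv.
rewrite (spine_path (fs := fu ++ [:: s, g & fv]) gG (z2 [:: a, b & v] erefl)) //.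
rewrite (spine_path (fs := fu ++ [:: s, g & fv]) gG (z2 [:: b, a & v] erefl)) //; last first.
  by move=> c /ff2; rewrite memA2.
rewrite (spine_path (fs := fu ++ g :: fv) gG) -?efs //; last first.
- by move=> c /ff; apply: contra => /memA3.
- by rewrite zf size_cat.
rewrite efs !comb_path_cat // !last_cat /=; set y := last x fu.
rewrite /comb_path /= -!/(comb_path _ _ _) -!catA !cat_cons.
set q := comb_path x fu u; set r := comb_path g fv v ++ t.
have mv2 p p' : G (q ++ [:: p, p' & r]) ((last g fv, z) :: ps) =
    G [:: p, p' & q ++ r] ((last g fv, z) :: ps).
  by rewrite tri_move -cat_cons tri_move tri_swap.
rewrite !mv2 (_ : G (q ++ _) _ = G [:: (y, g, s), (s, b, a) & q ++ r] ((last g fv, z) :: ps)); last first.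
  rewrite tri_move; have -> : (y, g, s) :: q ++ comb_path g fv v ++ (s, b, a) :: t =
     ((y, g, s) :: q ++ comb_path g fv v) ++ (s, b, a) :: t by rewrite cat_cons -catA.
  by rewrite tri_move /= tri_swap /r catA.
move: (_ ++ r) (_ :: ps) => T S.
have rot2 p a' b' c' : G [:: p, (a', b', c') & T] S = G [:: p, (b', c', a') & T] S.
  by rewrite tri_swap (g_rot gG) tri_swap.
have as2 p a' b' c' : G [:: p, (a', b', c') & T] S = - G [:: p, (b', a', c') & T] S.
  by rewrite tri_swap (g_as gG) tri_swap.
have e1 : G [:: (y, s, a), (s, g, b) & T] S = - G [:: (a, y, s), (s, b, g) & T] S.
  by rewrite 2!(g_rot gG) as2 rot2.
have e2 : G [:: (y, s, b), (s, g, a) & T] S = G [:: (y, b, s), (s, a, g) & T] S.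
  by rewrite 2!(g_rot gG) (g_as gG) as2 rot2 opprK.
have e3 : G [:: (y, g, s), (s, b, a) & T] S = G [:: (b, a, s), (s, y, g) & T] S.
  by rewrite 2!(g_rot gG) rot2 tri_swap.
(* These are the three terms of IHX with the shared edge [s]. *)
rewrite e1 e2 e3 -opprD; apply/eqP; rewrite eq_sym -addr_eq0 addrC.
by have := g_ihx gG a y b g s T S => ->.
Qed.

Definition flip (v : nat * nat * nat) := (v.1.2, v.1.1, v.2).

Lemma flip_sign (q : seq (nat * nat * nat)) t ps :
  G (map flip q ++ t) ps = (-1) ^+ size q *: G (q ++ t) ps.
Proof.
elim: q t => [|[[a b] c] q IH] t /=; first by rewrite expr0 scale1r.
rewrite /flip /= (g_as gG) -tri_move IH tri_move exprS mulN1r scaleNr //.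
Qed.

Lemma spine_path2 x bs c z fs t ps : size fs = size bs -> uniq fs ->
  {in fs, forall a, a \notin E0 ++ enclose x (rcons bs c) z ++ names t ps} ->
  spine x (rcons bs c) z G t ps =
  G (zip (zip (x :: fs) (rcons fs z)) (rcons bs c) ++ t) ps.
Proof.
move=> sf uf ff.
have [fs1 [sz1 _ f_fresh]] :=
  fresh_seq 1 (fs ++ E0 ++ enclose x (rcons bs c) z ++ names t ps).
case: fs1 sz1 f_fresh => [|f [|]] // _ f_fresh.
have {}f_fresh : f \notin fs ++ E0 ++ enclose x (rcons bs c) z ++ names t ps.
  by apply: f_fresh; rewrite mem_head.
move: f_fresh; rewrite mem_cat negb_or => /andP[ffs ffr].
rewrite (spine_path (fs := rcons fs f) gG) ?size_rcons ?sf ?rcons_uniq ?ffs //; last first.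
  by move=> a; rewrite mem_rcons inE => /orP[/eqP->|/ff].
rewrite last_rcons.
move: ffr; rewrite mem_cat negb_or => /andP[fE]; rewrite mem_cat negb_or => /andP[fw fn].
move: fw; rewrite inE negb_or => /andP[fx]; rewrite mem_rcons inE negb_or => /andP[fz fb].
(* The last edge [f] of the path is eliminated in favour of [z]. *)
rewrite (g_elim gG) // map_cat; congr (G (_ ++ _)).
- have e : zip (zip (x :: fs) (rcons fs z)) (rcons bs c) = comb_path x fs bs ++ [:: (last x fs, z, c)].
    rewrite -!cats1 /comb_path.
    elim: (fs) (bs) x sf {uf ff ffs fx fb} => [|f' fs' IH] [|b' bs'] //= x [sf].
    by rewrite IH.
  have e' : comb_path x (rcons fs f) (rcons bs c) = comb_path x fs bs ++ [:: (last x fs, f, c)].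
    by rewrite -!cats1 comb_path_cat.
  have hc : c \in rcons bs c by rewrite mem_rcons mem_head.
  have sub_id a : a \in x :: fs ++ rcons bs c -> subst f z a = a.
    move=> h; rewrite /subst; case: eqP => // ea; move: h; rewrite ea inE (negPf fx) mem_cat.
    by rewrite (negPf ffs) (negPf fb).
  rewrite e e' map_cat; congr (_ ++ _).
    apply: map_tri_id_in => a /tri_ends_path_sub h; apply: sub_id.
    move: h; rewrite !inE !mem_cat mem_rcons inE => /or3P[] ->; rewrite ?orbT //.
  rewrite /= /map_tri /= (sub_id c) ?(sub_id (last x fs)) ?/subst ?eqxx //.
    by rewrite -cat_cons mem_cat mem_last.
  by rewrite inE mem_cat hc !orbT.
- rewrite map_tri_subst_id //; apply: contra fn; by rewrite /names mem_cat => ->.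
- apply: map_pair_id_in => a h; rewrite /subst; case: eqP => // ea.
  by move: fn; rewrite /names mem_cat -ea h orbT.
Qed.

Lemma zip_rev_path x z (fs cs : seq nat) : size cs = (size fs).+1 ->
  zip (zip (z :: rev fs) (rcons (rev fs) x)) (rev cs) =
  rev (map flip (zip (zip (x :: fs) (rcons fs z)) cs)).
Proof.
move=> sz.
have flipE (r s c : seq nat) : zip (zip r s) c = map flip (zip (zip s r) c).
  by elim: r s c => [|a r IH] [|b s] [|d c] //=; congr (_ :: _); exact: IH.
have -> : z :: rev fs = rev (rcons fs z) by rewrite rev_rcons.
rewrite -rev_cons -!rev_zip ?size_zip ?size_rcons -?[size (x :: fs)]/((size fs).+1) ?sz ?minnn //.
congr rev; exact: flipE.
Qed.

(** Read from the other end, every vertex of the path has the opposite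
    orientation. *)
Lemma spine_rev x bs z t ps :
  spine x bs z G t ps = (-1) ^+ size bs *: spine z (rev bs) x G t ps.
Proof.
case: (lastP bs) => [|{}bs c].
  by rewrite !(spine_path (fs := [::]) gG) //= expr0 scale1r (g_sw gG).
have [fs [sf uf ff]] := fresh_seq (size bs) (E0 ++ enclose x (rcons bs c) z ++ names t ps).
rewrite (spine_path2 sf uf ff).
have [b [r [er sr]]] : exists b r, rev (rcons bs c) = rcons r b /\ size r = size bs.
  case: bs {sf ff} => [|b bs]; first by exists c, [::].
  by exists b, (c :: rev bs); rewrite rev_rcons rev_cons /= size_rev.
rewrite er (@spine_path2 z r b x (rev fs)) ?rev_uniq ?size_rev ?sr //; last first.
  move=> a; rewrite mem_rev => /ff; apply: contra; rewrite -er; by mem_cases.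
rewrite -er zip_rev_path ?size_rcons ?sf //.
rewrite [X in _ *: X](g_t gG (t' := map flip (zip (zip (x :: fs) (rcons fs z)) (rcons bs c)) ++ t)); last first.
  by rewrite perm_cat2r perm_rev.
rewrite flip_sign scalerA !size_zip /= !size_rcons sf !minnn -exprMn.
by rewrite mulrNN mulr1 expr1n scale1r.
Qed.

End PathRelations.

(** * Descents of words *)

Section Words.
Local Open Scope nat_scope.
Implicit Types w u v : seq nat.

Fixpoint des w : nat :=
  if w is x :: r then (if r is y :: _ then (y < x : nat) else 0) + des r else 0.

Fixpoint adj a b w : nat :=
  if w is x :: r then
    (if r is y :: _ then ((x == a) && (y == b) : nat) else 0) + adj a b r
  else 0.

Definition words n := permutations (iota 0 n).

Lemma mem_words n w : (w \in words n) = perm_eq w (iota 0 n).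
Proof. by rewrite /words mem_permutations perm_sym. Qed.

Lemma words_size n w : w \in words n -> size w = n.
Proof. by rewrite mem_words => /perm_size; rewrite size_iota. Qed.

Lemma words_uniq n w : w \in words n -> uniq w.
Proof. by rewrite mem_words => /perm_uniq; rewrite iota_uniq. Qed.

Lemma words_mem n w i : w \in words n -> (i \in w) = (i < n).
Proof. by rewrite mem_words => /perm_mem->; rewrite mem_iota. Qed.

Lemma words_intro n w : uniq w -> size w = n -> {in w, forall i, i < n} -> w \in words n.
Proof.
move=> uw sw h; rewrite mem_words; apply: uniq_perm; rewrite ?iota_uniq //.
have sub : {subset w <= iota 0 n} by move=> i /h; rewrite mem_iota.
by have [//|_ e] := uniq_min_size uw sub; rewrite ?size_iota ?sw.
Qed.

Lemma perm_map_words n (g : seq nat -> seq nat) :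
  {in words n &, injective g} -> {in words n, forall w, g w \in words n} ->
  perm_eq (map g (words n)) (words n).
Proof.
move=> gI gW; have ug : uniq (map g (words n)) by rewrite map_inj_in_uniq ?permutations_uniq.
have sub : {subset map g (words n) <= words n} by move=> x /mapP[w /gW h ->].
apply: uniq_perm; rewrite ?permutations_uniq //.
by have [//|] := uniq_min_size ug sub; rewrite ?size_map.
Qed.

(** * Descents and cyclic rotations *)

Lemma des_cons2 x y w : des [:: x, y & w] = (y < x) + des (y :: w).
Proof. by []. Qed.

Lemma adj_cons2 a b x y w :
  adj a b [:: x, y & w] = ((x == a) && (y == b)) + adj a b (y :: w).
Proof. by []. Qed.

Lemma des_cat x y u v :
  des (rcons u x ++ y :: v) = des (rcons u x) + (y < x) + des (y :: v).
Proof.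
elim: u => [|a u IH]; first by rewrite [RHS]/= !add0n.
rewrite rcons_cons cat_cons [LHS]/= [des (a :: _)]/= -!/(des _) IH -!addnA; congr (_ + _).
by case: u {IH}.
Qed.

Lemma des_le x w : des (x :: w) <= size w.
Proof.
elim: w x => //= y w IH x; have := IH y => /=; case: (y < x) => /=; lia.
Qed.

Lemma des_max x w : des (x :: w) = size w -> last x w <= x.
Proof.
elim: w x => //= y w IH x; have := des_le y w => /=; have := IH y => /=.
by case: (ltnP y x) => /= h h1 h2 h3; [apply: leq_trans (h1 _) (ltnW h); lia|lia].
Qed.

Lemma des_min x w : des (x :: w) = 0 -> x <= last x w.
Proof.
elim: w x => //= y w IH x; have := IH y => /=.
case: (ltnP y x) => //= h h1 /h1; exact: leq_trans.
Qed.

(** [cut w k] tells whether the cyclic word [w] descends at its [k]-th gap. *)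
Definition cut w k : bool := nth 0 w k < (if k is j.+1 then nth 0 w j else last 0 w).

Lemma des_rot w k : k < size w -> des (rot k w) + cut w k = des w + cut w 0.
Proof.
case: k => [|k] h; first by rewrite rot0.
have := cat_take_drop k.+1 w; rewrite /rot.
have st : size (take k.+1 w) = k.+1 by rewrite size_takel // ltnW.
have sd : 0 < size (drop k.+1 w) by rewrite size_drop subn_gt0.
case/lastP: (take k.+1 w) st => [//|u a]; rewrite size_rcons => -[su].
case/lastP: (drop k.+1 w) sd => [//|v b] _ ew.
rewrite /cut -ew.
have -> : nth 0 (rcons u a ++ rcons v b) k.+1 = head b v.
  by rewrite nth_cat size_rcons su ltnn subnn nth0; case: (v).
have -> : nth 0 (rcons u a ++ rcons v b) k = a.
  by rewrite nth_cat size_rcons su ltnSn nth_rcons su ltnn eqxx.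
have -> : nth 0 (rcons u a ++ rcons v b) 0 = head a u by case: (u).
have -> : last 0 (rcons u a ++ rcons v b) = b by rewrite last_cat last_rcons.
have eu : rcons u a = head a u :: behead (rcons u a) by case: (u).
have ev : rcons v b = head b v :: behead (rcons v b) by case: (v).
rewrite {1}eu des_cat -eu {2}ev des_cat -ev.
by lia.
Qed.

Lemma des_sum_cut w : des w + cut w 0 = \sum_(k < size w) cut w k.
Proof.
case: w => [|x w]; first by rewrite big_ord0 /cut.
rewrite big_ord_recl addnC; congr (_ + _).
elim: w x => [|y w IH] x; first by rewrite big_ord0.
rewrite [size _]/= big_ord_recl des_cons2 IH; congr (_ + _).
Qed.

(** A cyclic word with distinct letters has both a descent and an ascent. *)
Lemma cut_bounds w : uniq w -> 1 < size w -> 0 < des w + cut w 0 < size w.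
Proof.
case: w => [|x [|y w]] // uw _; rewrite /cut [nth _ _ _]/= [last _ _]/=.
have lx : last y w != x.
  by apply: contraTneq uw => <-; rewrite /= mem_last.
have h3 : des [:: x, y & w] = 0 -> x <= last y w := @des_min x (y :: w).
have h2 : des [:: x, y & w] = (size w).+1 -> last y w <= x := @des_max x (y :: w).
have h1 : des [:: x, y & w] <= (size w).+1 := des_le x (y :: w).
move: (des _) (last _ _) lx h1 h2 h3 => d l lx h1 h2 h3.
apply/andP; split.
  case: d h1 h2 h3 => // _ _ /(_ erefl) h.
  by have -> : x < l by rewrite ltn_neqAle h andbT eq_sym.
case: (ltnP x l) => /= hx; last by rewrite addn0 ltnS.
rewrite addn1 ltnS ltn_neqAle h1 andbT; apply/eqP => /h2; by rewrite leqNgt hx.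
Qed.

(** * Exchange of two consecutive letters *)

Definition swp i x := if x == i then i.+1 else if x == i.+1 then i else x.

Lemma swpK i : involutive (swp i).
Proof.
move=> x; rewrite /swp; have [->|xi] := eqVneq x i.
  by rewrite eqn_leq ltnn /= eqxx.
have [->|xi'] := eqVneq x i.+1; first by rewrite eqxx.
by rewrite (negPf xi) (negPf xi').
Qed.

Lemma swp_inj i : injective (swp i). Proof. exact: inv_inj (swpK i). Qed.

Lemma swp_lt i x y : x != y ->
  (swp i y < swp i x) + ((x == i.+1) && (y == i)) = (y < x) + ((x == i) && (y == i.+1)).
Proof.
rewrite /swp => xy.
case: (eqVneq x i) => [ex|nx]; case: (eqVneq y i) => [ey|ny];
 case: (eqVneq x i.+1) => [ex'|nx']; case: (eqVneq y i.+1) => [ey'|ny'] /=; lia.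
Qed.

Lemma des_swp i w : uniq w ->
  des (map (swp i) w) + adj i.+1 i w = des w + adj i i.+1 w.
Proof.
elim: w => //= x [|y w] IH //= /andP[xw uw]; have := IH uw; rewrite /= => {}IH.
have xy : x != y by apply: contraNneq xw => ->; rewrite mem_head.
have := swp_lt i xy; lia.
Qed.

Lemma adj_swp i w : adj i.+1 i (map (swp i) w) = adj i i.+1 w.
Proof.
elim: w => // x [|y w] IH //; rewrite adj_cons2 -IH !map_cons adj_cons2; congr (_ + _).
by rewrite /swp; case: (eqVneq x i) => ex; case: (eqVneq y i) => ey;
  case: (eqVneq x i.+1) => ex'; case: (eqVneq y i.+1) => ey' /=; lia.
Qed.

Lemma adj_notin1 a b w : a \notin w -> adj a b w = 0.
Proof.
elim: w => //= x w IH; rewrite inE negb_or eq_sym => /andP[xa /IH->].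
by rewrite addn0; case: w {IH} => // y w; rewrite (negPf xa).
Qed.

Lemma adj_notin2 a b w : b \notin w -> adj a b w = 0.
Proof.
elim: w => //= x w IH; rewrite inE negb_or => /andP[_ bw]; rewrite IH //.
rewrite addn0; case: w bw {IH} => // y w; rewrite inE negb_or eq_sym => /andP[/negPf-> _].
by rewrite andbF.
Qed.

Lemma adj_cat a b u v : uniq (u ++ a :: b :: v) ->
  (adj a b (u ++ a :: b :: v) = 1) /\ (adj b a (u ++ a :: b :: v) = 0).
Proof.
elim: u => [|x u IH].
  rewrite cat0s [uniq _]/= inE negb_or => /andP[/andP[ab av] /andP[bv uv]].
  have abv : a \notin b :: v by rewrite inE negb_or ab.
  rewrite adj_cons2 (adj_notin1 _ abv) !eqxx.
  by rewrite adj_cons2 (adj_notin2 _ abv) (negPf ab).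
rewrite cat_cons [uniq _]/= => /andP[xw /IH[e1 e2]].
have xa : (x == a) = false by apply: contraNF xw => /eqP->; rewrite mem_cat mem_head orbT.
have xb : (x == b) = false.
  by apply: contraNF xw => /eqP->; rewrite mem_cat !inE eqxx !orbT.
by rewrite [adj a _ _]/= [adj b _ _]/= -/(adj _ _ _) e1 e2 xa xb; case: (u ++ _).
Qed.

Lemma adj_split a b w : adj a b w != 0 -> exists u v, w = u ++ a :: b :: v.
Proof.
elim: w => // x [|y w] IH //; rewrite adj_cons2.
case: (boolP ((x == a) && (y == b))) => [/andP[/eqP-> /eqP->] _|_].
  by exists [::], w.
by rewrite add0n => /IH[u [v ->]]; exists (x :: u), v.
Qed.

(** Inverse to the merging of two consecutive letters: the words of [words m.+1]
    in which [i] is followed by [i.+1] arise from [words m] in this way. *)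
Definition split_letter i w : seq nat :=
  flatten [seq if y == i then [:: i; i.+1] else [:: bump i.+1 y] | y <- w].

Lemma split_letter_cons i y w : split_letter i (y :: w) =
  (if y == i then [:: i; i.+1] else [:: bump i.+1 y]) ++ split_letter i w.
Proof. by []. Qed.

Lemma split_letter_cat i u v :
  split_letter i (u ++ v) = split_letter i u ++ split_letter i v.
Proof. by rewrite /split_letter map_cat flatten_cat. Qed.

Lemma split_letter_id i u : i \notin u -> split_letter i u = map (bump i.+1) u.
Proof.
elim: u => //= y u IH; rewrite inE negb_or => /andP[yi /IH e].
by rewrite split_letter_cons e eq_sym (negPf yi).
Qed.

Lemma split_letter_mid i u v : i \notin u -> i \notin v ->
  split_letter i (u ++ i :: v) = map (bump i.+1) u ++ i :: i.+1 :: map (bump i.+1) v.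
Proof.
move=> iu iv; rewrite split_letter_cat split_letter_cons eqxx /=.
by rewrite !split_letter_id.
Qed.

Lemma word_split m i w : w \in words m -> i < m ->
  exists u v, [/\ w = u ++ i :: v, i \notin u & i \notin v].
Proof.
move=> ww im; have uw := words_uniq ww.
have iw : i \in w by rewrite (words_mem _ ww).
case/splitPr: iw uw => u v; rewrite -cat1s uniq_catCA /= mem_cat negb_or.
by case/andP => /andP[h1 h2] _; exists u, v.
Qed.

Lemma des_split_letter i w : uniq w -> des (split_letter i w) = des w.
Proof.
elim: w => // x w IH /andP[xw uw]; rewrite split_letter_cons.
have {}IH := IH uw.
have bump_i : bump i.+1 i = i by rewrite /bump ltnn.
case: w xw uw IH => [|y w] xw uw IH; first by case: ifP => //= _; rewrite ltnNge leqnSn.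
have [h [r er]] : exists h r, split_letter i (y :: w) = h :: r /\ h = bump i.+1 y.
  rewrite split_letter_cons; case: (eqVneq y i) => [->|_].
    by exists i, (i.+1 :: split_letter i w); rewrite bump_i.
  by exists (bump i.+1 y), (split_letter i w).
case: er => er eh; rewrite er in IH *.
have xy : x != y by apply: contraNneq xw => ->; rewrite mem_head.
rewrite des_cons2 -IH; case: (eqVneq x i) => [ex|nx] /=; rewrite eh /bump; lia.
Qed.

Lemma split_letter_inj m i : i < m -> {in words m &, injective (split_letter i)}.
Proof.
move=> im w w' ww ww'.
have K v : v \in words m -> map (unbump i.+1) (filter (predC1 i.+1) (split_letter i v)) = v.
  move=> vw; have [u1 [u2 [-> h1 h2]]] := word_split vw im.
  have e u : map (unbump i.+1) (filter (predC1 i.+1) (map (bump i.+1) u)) = u.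
    have /all_filterP-> : all (predC1 i.+1) (map (bump i.+1) u).
      by rewrite all_map; apply/allP => x _ /=; rewrite eq_sym neq_bump.
    by rewrite -map_comp -[RHS]map_id; apply: eq_map; exact: bumpK.
  rewrite split_letter_mid // filter_cat /= eqn_leq ltnn andbF eqxx /= map_cat /=.
  by rewrite !e /unbump ltnNge leqnSn subn0.
by move=> e; rewrite -(K w) // -(K w') // e.
Qed.

Lemma split_letter_words m i w : i < m -> w \in words m ->
  (split_letter i w \in words m.+1) && (adj i i.+1 (split_letter i w) != 0).
Proof.
move=> im ww; have [u [v [ew iu iv]]] := word_split ww im.
have uw := words_uniq ww; have zw := words_size ww.
have us : uniq (split_letter i w).
  rewrite ew split_letter_mid // -[i :: _]/([:: i; i.+1] ++ _) uniq_catCA.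
  rewrite -map_cat cat_uniq map_inj_uniq; last exact: can_inj (bumpK _).
  have -> : uniq (u ++ v) by move: uw; rewrite ew -cat1s uniq_catCA => /andP[].
  rewrite andbT /= inE eqn_leq ltnn andbF andbT; apply/hasPn => x /mapP[y yuv ->].
  rewrite !inE; apply/norP; split; last by rewrite eq_sym neq_bump.
  apply: contraTneq yuv => e; have ey : y = i.
    by apply: (can_inj (bumpK i.+1)); rewrite e /bump ltnn.
  by rewrite ey mem_cat negb_or iu.
apply/andP; split; last first.
  by move: us; rewrite ew split_letter_mid // => /adj_cat[-> _].
apply: words_intro => //.
  rewrite -zw ew split_letter_mid // !size_cat /= !size_map; lia.
have hw x : x \in w -> x < m by rewrite (words_mem _ ww).
rewrite ew split_letter_mid // => x; rewrite mem_cat !inE.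
have hb y : y \in w -> bump i.+1 y < m.+1 by move/hw; rewrite /bump; lia.
case/or4P => [/mapP[y yu ->]|/eqP->|/eqP->|/mapP[y yv ->]].
- by apply: hb; rewrite ew mem_cat yu.
- by lia.
- by lia.
- by apply: hb; rewrite ew mem_cat inE yv !orbT.
Qed.

Lemma split_letter_surj m i w : w \in words m.+1 -> adj i i.+1 w != 0 ->
  exists2 w', w' \in words m & w = split_letter i w'.
Proof.
move=> ww /adj_split[u [v ew]].
have uw := words_uniq ww; have zw := words_size ww.
have := uw; rewrite ew -[i :: _]/([:: i; i.+1] ++ _) uniq_catCA cat_uniq => /and3P[_ nin uuv].
have ni : i \notin u ++ v.
  by apply: contra nin => h; apply/hasP; exists i; rewrite // !inE eqxx.
have ni' : i.+1 \notin u ++ v.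
  by apply: contra nin => h; apply/hasP; exists i.+1; rewrite // !inE eqxx orbT.
have K s : {subset s <= u ++ v} -> map (bump i.+1) (map (unbump i.+1) s) = s.
  move=> hs; rewrite -map_comp -[RHS]map_id; apply/eq_in_map => x /hs xs /=.
  by apply: unbumpK; rewrite inE; apply: contraNneq ni' => <-.
have nu s : {subset s <= u ++ v} -> i \notin map (unbump i.+1) s.
  move=> hs; apply/negP => /(map_f (bump i.+1)); rewrite K // => /hs.
  by rewrite /bump ltnn => h; rewrite h in ni.
have hu : {subset u <= u ++ v} by move=> x; rewrite mem_cat => ->.
have hv : {subset v <= u ++ v} by move=> x; rewrite mem_cat orbC => ->.
have im : i < m.
  have : i.+1 \in w by rewrite ew mem_cat !inE eqxx !orbT.
  by rewrite (words_mem _ ww).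
exists (map (unbump i.+1) u ++ i :: map (unbump i.+1) v); last first.
  by rewrite split_letter_mid ?nu // !K.
apply: words_intro.
- rewrite -cat1s uniq_catCA /= mem_cat negb_or !nu //= -map_cat map_inj_in_uniq //.
  move=> x y xuv yuv e; have := congr1 (bump i.+1) e.
  by rewrite !unbumpK // inE; [apply: contraNneq ni' => <-|apply: contraNneq ni' => <-].
- by move: zw; rewrite ew !size_cat /= !size_map; lia.
move=> x; rewrite mem_cat inE orbCA => /orP[/eqP-> //|].
rewrite -mem_cat -map_cat => /mapP[y yuv ->].
have yi : y != i.+1 by apply: contraNneq ni' => <-.
have : y \in w by rewrite ew mem_cat !inE; move: yuv; rewrite mem_cat => /orP[->|->]; rewrite ?orbT.
by rewrite (words_mem _ ww) /unbump; lia.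
Qed.

Lemma perm_split_letter m i : i < m ->
  perm_eq [seq w <- words m.+1 | adj i i.+1 w != 0] (map (split_letter i) (words m)).
Proof.
move=> im; apply: uniq_perm.
- by rewrite filter_uniq ?permutations_uniq.
- by rewrite map_inj_in_uniq ?permutations_uniq //; exact: split_letter_inj.
move=> w; rewrite mem_filter; apply/andP/mapP => [[h ww]|[w' ww' ->]].
  by have [w' ww' e] := split_letter_surj ww h; exists w'.
by have /andP[h1 h2] := split_letter_words im ww'.
Qed.

Lemma swp_words n i w : i.+1 < n -> w \in words n -> map (swp i) w \in words n.
Proof.
move=> im ww; apply: words_intro; first by rewrite map_inj_uniq ?(words_uniq ww) //; exact: swp_inj.
  by rewrite size_map (words_size ww).
move=> x /mapP[y yw ->]; move: yw; rewrite (words_mem _ ww) /swp.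
by case: ifP => _; [lia|case: ifP => _; lia].
Qed.

End Words.

Section Coefficients.
Variable K : fieldType.
Hypothesis charK : [pchar K] =i pred0.

(** The coefficients of [T_n.+1]. *)
Definition coef n r : K := (-1) ^+ r / (n * 'C(n.-1, r))%:R.

Lemma natr_neq0 n : (0 < n)%N -> n%:R != 0 :> K.
Proof. by move=> h; have /pcharf0P-> := charK; rewrite -lt0n. Qed.

(** Owing to this recursion the exchange of two leaves of [T_k] produces the
    coefficients of [T_(k-1)]. *)
Lemma coef_sub m r : (r < m)%N -> coef m.+1 r - coef m.+1 r.+1 = coef m r.
Proof.
move=> rm; have e1 := mul_bin_down m r; have e2 := mul_bin_diag m r.
rewrite /coef /= e1.
have n1 : 'C(m, r)%:R != 0 :> K by rewrite natr_neq0 // bin_gt0 ltnW.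
have n2 : 'C(m, r.+1)%:R != 0 :> K by rewrite natr_neq0 // bin_gt0.
have n3 : (m - r)%:R != 0 :> K by rewrite natr_neq0 // subn_gt0.
have n4 : m.+1%:R != 0 :> K by rewrite natr_neq0.
have e3 : ('C(m, r.+1)%:R : K) = (m - r)%:R * 'C(m, r)%:R / r.+1%:R.
  by apply: (mulIf (natr_neq0 (ltn0Sn r))); rewrite mulfVK ?natr_neq0 // -!natrM -e1 e2 mulnC.
have n5 : r.+1%:R != 0 :> K by rewrite natr_neq0.
rewrite !natrM e3 exprS mulN1r mulNr opprK.
have -> : (m.+1%:R : K) = (m - r)%:R + r.+1%:R by rewrite -natrD; congr _%:R; lia.
have n6 : (m - r)%:R + r.+1%:R != 0 :> K by rewrite -natrD (_ : _ + _ = m.+1)%N //; lia.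
by field; rewrite nat1r n1 n3 n5 n6.
Qed.

(** For a cyclic word with [r] descents: each of the [r] rotations that cut it at
    a descent has one descent less. *)
Lemma coef_rot n r : (0 < r < n)%N -> r%:R * coef n r.-1 + (n - r)%:R * coef n r = 0.
Proof.
case: r n => [|r] [|m] // /andP[_]; rewrite ltnS => rm.
have e1 := mul_bin_down m r; have e2 := mul_bin_diag m r.
rewrite /coef /=.
have n1 : 'C(m, r)%:R != 0 :> K by rewrite natr_neq0 // bin_gt0 ltnW.
have n3 : (m - r)%:R != 0 :> K by rewrite natr_neq0 // subn_gt0.
have n4 : m.+1%:R != 0 :> K by rewrite natr_neq0.
have e3 : ('C(m, r.+1)%:R : K) = (m - r)%:R * 'C(m, r)%:R / r.+1%:R.
  by apply: (mulIf (natr_neq0 (ltn0Sn r))); rewrite mulfVK ?natr_neq0 // -!natrM -e1 e2 mulnC.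
have n5 : r.+1%:R != 0 :> K by rewrite natr_neq0.
rewrite subSS !natrM e3 exprS.
by field; rewrite !nat1r n1 n3 n4 n5.
Qed.

Lemma coef_rot_sum w : uniq w -> (1 < size w)%N ->
  \sum_(k < size w) coef (size w) (des (rot k w)) = 0.
Proof.
move=> uw sw; set n := size w; set d := (des w + cut w 0)%N.
have dE : d = (\sum_(k < n) cut w k)%N := des_sum_cut w.
have dn : (0 < d < n)%N := cut_bounds uw sw.
(* Cutting the cyclic word at one of its [d] descents leaves [d.-1] of them,
   cutting it elsewhere leaves all of them. *)
have -> : \sum_(k < n) coef n (des (rot k w)) =
    \sum_(k < n) ((cut w k)%:R * coef n d.-1 + (1 - (cut w k)%:R) * coef n d).
  apply: eq_bigr => k _; have := des_rot (ltn_ord k); rewrite -/d => h.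
  case: (cut w k) h => /= h.
    by rewrite mul1r subrr mul0r addr0 -h addn1.
  by rewrite mul0r add0r subr0 mul1r -h addn0.
rewrite big_split /= -!mulr_suml sumrB -!natr_sum -dE sumr_const card_ord.
by rewrite -natrB ?coef_rot // ltnW //; case/andP: dn.
Qed.

(** The sum over the cyclic rotations of any single word vanishes. *)
Lemma coef_words_sum n : (1 < n)%N -> \sum_(w <- words n) coef n (des w) = 0.
Proof.
move=> n1; have nn : n%:R != 0 :> K by rewrite natr_neq0 // ltnW.
apply: (mulfI nn); rewrite mulr0 mulr_natl -[n in _ *+ n]card_ord -sumr_const.
rewrite (eq_bigr (fun k : 'I_n => \sum_(w <- words n) coef n (des (rot k w)))); last first.
  move=> k _; rewrite -(perm_big _ (@perm_map_words n (rot k) _ _)) ?big_map //.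
    by move=> w w' _ _; exact: rot_inj.
  by move=> w; rewrite !mem_words perm_rot.
rewrite exchange_big big_seq big1 //= => w ww.
have sw := words_size ww; have := @coef_rot_sum w (words_uniq ww).
by rewrite sw => ->.
Qed.

End Coefficients.

(** * Sums of combs with a given first leaf *)

(** For relations that speak of neighbouring legs only, as STU does. *)
Lemma perm_adjacent_ind (T : eqType) (R : seq T -> seq T -> Prop) :
  (forall s, R s s) -> (forall s1 s2 s3, R s1 s2 -> R s2 s3 -> R s1 s3) ->
  (forall u x y v, R (u ++ x :: y :: v) (u ++ y :: x :: v)) ->
  forall s s', perm_eq s s' -> R s s'.
Proof.
move=> Rr Rt Rs s s' h; rewrite -[s]cat0s -[s']cat0s; move: [::] => p.
elim: s p s' h => [|x s IH] p s' h.
  by rewrite perm_sym in h; rewrite (perm_nilP h).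
have xs' : x \in s' by rewrite -(perm_mem h) mem_head.
case/splitPr: xs' h => u v; rewrite perm_sym -[x :: v]cat1s perm_catCA /= perm_cons perm_sym => h.
apply: (Rt _ (p ++ x :: u ++ v)); first by rewrite -!cat_rcons; exact: IH.
elim: u p {h} => [|y u IHu] p //=.
apply: (Rt _ (p ++ y :: x :: u ++ v)); first exact: Rs.
by rewrite -!(cat_rcons y); exact: IHu.
Qed.

Section TreeSums.
Variables (K : fieldType) (V : lmodType K).
Hypothesis charK : [pchar K] =i pred0.
Variables (E0 : seq nat) (G : seq (nat * nat * nat) -> seq (nat * nat) -> V).
Hypothesis gG : good E0 G.
Implicit Types (t : seq (nat * nat * nat)) (ps : seq (nat * nat)).

Local Notation coef := (coef K).

Definition comb_word (b : nat -> nat) z w t ps : V :=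
  spine (b (head 0%N w)) (map b (behead w)) z G t ps.

(** [T_n.+1] is the case [f = 0] (see [lmo_ins_tree_sum]). The other values of [f]
    appear when the first leaf takes part in an exchange. *)
Definition tree_sum n b z f t ps : V :=
  \sum_(w <- words n | head 0%N w == f) coef n (des w) *: comb_word b z w t ps.

Lemma eq_tree_sum n b b' z f t ps : (forall x, (x < n)%N -> b x = b' x) ->
  tree_sum n b z f t ps = tree_sum n b' z f t ps.
Proof.
move=> e; rewrite /tree_sum [LHS]big_seq_cond [RHS]big_seq_cond; apply: eq_bigr => w /andP[ww _].
case: n e ww => [|n] e ww.
  by move/words_size: (ww) => /size0nil ->; rewrite /coef mul0n invr0 mulr0 !scale0r.
case: w ww => [|x w] ww; first by have := words_size ww.
rewrite /comb_word /= e -?(words_mem _ ww) ?mem_head //.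
rewrite (_ : map b w = map b' w) //; apply/eq_in_map => y yw.
by apply: e; rewrite -(words_mem _ ww) inE yw orbT.
Qed.

(** What becomes of the letter [f] when the letters [i] and [i.+1] are merged. *)
Definition merge i f := if (i < f)%N then f.-1 else f.

(** An exchange of the letters [i], [i.+1] affects the number of descents only in
    those words that have them next to each other. For such words [coef_sub] gives
    the coefficients of the shorter sum, and AS or IHX its combs. *)
Lemma tree_sum_swap m i b z f t ps s : (i < m)%N ->
  s \notin E0 ++ (z :: map b (iota 0 m.+1)) ++ names t ps ->
  tree_sum m.+1 b z f t ps - tree_sum m.+1 (b \o swp i) z (swp i f) t ps =
  tree_sum m (fun j => if j == i then s else b (bump i.+1 j)) z (merge i f)
    ((s, b i.+1, b i) :: t) ps.
Proof.
move=> im sf; set b' := fun j => _.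
have wpos n w : w \in words n.+1 -> w = head 0%N w :: behead w.
  by case: w => // /words_size.
have pw : perm_eq (map (map (swp i)) (words m.+1)) (words m.+1).
  apply: perm_map_words; first by move=> w w' _ _; apply: inj_map; exact: swp_inj.
  by move=> w; apply: swp_words.
pose d w := coef m.+1 (des w) - coef m.+1 (des (map (swp i) w)).
pose F w := if head 0%N w == f then d w *: comb_word b z w t ps else 0.
have -> : tree_sum m.+1 b z f t ps - tree_sum m.+1 (b \o swp i) z (swp i f) t ps =
    \sum_(w <- words m.+1) F w.
  have -> : tree_sum m.+1 (b \o swp i) z (swp i f) t ps =
      \sum_(w <- words m.+1 | head 0%N w == f)
        coef m.+1 (des (map (swp i) w)) *: comb_word b z w t ps.
    rewrite /tree_sum -(perm_big _ pw) big_map /= [LHS]big_seq_cond [RHS]big_seq_cond.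
    apply: eq_big => [w|w /andP[ww _]].
      case: (boolP (w \in words m.+1)) => //= /words_size.
      by case: w => // x w _; rewrite (inj_eq (@swp_inj i)).
    have := words_size ww; case: w {ww} => // x w _.
    have -> : comb_word (b \o swp i) z (map (swp i) (x :: w)) t ps =
        comb_word b z (x :: w) t ps; last by [].
    rewrite /comb_word /= swpK -map_comp (@eq_map _ _ ((b \o swp i) \o swp i) b) // => y /=.
    by rewrite swpK.
  rewrite /F -big_mkcond /= /d /tree_sum -sumrB.
  by apply: eq_bigr => w _; rewrite scalerBl.
pose P1 w := adj i i.+1 w != 0%N.
pose P2 w := adj i.+1 i w != 0%N.
(* [P1] and [P2] say that [i], [i.+1] are neighbours in [w], in this order and in
   the opposite one. The two kinds of words are exchanged by [swp i]. *)
have F0 w : w \in words m.+1 -> ~~ P1 w -> ~~ P2 w -> F w = 0.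
  move=> ww; rewrite /P1 /P2 !negbK => /eqP h1 /eqP h2; rewrite /F; case: ifP => // _.
  have := des_swp i (words_uniq ww); rewrite h1 h2 !addn0 /d => ->.
  by rewrite subrr scale0r.
have P12 w : w \in words m.+1 -> P2 w -> ~~ P1 w.
  move=> ww /adj_split[u [v ew]]; have := words_uniq ww.
  by rewrite /P1 ew => /adj_cat[_ ->].
have -> : \sum_(w <- words m.+1) F w =
    \sum_(w <- words m.+1 | P1 w) (F w + F (map (swp i) w)).
  rewrite (bigID P1) /= big_split /=; congr (_ + _).
  rewrite (bigID P2) /= [X in _ + X]big_seq_cond [X in _ + X]big1 ?addr0; last first.
    by move=> w /andP[ww /andP[h1 h2]]; exact: F0.
  transitivity (\sum_(w <- words m.+1 | P2 w) F w).
    rewrite big_seq_cond [RHS]big_seq_cond; apply: eq_bigl => w.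
    by case: (boolP (w \in _)) => //= ww; case: (boolP (P2 w)) => [/(P12 _ ww)->|]; rewrite ?andbF.
  by rewrite -(perm_big _ pw) big_map /=; apply: eq_bigl => w; rewrite /P2 adj_swp.
rewrite -big_filter (perm_big _ (perm_split_letter im)) big_map /tree_sum.
rewrite [RHS]big_mkcond /= [LHS]big_seq [RHS]big_seq; apply: eq_bigr => w ww.
have uw := words_uniq ww.
have /andP[sww adj1] := split_letter_words im ww.
have usw := words_uniq sww.
have a1 : adj i i.+1 (split_letter i w) = 1%N /\ adj i.+1 i (split_letter i w) = 0%N.
  by have [u [v ev]] := adj_split adj1; rewrite ev; apply: adj_cat; rewrite -ev.
case: a1 => a1 a2.
have dw : (des w < m)%N.
  case: w ww uw {sww adj1 usw a1 a2} => [|x w] ww _; first by move: im; rewrite -(words_size ww).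
  by rewrite -(words_size ww) /= ltnS; exact: des_le.
have d1 : d (split_letter i w) = coef m (des w).
  have := des_swp i usw; rewrite a1 a2 addn0 addn1 des_split_letter // /d => ->.
  by rewrite des_split_letter // coef_sub.
have d2 : d (map (swp i) (split_letter i w)) = - coef m (des w).
  rewrite -d1 /d opprB; congr (_ - coef _ (des _)).
  by rewrite -map_comp -[RHS]map_id; apply: eq_map => x /=; rewrite swpK.
rewrite /F d1 d2.
have [u [v [ew iu iv]]] := word_split ww im.
have swp_bump r : i \notin r -> map (swp i) (map (bump i.+1) r) = map (bump i.+1) r.
  move=> ir; rewrite -map_comp; apply/eq_in_map => x xr /=.
  have xi : x != i by apply: contraNneq ir => <-.
  by rewrite /swp /bump; case: eqP; [lia|case: eqP; lia].
have b'_bump r : i \notin r -> map b' r = map b (map (bump i.+1) r).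
  move=> ir; rewrite -map_comp; apply/eq_in_map => x xr /=; rewrite /b'.
  by case: eqP => // xi; rewrite -xi xr in ir.
have b_mem x : x \in split_letter i w -> b x \in map b (iota 0 m.+1).
  by move=> xs; apply: map_f; rewrite mem_iota /= -(words_mem _ sww).
move: (map b (iota 0 m.+1)) sf b_mem => B sf b_mem.
have sfresh (l : seq nat) : {subset l <= map b (split_letter i w)} ->
    s \notin E0 ++ (z :: l) ++ names t ps.
  move=> hl; apply: contra sf; rewrite !mem_cat !inE -!mem_cat.
  case/or3P => [->//|/orP[->|/hl/mapP[x xs ->]]|->]; rewrite ?orbT //.
  by rewrite b_mem ?orbT.
have swi : swp i i = i.+1 by rewrite /swp eqxx.
have swi1 : swp i i.+1 = i by rewrite -swi swpK.
have b'i : b' i = s by rewrite /b' eqxx.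
(* If [i] heads the word, then at most one of the two combs has the first leaf
   [f], and [spine_first] applies; otherwise both or none of them do, and
   [spine_comm] applies. *)
case: u ew iu => [|h u] ew iu.
  rewrite ew cat0s (@split_letter_mid i [::]) // cat0s !map_cons swi swi1 swp_bump //.
  rewrite /comb_word /= b'i b'_bump //.
  set bv := map b _.
  have sfr : s \notin E0 ++ enclose (b i) (b i.+1 :: bv) z ++ names t ps.
    have := sfresh [:: b i, b i.+1 & bv]; rewrite ew (@split_letter_mid i [::]) // => /(_ (fun x h => h)).
    by apply: contra; mem_cases.
  rewrite -(spine_first gG sfr) (spine_antisym gG (b i.+1)).
  rewrite scaleNr scalerN opprK /merge; case: (eqVneq i f) => [<-|nf].
    have -> : (i.+1 == i) = false by apply/eqP; lia.
    by rewrite ltnn eqxx addr0.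
  case: (eqVneq i.+1 f) => [<-|nf']; first by rewrite /= ltnSn eqxx add0r.
  by rewrite addr0; case: ltnP => hf; case: eqP => //; lia.
have hi : h != i by apply: contraNneq iu => ->; rewrite mem_head.
have iu' : i \notin u by apply: contra iu => hu; rewrite inE hu orbT.
rewrite ew split_letter_mid // map_cons cat_cons map_cons map_cat !map_cons.
have -> : swp i (bump i.+1 h) = bump i.+1 h.
  by have := @swp_bump [:: h]; rewrite inE eq_sym => /(_ hi)[].
rewrite swi swi1 !swp_bump // /comb_word /= !map_cat /= b'i !b'_bump //.
have -> : b' h = b (bump i.+1 h) by rewrite /b' (negPf hi).
have -> : (bump i.+1 h == f) = (h == merge i f).
  by rewrite /merge /bump; case: (ltnP i f) => hf; apply/eqP/eqP; lia.
case: ifP => _; last by rewrite addr0.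
rewrite scaleNr -scalerBr; congr (_ *: _).
apply: (spine_comm gG).
have := sfresh (map b (split_letter i w)) (fun x h => h).
apply: contra; rewrite ew split_letter_mid // map_cat /=.
by mem_cases.
Qed.

End TreeSums.

(** * Independence of the first leaf *)

Section Independence.
Variables (K : fieldType) (V : lmodType K).
Hypothesis charK : [pchar K] =i pred0.
Variables (E0 : seq nat) (G : seq (nat * nat * nat) -> seq (nat * nat) -> V).
Hypothesis gG : good E0 G.
Implicit Types (t : seq (nat * nat * nat)) (ps : seq (nat * nat)).

Lemma fresh1 (A : seq nat) : exists s, s \notin A.
Proof.
have [fs [sz _ h]] := fresh_seq 1 A.
by case: fs sz h => // s fs _ h; exists s; apply: h; rewrite mem_head.
Qed.

Lemma index_words n v w : v \in words n -> w \in words n -> map (index^~ w) v \in words n.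
Proof.
move=> vv ww; apply: words_intro.
- rewrite map_inj_in_uniq ?(words_uniq vv) // => x y xv yv e.
  have xw : x \in w by rewrite (words_mem _ ww) -(words_mem _ vv).
  have yw : y \in w by rewrite (words_mem _ ww) -(words_mem _ vv).
  by rewrite -(nth_index 0%N xw) e nth_index.
- by rewrite size_map (words_size vv).
- move=> i /mapP[x xv ->]; rewrite -[X in (_ < X)%N](words_size ww) index_mem.
  by rewrite (words_mem _ ww) -(words_mem _ vv).
Qed.

Lemma nth_words n v w : v \in words n -> w \in words n -> map (nth 0%N w) v \in words n.
Proof.
move=> vv ww; apply: words_intro.
- rewrite map_inj_in_uniq ?(words_uniq vv) // => x y xv yv /eqP.
  by rewrite nth_uniq ?(words_uniq ww) ?(words_size ww) -?(words_mem _ vv) // => /eqP.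
- by rewrite size_map (words_size vv).
- move=> i /mapP[x xv ->]; rewrite -(words_mem _ ww) mem_nth // (words_size ww).
  by rewrite -(words_mem _ vv).
Qed.

(** After a change of variables, the coefficient of each comb is the sum of [coef]
    over all words, which vanishes by [coef_words_sum]. *)
Lemma tree_sum_avg n b z f t ps : (1 < n)%N -> (f < n)%N ->
  \sum_(w <- words n) tree_sum G n (b \o nth 0%N w) z (index f w) t ps = 0.
Proof.
move=> n1 fn.
pose F w v : V := if head 0%N v == f then
   coef K n (des (map (index^~ w) v)) *: comb_word G b z v t ps else 0.
have e w : w \in words n ->
   tree_sum G n (b \o nth 0%N w) z (index f w) t ps = \sum_(v <- words n) F w v.
  move=> ww; rewrite /tree_sum.
  have pw : perm_eq (map (map (nth 0%N w)) (words n)) (words n).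
    apply: perm_map_words; last by move=> v vv; exact: nth_words.
    move=> v v' vv vv' /(congr1 (map (index^~ w))); rewrite -!map_comp.
    have K1 u : u \in words n -> map (index^~ w \o nth 0%N w) u = u.
      move=> uu; rewrite -[RHS]map_id; apply/eq_in_map => x xu /=.
      by rewrite index_uniq ?(words_uniq ww) // (words_size ww) -(words_mem _ uu).
    by rewrite !K1.
  rewrite -[RHS](perm_big _ pw) big_map [LHS]big_mkcond [LHS]big_seq [RHS]big_seq.
  apply: eq_bigr => v vv; rewrite /F /=.
  have K1 : map (index^~ w \o nth 0%N w) v = v.
    rewrite -[RHS]map_id; apply/eq_in_map => x xu /=.
    by rewrite index_uniq ?(words_uniq ww) // (words_size ww) -(words_mem _ vv).
  rewrite -map_comp K1.
  case: v vv K1 => [|x v] vv K1; first by move: n1; rewrite -(words_size vv).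
  rewrite /= /comb_word /= -map_comp.
  have -> : (x == index f w) = (nth 0%N w x == f); last by [].
  apply/eqP/eqP => [->|<-]; first by rewrite nth_index // (words_mem _ ww).
  by rewrite index_uniq ?(words_uniq ww) // (words_size ww) -(words_mem _ vv) mem_head.
rewrite [LHS]big_seq (eq_bigr _ e) -big_seq exchange_big /= big_seq big1 // => v vv.
rewrite /F; case: (head 0%N v == f); last by apply: big1.
transitivity ((\sum_(w <- words n) coef K n (des (map (index^~ w) v))) *: comb_word G b z v t ps).
  by rewrite scaler_suml.
have pw : perm_eq (map (fun w => map (index^~ w) v) (words n)) (words n).
  apply: perm_map_words; last by move=> w ww; exact: index_words.
  move=> w w' ww ww' /eq_in_map h.
  apply: (@eq_from_nth _ 0%N); first by rewrite (words_size ww) (words_size ww').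
  move=> i; rewrite (words_size ww) => hi; set x := nth 0%N w i.
  have xw : x \in w by rewrite mem_nth // (words_size ww).
  have xv : x \in v by rewrite (words_mem _ vv) -(words_mem _ ww).
  have := h x xv; rewrite /= /x index_uniq ?(words_uniq ww) ?(words_size ww) // -/x => ->.
  by rewrite nth_index // (words_mem _ ww') -(words_mem _ ww).
have := coef_words_sum charK n1; rewrite -(perm_big _ pw) big_map => ->.
by rewrite scale0r.
Qed.

(** The difference of the two sums is equivariant under exchanges of the letters:
    by induction on [n] its two terms fail to be so by the same amount. Being zero
    on average by [tree_sum_avg], it vanishes. *)
Lemma tree_sum_indep n b z f g t ps : (f < n)%N -> (g < n)%N ->
  tree_sum G n b z f t ps = tree_sum G n b z g t ps.
Proof.
elim: n b t f g => // -[|m] IH b t f g fn gn.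
  by case: f fn => //; case: g gn.
set n := m.+2.
pose D b f g : V := tree_sum G n b z f t ps - tree_sum G n b z g t ps.
(* The right-hand sides of [tree_sum_swap] for [f'] and for [g'] agree by
   induction. *)
have sw i b' f' g' : (i < m.+1)%N -> (f' < n)%N -> (g' < n)%N ->
    D b' f' g' = D (b' \o swp i) (swp i f') (swp i g').
  move=> im hf hg; have [s sf] := fresh1 (E0 ++ (z :: map b' (iota 0 n)) ++ names t ps).
  have mlt h : (h < n)%N -> (merge i h < m.+1)%N.
    by rewrite /n /merge; case: (ltnP i h); lia.
  have := tree_sum_swap charK gG f' im sf; rewrite (IH _ _ _ (merge i g')) ?mlt //.
  rewrite -(tree_sum_swap charK gG g' im sf) => /eqP; rewrite subr_eq => /eqP e.
  by rewrite /D e addrC !addrA addNr add0r addrC.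
have Dw w : w \in words n ->
    D b f g = D (b \o nth 0%N w) (index f w) (index g w).
  move=> ww; pose R (s s' : seq nat) := s \in words n -> s' \in words n /\
    D (b \o nth 0%N s) (index f s) (index g s) = D (b \o nth 0%N s') (index f s') (index g s').
  have Rperm s s' : perm_eq s s' -> R s s'.
    apply: perm_adjacent_ind => {s s'} [s //|s1 s2 s3 h1 h2 /h1[/h2[h3 h4] h5]|u x y v].
      by rewrite h5.
    set s := u ++ _; set s' := u ++ _; move=> ss.
    have pss : perm_eq s' s.
      rewrite /s /s' perm_cat2l -[y :: _]/([:: y; x] ++ v) -[x :: y :: v]/([:: x; y] ++ v).
      by rewrite perm_cat2r (perm_catC [:: y]).
    have ss' : s' \in words n by rewrite mem_words (perm_trans pss) // -mem_words.
    split=> //; have us := words_uniq ss.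
    have im : (size u < m.+1)%N.
      by have := words_size ss; rewrite /s size_cat /= /n; lia.
    have es k : nth 0%N s (swp (size u) k) = nth 0%N s' k.
      rewrite /swp !nth_cat; case: (eqVneq k (size u)) => [->|nk].
        by rewrite ltnNge leqnSn /= subSnn ltnn subnn.
      case: (eqVneq k (size u).+1) => [->|nk'].
        by rewrite ltnn subnn ltnNge leqnSn /= subSnn.
      case: (ltnP k (size u)) => // hk.
      have -> : (k - size u = (k - (size u).+2).+2)%N by lia.
      by [].
    have hi h : (h < n)%N -> (index h s < n)%N.
      by move=> hn; rewrite -[X in (_ < X)%N](words_size ss) index_mem (words_mem _ ss).
    have ei h : (h < n)%N -> swp (size u) (index h s) = index h s'.
      move=> hn; have hs : h \in s by rewrite (words_mem _ ss).
      have := es (swp (size u) (index h s)); rewrite swpK nth_index // => e.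
      rewrite [in RHS]e index_uniq ?(words_uniq ss') // (words_size ss').
      by have := hi h hn; rewrite /swp; case: eqP => [_|_]; [lia|case: eqP; lia].
    rewrite (sw _ _ _ _ im) ?hi // !ei // /D.
    by rewrite !(@eq_tree_sum _ _ G n ((b \o nth 0%N s) \o swp (size u)) (b \o nth 0%N s')) // => k _;
      rewrite /= es.
  have i0 : iota 0 n \in words n by rewrite mem_words.
  have pw : perm_eq (iota 0 n) w by rewrite perm_sym -mem_words.
  have [_ <-] := Rperm _ _ pw i0.
  have ei h : (h < n)%N -> index h (iota 0 n) = h.
    by move=> hn; rewrite -{1}[h]add0n -{1}(nth_iota 0 0 hn) index_uniq ?iota_uniq ?size_iota.
  rewrite !ei // /D.
  by rewrite !(@eq_tree_sum _ _ G n (b \o nth 0%N (iota 0 n)) b) // => k kn;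
    exact: (congr1 b (nth_iota 0%N 0%N kn)).
have : \sum_(w <- words n) D (b \o nth 0%N w) (index f w) (index g w) = 0.
  by rewrite /D sumrB !tree_sum_avg // subrr.
rewrite big_seq (eq_bigr (fun=> D b f g)) => [|w ww]; last by rewrite -Dw.
rewrite -big_seq big_const_seq count_predT iter_addr addr0.
have -> : size (words n) = n`! by rewrite size_permutations ?iota_uniq // size_iota.
rewrite -scaler_nat => /eqP; rewrite scaler_eq0 (negPf (natr_neq0 charK (fact_gt0 n))) /=.
by rewrite subr_eq0 => /eqP.
Qed.

End Independence.

(** * The trees T_k in a context *)

Section PermutationWords.
Local Open Scope nat_scope.

Definition word_of n (s : 'S_n) : seq nat := [seq nat_of_ord (s i) | i <- enum 'I_n].

Lemma word_of_words n (s : 'S_n) : word_of s \in words n.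
Proof.
rewrite mem_words /word_of (map_comp (@nat_of_ord n) s) -val_enum_ord perm_map //.
exact: perm_enum_perm.
Qed.

Lemma perm_word_of n : perm_eq (map (@word_of n) (enum 'S_n)) (words n).
Proof.
have u : uniq (map (@word_of n) (enum 'S_n)).
  rewrite map_inj_uniq ?enum_uniq // => s s' e; apply/permP => i.
  have /eq_in_map/(_ i) h : map (fun i => nat_of_ord (s i)) (enum 'I_n) =
    map (fun i => nat_of_ord (s' i)) (enum 'I_n) by [].
  by apply: val_inj; apply: h; rewrite mem_enum.
have sub : {subset map (@word_of n) (enum 'S_n) <= words n}.
  by move=> w /mapP[s _ ->]; exact: word_of_words.
apply: uniq_perm; rewrite ?permutations_uniq //.
have [|_ //] := uniq_min_size u sub.
rewrite size_permutations ?iota_uniq // size_iota size_map -cardE.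
by rewrite card_Sn.
Qed.

Lemma des_sum w :
  des w = \sum_(i < size w) ((i.+1 < size w) && (nth 0 w i.+1 < nth 0 w i)).
Proof.
elim: w => [|x w IH]; first by rewrite big_ord0.
rewrite [size _]/= big_ord_recl; case: w IH => [|y w] IH.
  by rewrite big_ord0.
by rewrite des_cons2 IH.
Qed.

Lemma des_word_of n (s : 'S_n) : des (word_of s) = descents s.
Proof.
rewrite des_sum /descents -sum1dep_card [RHS]big_mkcond /=.
transitivity (\sum_(i < n) \sum_(j < n) if (j == i.+1 :> nat) && (s j < s i) then 1 else 0);
  last by rewrite pair_bigA; apply: eq_bigr => -[].
have sz : size (word_of s) = n by rewrite size_map size_enum_ord.
rewrite sz; apply: eq_bigr => i _.
have nthw (j : 'I_n) : nth 0 (word_of s) j = s j.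
  by rewrite (nth_map j) ?size_enum_ord // nth_ord_enum.
case: (ltnP i.+1 n) => h.
  rewrite (bigD1 (Ordinal h)) //= eqxx /= big1 => [|j /eqP jh].
    by rewrite addn0 nthw (nthw (Ordinal h)); case: ltnP.
  by case: eqP => //= e; case: jh; apply: val_inj.
by rewrite /= big1 // => j _; have := ltn_ord j; case: eqP => //= ->; rewrite ltnNge h.
Qed.

Lemma des_rev_comp n w : {in w, forall i, i < n} ->
  des (rev (map (fun i => n - i.+1) w)) = des w.
Proof.
elim: w => // x [|y w] IH h //.
rewrite map_cons rev_cons -cats1.
have e : rev [seq n - i.+1 | i <- y :: w] = rcons (rev [seq n - i.+1 | i <- w]) (n - y.+1).
  by rewrite map_cons rev_cons.
rewrite e des_cat -e IH; last by move=> i iw; apply: h; rewrite inE iw orbT.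
have := h x; have := h y; rewrite !inE !eqxx orbT => /(_ isT) hy /(_ isT) hx.
have -> : (n - x.+1 < n - y.+1) = (y < x) by lia.
by rewrite des_cons2 (_ : des [:: _] = 0) // addn0 addnC.
Qed.

Lemma rev_comp_words n :
  perm_eq (map (fun w => rev (map (fun i => n - i.+1) w)) (words n)) (words n).
Proof.
apply: perm_map_words => [w w' ww ww' /(congr1 rev)|w ww].
  rewrite !revK => /(congr1 (map (fun i => n - i.+1))); rewrite -!map_comp.
  have K v : v \in words n -> map ((fun i => n - i.+1) \o (fun i => n - i.+1)) v = v.
    move=> vv; rewrite -[RHS]map_id; apply/eq_in_map => x; rewrite (words_mem _ vv) /=; lia.
  by rewrite !K.
apply: words_intro.
- rewrite rev_uniq map_inj_in_uniq ?(words_uniq ww) // => x y.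
  by rewrite !(words_mem _ ww); lia.
- by rewrite size_rev size_map (words_size ww).
by move=> i; rewrite mem_rev => /mapP[x]; rewrite (words_mem _ ww); lia.
Qed.

End PermutationWords.

Section LMOTrees.
Variables (K : fieldType) (V : lmodType K).
Hypothesis charK : [pchar K] =i pred0.
Implicit Types (t : seq (nat * nat * nat)) (ps : seq (nat * nat)).
Implicit Types G : seq (nat * nat * nat) -> seq (nat * nat) -> V.

(** [T_k], [k] being the size of [l], with its leaves glued to the edges [l] of
    the context. *)
Definition lmo_ins (l : seq nat) G t ps : V :=
  if size l is n.+2 then
    \sum_(s : 'S_n) ((-1) ^+ descents s / (n.+1 * 'C(n, descents s))%:R : K) *:
      ins (comb s l) G t ps
  else 0.

Lemma lmo_ins_small l G : (size l < 2)%N -> lmo_ins l G = fun _ _ => 0.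
Proof. by move=> h; rewrite /lmo_ins; case: (size l) h => [|[|]]. Qed.

Lemma lmo_ins2 a b G : lmo_ins [:: a; b] G = spine a [::] b G.
Proof.
apply/funext => t; apply/funext => ps; rewrite /lmo_ins /spine /=.
have e (s : 'S_0) : s = 1%g by apply/permP => -[].
rewrite (big_pred1 1%g) => [|s]; last by rewrite /= (e s) eqxx.
have -> : descents (1%g : 'S_0) = 0%N by rewrite -des_word_of /word_of enum_ord0.
by rewrite expr0 bin0 divr1 scale1r.
Qed.

Lemma good_lmo_ins E0 G l : good E0 G -> good (l ++ E0) (lmo_ins l G).
Proof.
move=> gG; rewrite /lmo_ins; case sl: (size l) => [|[|n]]; try exact: good0.
apply: good_sum => s _; apply: good_scale.
by have := good_ins (comb s l) gG; rewrite labs_comb.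
Qed.

Lemma ins_linear (I : Type) (r : seq I) (c : I -> K) (F : I -> _) E E0 t ps :
  (forall i, good E0 (F i)) ->
  ins E (fun t ps => \sum_(i <- r) c i *: F i t ps : V) t ps =
  \sum_(i <- r) c i *: ins E (F i) t ps.
Proof.
move=> gF.
have gS : good E0 (fun t ps => \sum_(i <- r) c i *: F i t ps).
  by apply: good_sum => i _; apply: good_scale.
have [N hN] := belowP (avoid E0 E t ps).
rewrite (ins_below gS hN) /attach; apply: eq_bigr => i _.
by rewrite (ins_below (gF i) hN).
Qed.

Lemma ins0 E t ps : ins E (fun _ _ => 0 : V) t ps = 0.
Proof.
have [N hN] := belowP (avoid [::] E t ps).
by rewrite (ins_below (good0 _ [::]) hN).
Qed.

Lemma lmo_ins_comm E0 G l l' : good E0 G ->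
  lmo_ins l (lmo_ins l' G) = lmo_ins l' (lmo_ins l G).
Proof.
move=> gG; apply/funext => t; apply/funext => ps; rewrite /lmo_ins.
case sl: (size l) => [|[|n]]; case sl': (size l') => [|[|n']] //.
- by rewrite big1 // => s _; rewrite ins0 scaler0.
- by rewrite big1 // => s _; rewrite ins0 scaler0.
- by rewrite big1 // => s _; rewrite ins0 scaler0.
- by rewrite big1 // => s _; rewrite ins0 scaler0.
under eq_bigr => s _.
  rewrite (@ins_linear _ _ _ _ _ (l' ++ E0)); last first.
    by move=> s'; have := good_ins (comb s' l') gG; rewrite labs_comb.
  over.
under [RHS]eq_bigr => s _.
  rewrite (@ins_linear _ _ _ _ _ (l ++ E0)); last first.
    by move=> s'; have := good_ins (comb s' l) gG; rewrite labs_comb.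
  over.
under eq_bigr => s _ do rewrite scaler_sumr.
under [RHS]eq_bigr => s _ do rewrite scaler_sumr.
rewrite exchange_big /=; apply: eq_bigr => s _; apply: eq_bigr => s' _.
by rewrite !scalerA mulrC (ins_comm _ _ gG).
Qed.

Section Fixed.
Variables (E0 : seq nat) (G : seq (nat * nat * nat) -> seq (nat * nat) -> V).
Hypothesis gG : good E0 G.

Lemma lmo_ins_words n x bs z t ps : size bs = n ->
  lmo_ins (enclose x bs z) G t ps =
  \sum_(w <- words n) coef K n.+1 (des w) *: spine x (map (nth 0%N bs) w) z G t ps.
Proof.
move=> sb; rewrite /lmo_ins /= size_rcons sb -(perm_big _ (perm_word_of n)) big_map.
rewrite big_enum; apply: eq_big => [s|s _]; first by rewrite inE.
rewrite des_word_of (ins_comb_spine _ _ _ gG sb); congr (_ *: _).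
by rewrite /word_of -map_comp.
Qed.

Lemma lmo_ins_tree_sum x bs z t ps :
  lmo_ins (enclose x bs z) G t ps =
  tree_sum G (size bs).+1 (nth 0%N (x :: bs)) z 0%N t ps.
Proof.
rewrite (lmo_ins_words _ _ _ _ (erefl _)) /tree_sum; set n := size bs.
rewrite -[RHS]big_filter.
have pw : perm_eq [seq w <- words n.+1 | head 0%N w == 0%N]
    (map (fun w => 0%N :: map S w) (words n)).
  apply: uniq_perm; first by rewrite filter_uniq ?permutations_uniq.
    rewrite map_inj_uniq ?permutations_uniq // => w w' [].
    by apply: inj_map => a b [].
  move=> w; rewrite mem_filter; apply/andP/mapP => [[hw ww]|[w' ww' ->]]; last first.
    split=> //; apply: words_intro.
    - rewrite /= map_inj_uniq ?(words_uniq ww') ?andbT; last by move=> a b [].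
      by apply/mapP => -[].
    - by rewrite /= size_map (words_size ww').
    by move=> i; rewrite inE => /orP[/eqP-> //|/mapP[y yw ->]]; rewrite ltnS -(words_mem _ ww').
  case: w hw ww => [|y w] /= hw ww; first by have := words_size ww.
  rewrite (eqP hw) in ww *; have /andP[n0 uw] := words_uniq ww.
  have pw y' : y' \in w -> y' = y'.-1.+1 by case: y' n0 => // /negPf->.
  exists (map predn w); last by rewrite -map_comp -[LHS]map_id; congr (_ :: _); apply/eq_in_map => a /pw.
  apply: words_intro.
  - rewrite map_inj_in_uniq // => a b aw bw e; by rewrite (pw a) // (pw b) // e.
  - by rewrite size_map; have [] := words_size ww.
  move=> i /mapP[a aw ->]; have := words_mem a ww; rewrite inE aw orbT => /esym.
  by rewrite (pw a).
rewrite (perm_big _ pw) big_map; apply: eq_bigr => w _.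
have -> : des (0%N :: map S w) = des w.
  case: w => // y w; rewrite map_cons des_cons2 ltn0 add0n.
  by elim: w y => // a w IH y; rewrite map_cons !des_cons2 IH.
by rewrite /comb_word /= -map_comp.
Qed.

Lemma lmo_ins_rev l t ps : lmo_ins (rev l) G t ps = (-1) ^+ size l *: lmo_ins l G t ps.
Proof.
case: l => [|x l]; first by rewrite /lmo_ins /= scaler0.
case: (lastP l) => [|bs z]; first by rewrite /lmo_ins /= scaler0.
have -> : rev (x :: rcons bs z) = enclose z (rev bs) x by rewrite rev_cons rev_rcons.
rewrite -/(enclose x bs z) (lmo_ins_words _ _ _ _ (size_rev bs)).
rewrite (lmo_ins_words _ _ _ _ (erefl _)); set n := size bs.
rewrite -[in RHS](perm_big _ (rev_comp_words n)) big_map scaler_sumr.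
rewrite big_seq [RHS]big_seq; apply: eq_bigr => w ww.
rewrite des_rev_comp; last by move=> i; rewrite (words_mem _ ww).
rewrite (spine_rev gG) scalerA mulrC -scalerA size_map (words_size ww).
rewrite /= size_rcons -/n -signr_odd -[in RHS]signr_odd /= negbK; congr (_ *: (_ *: _)).
have -> : rev (map (nth 0%N (rev bs)) w) =
    map (nth 0%N bs) (rev (map (fun i => n - i.+1)%N w)); last by [].
rewrite map_rev -map_comp; congr rev; apply/eq_in_map => i.
by rewrite (words_mem _ ww) => iw /=; rewrite nth_rev.
Qed.

(** The property of [T_k] behind the invariance of j_m under STU. It is
    [tree_sum_swap] when neither leaf is the last one, up to the choice of the
    first letter, which does not matter by [tree_sum_indep]. Exchanges with the
    last leaf reduce to exchanges with the first one by reversal. *)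
Lemma lmo_ins_swap l1 a b l2 s t ps :
  s \notin E0 ++ (l1 ++ a :: b :: l2) ++ names t ps ->
  lmo_ins (l1 ++ a :: b :: l2) G t ps - lmo_ins (l1 ++ b :: a :: l2) G t ps =
  lmo_ins (l1 ++ s :: l2) G ((s, b, a) :: t) ps.
Proof.
have main l l' z x y r : s \notin E0 ++ (l ++ x :: y :: rcons l' z) ++ names r ps ->
  lmo_ins (l ++ x :: y :: rcons l' z) G r ps - lmo_ins (l ++ y :: x :: rcons l' z) G r ps =
  lmo_ins (l ++ s :: rcons l' z) G ((s, y, x) :: r) ps.
  move=> sf; pose L := l ++ x :: y :: l'; set m := (size l + size l').+1.
  (* If [l] is empty, the exchange moves the first leaf. *)
  have wE u v : l ++ u :: v :: rcons l' z =
      enclose (head u l) (behead (l ++ u :: v :: l')) z.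
    by rewrite /enclose; case: (l) => [|c r'] /=; rewrite ?rcons_cat ?rcons_cons.
  have wE1 u : l ++ u :: rcons l' z = enclose (head u l) (behead (l ++ u :: l')) z.
    by rewrite /enclose; case: (l) => [|c r'] /=; rewrite ?rcons_cat ?rcons_cons.
  have sE u v : size (behead (l ++ u :: v :: l')) = m.
    by rewrite size_behead size_cat /= /m; lia.
  have sE1 u : (size (behead (l ++ u :: l'))).+1 = m.
    by rewrite size_behead size_cat /= /m; lia.
  have hE u v : head u l :: behead (l ++ u :: v :: l') = l ++ u :: v :: l' by case: (l).
  have hE1 u : head u l :: behead (l ++ u :: l') = l ++ u :: l' by case: (l).
  rewrite !wE wE1 !lmo_ins_tree_sum !sE sE1 !hE hE1.
  set i := size l; have im : (i < m)%N by rewrite /i /m ltnS leq_addr.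
  have sf' : s \notin E0 ++ (z :: map (nth 0%N L) (iota 0 m.+1)) ++ names r ps.
    have -> : map (nth 0%N L) (iota 0 m.+1) = L.
      have -> : m.+1 = size L by rewrite /L size_cat /= /m; lia.
      exact: mkseq_nth.
    by apply: contra sf; rewrite /L; mem_cases.
  have L1 : nth 0%N L i = x by rewrite /L nth_cat ltnn subnn.
  have L2 : nth 0%N L i.+1 = y by rewrite /L nth_cat ltnNge leqnSn /= subSnn.
  (* The letter that becomes the first one, [0], after the exchange. *)
  pose f := if i == 0%N then 1%N else 0%N.
  have fm : (f < m.+1)%N by rewrite /f; case: ifP => _; rewrite ?ltnS.
  have sf0 : swp i f = 0%N.
    by rewrite /f /swp; case: (eqVneq i 0%N) => [->//|]; rewrite eq_sym => /negPf->.
  have mf0 : merge i f = 0%N.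
    by rewrite /f /merge; case: (eqVneq i 0%N) => [->|]; rewrite //= ltn0.
  have := tree_sum_swap charK gG f im sf'; rewrite sf0 mf0 L1 L2.
  rewrite (tree_sum_indep charK gG (nth 0%N L) z r ps fm (ltn0Sn _)).
  rewrite (@eq_tree_sum _ _ G m.+1 (nth 0%N L \o swp i) (nth 0%N (l ++ y :: x :: l'))); last first.
    move=> k _ /=; rewrite /swp /L !nth_cat -/i.
    case: (eqVneq k i) => [->|nk]; first by rewrite ltnNge leqnSn /= subSnn ltnn subnn.
    case: (eqVneq k i.+1) => [->|nk']; first by rewrite ltnn subnn ltnNge leqnSn /= subSnn.
    case: (ltnP k i) => // hk.
    by have -> : (k - i = (k - i.+2).+2)%N by lia.
  move=> ->; apply: eq_tree_sum => k _.
  rewrite /L !nth_cat -/i /bump; case: (eqVneq k i) => [->|nk]; first by rewrite ltnn subnn.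
  case: (ltnP k i) => hk.
    have -> : ((i < k) + k = k)%N by lia.
    by rewrite hk.
  have -> : ((i < k) + k = k.+1)%N by lia.
  have -> : (k.+1 < i)%N = false by lia.
  have -> : (k.+1 - i = (k - i.+1).+2)%N by lia.
  by have -> : (k - i = (k - i.+1).+1)%N by lia.
case: (lastP l2) => [|l' z] sf; last exact: main.
case: (lastP l1) sf => [|l c] sf.
  rewrite !cat0s !lmo_ins2 [RHS](_ : _ = 0) //.
  by rewrite (spine_rev gG) /= expr0 scale1r subrr.
have key u r' : lmo_ins u G r' ps = (-1) ^+ size u *: lmo_ins (rev u) G r' ps.
  by rewrite lmo_ins_rev scalerA -exprMn mulrNN mulr1 expr1n scale1r.
have [r [z er]] : exists r z, rev (rcons l c) = rcons r z.
  case/lastP: (rev (rcons l c)) (size_rev (rcons l c)) => [|r z _]; first by rewrite size_rcons.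
  by exists r, z.
rewrite (key (rcons l c ++ [:: a; b])) (key (rcons l c ++ [:: b; a])) (key (rcons l c ++ [:: s])).
rewrite !rev_cat !size_cat er -scalerBr.
have sf1 : s \notin E0 ++ ([::] ++ b :: a :: rcons r z) ++ names t ps.
  by apply: contra sf; rewrite -er; mem_cases.
have -> := main [::] r z b a t sf1.
have gl := good_lmo_ins (s :: rcons r z) gG.
rewrite -[rev [:: s] ++ _]/(s :: rcons r z) -[[::] ++ _]/(s :: rcons r z).
rewrite [size [:: _; _]]/= [size [:: _]]/= addn2 addn1 exprS mulN1r scaleNr.
by rewrite (g_rot gl) (g_as gl) -(g_rot gl) scalerN opprK.
Qed.

End Fixed.
End LMOTrees.

(** * Pairings as insertions *)

Section Action.
Variables (K : fieldType) (V : lmodType K).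
Implicit Types (t : seq (nat * nat * nat)) (ps : seq (nat * nat)).
Implicit Types G : seq (nat * nat * nat) -> seq (nat * nat) -> V.

Definition relabel I (e : I -> nat) (E : graph I) : graph nat :=
  Graph (tri E) [seq (e l.1, l.2) | l <- leg E] (circ E).

Lemma labs_relabel I (e : I -> nat) (E : graph I) :
  labs (relabel e E) = map e (unzip1 (leg E)).
Proof. by rewrite /labs /relabel /= /unzip1 -!map_comp. Qed.

Lemma relabel_dunion I (e : I -> nat) (E1 E2 : graph I) :
  relabel e (dunion E1 E2) = dunion (relabel e E1) (relabel e E2).
Proof.
have eb : bound (relabel e E1) = bound E1.
  by rewrite /bound /ends /relabel /= /unzip2 -!map_comp.
by rewrite /relabel /dunion /= -/(relabel e E1) eb map_cat -!map_comp.
Qed.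

Lemma ins_dunion E0 G (E1 E2 : graph nat) : good E0 G ->
  ins (dunion E1 E2) G = ins E1 (ins E2 G).
Proof.
move=> gG; apply/funext => t; apply/funext => ps; set b := bound E1.
have gE2 := good_ins E2 gG.
pose A := E0 ++ labs E1 ++ labs E2 ++ names t ps.
have [N hN] := belowP A.
have belowS B C (l : nat) : {subset B <= C} -> below l C -> below l B.
  by move=> h /allP hC; apply/allP => a /h/hC.
rewrite (ins_below (N := N) gG); last first.
  apply: (belowS _ A) => // a; rewrite /avoid /labs /= /unzip1 map_cat -map_comp.
  by rewrite !mem_cat => /or3P[->|/orP[->|->]|/orP[->|->]]; rewrite ?orbT.
rewrite (ins_below (N := N) gE2); last first.
  apply: (belowS _ A) => // a.
  by rewrite !mem_cat => /or3P[/orP[->|->]|->|/orP[->|->]]; rewrite ?orbT.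
rewrite /attach (ins_any (rho := fun a => (N + (b + a))%N) gG); last first.
  split=> [x y _ _ /addnI/addnI //|x _]; apply/negP.
  have hA y : y \in A -> (y < N)%N by move/(allP hN).
  rewrite mem_cat => /orP[xE|].
    by have := hA (N + (b + x))%N; rewrite mem_cat xE => /(_ isT); rewrite ltnNge leq_addr.
  rewrite mem_cat => /orP[xE|/names_attach].
    by have := hA (N + (b + x))%N; rewrite !mem_cat xE !orbT => /(_ isT); rewrite ltnNge leq_addr.
  rewrite !mem_cat => /or3P[xE|/mapP[y /ends_lt yE /addnI e]|xE].
  - by have := hA (N + (b + x))%N; rewrite !mem_cat xE !orbT => /(_ isT); rewrite ltnNge leq_addr.
  - by move: yE; rewrite -e ltnNge leq_addr.
  - by have := hA (N + (b + x))%N; rewrite !mem_cat xE !orbT => /(_ isT); rewrite ltnNge leq_addr.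
rewrite /attach /dunion /= !map_cat -!map_comp -!catA.
rewrite (g_t gG (t' := map (map_tri (fun a => N + (b + a))%N) (tri E2) ++ map (map_tri (addn N)) (tri E1) ++ t)).
  by apply: (g_ps gG); rewrite perm_catCA.
by rewrite perm_catCA.
Qed.

Lemma ins_empty E0 G (k : nat) : good E0 G -> ins (Graph [::] [::] k) G = G.
Proof.
move=> gG; apply/funext => t; apply/funext => ps.
have [N hN] := belowP (avoid E0 (Graph [::] [::] k) t ps).
by rewrite (ins_below gG hN).
Qed.

Variables (I : finType) (e : I -> nat).

(** A leg labelled [i] goes to the edge [e i]. Disjoint unions then act by
    composition, which turns products of trees into successive insertions. *)
Definition act (u : {malg K[diag false I]}) G t ps : V :=
  linext (fun E : diag false I => ins (relabel e (val E)) G t ps) u.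

Let EI := map e (enum I).

Lemma good_relabel G E : good EI G -> good EI (ins (relabel e E) G).
Proof.
move=> /(good_ins (relabel e E)); apply: good_sub => a.
rewrite mem_cat labs_relabel => /orP[/mapP[i _ ->]|//].
by apply: map_f; rewrite mem_enum.
Qed.

Lemma good_act u G : good EI G -> good EI (act u G).
Proof.
by move=> gG; apply: good_sum => E _; apply: good_scale; apply: good_relabel.
Qed.

Lemma act_gen E G t ps : diag_ok false E ->
  act (gen K false E) G t ps = ins (relabel e E) G t ps.
Proof. by move=> ok; rewrite /act /gen; case: insubP => [E' _ <-|/negP//]; rewrite linextU. Qed.

Lemma act_dunit G : good EI G -> act (dunit K false I) G = G.
Proof.
move=> gG; apply/funext => t; apply/funext => ps.
by rewrite /dunit act_gen ?diag_ok_empty // (ins_empty _ gG).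
Qed.

Lemma act_dmul u v G : good EI G -> act (dmul u v) G = act u (act v G).
Proof.
move=> gG; apply/funext => t; apply/funext => ps.
rewrite /dmul [LHS]/act linext_comp /act; apply: eq_linext => E1 /=.
rewrite linext_comp /=.
rewrite (@ins_linear _ _ _ _ _ _ _ EI); last by move=> E; exact: good_relabel.
apply: eq_bigr => E2 _; congr (_ *: _).
rewrite -[LHS]/(act (gen K false (dunion (val E1) (val E2))) G t ps) act_gen.
  by rewrite relabel_dunion (ins_dunion _ _ gG).
by apply: diag_ok_dunion; apply: valP.
Qed.

Lemma act_big J (r : seq J) (P : pred J) (F : J -> {malg K[diag false I]}) G :
  good EI G ->
  act (\big[@dmul K false I/dunit K false I]_(j <- r | P j) F j) G =
  foldr (fun j => act (F j)) G [seq j <- r | P j].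
Proof.
move=> gG; elim: r => [|j r IH]; first by rewrite big_nil act_dunit.
by rewrite big_cons /=; case: (P j); rewrite //= act_dmul // IH.
Qed.

Lemma act_lmo_tree l G : good EI G -> act (lmo_tree K l) G = lmo_ins (map e l) G.
Proof.
move=> gG; apply/funext => t; apply/funext => ps.
rewrite /act /lmo_tree /lmo_ins size_map; case sl: (size l) => [|[|n]]; try exact: linear0.
rewrite linear_sum; apply: eq_bigr => s _; rewrite linearZ; congr (_ *: _).
rewrite -[LHS]/(act (gen K false (comb s l)) G t ps) act_gen ?diag_ok_comb //.
have zipE (s' : seq nat) : [seq (e p.1, p.2) | p <- zip l s'] = zip (map e l) s'.
  by elim: (l) s' => [|x l' IH] [|y s'] //=; rewrite IH.
by rewrite /comb -zipE.
Qed.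

(** Said by extensionality rather than on the support of [u], so as to pass
    through the bilinear product easily. *)
Definition labelled (L : seq I) (u : {malg K[diag false I]}) : Prop :=
  forall (W : lmodType K) (F F' : diag false I -> W),
  (forall E, perm_eq (unzip1 (leg (val E))) L -> F E = F' E) ->
  linext F u = linext F' u.

Lemma labelled_perm L L' u : perm_eq L L' -> labelled L u -> labelled L' u.
Proof.
move=> h lu W F F' e'; apply: lu => E hE; apply: e'; exact: perm_trans h.
Qed.

Lemma labelled_gen E : diag_ok false E -> labelled (unzip1 (leg E)) (gen K false E).
Proof.
move=> ok W F F' h; rewrite /gen; case: insubP => [E' _ eE|/negP//].
by rewrite !linextU; apply: h; rewrite eE.
Qed.

Lemma labelled_dmul L L' u v : labelled L u -> labelled L' v ->
  labelled (L ++ L') (dmul u v).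
Proof.
move=> lu lv W F F' h; rewrite /dmul !linext_comp; apply: lu => E1 h1 /=.
rewrite !linext_comp; apply: lv => E2 h2 /=.
have ok : diag_ok false (dunion (val E1) (val E2)).
  by apply: diag_ok_dunion; apply: valP.
rewrite /gen; case: insubP => [E' _ eE|/negP//].
rewrite !linextU; apply: h; rewrite eE /= /unzip1 map_cat -map_comp.
exact: perm_cat h1 h2.
Qed.

Lemma labelled_big J (r : seq J) (P : pred J) (L : J -> seq I) F :
  (forall j, labelled (L j) (F j)) ->
  labelled (flatten [seq L j | j <- r & P j])
    (\big[@dmul K false I/dunit K false I]_(j <- r | P j) F j).
Proof.
move=> h; elim: r => [|j r IH].
  rewrite big_nil; apply: (@labelled_gen (Graph [::] [::] 0)); exact: diag_ok_empty.
by rewrite big_cons /=; case: (P j) => //=; apply: labelled_dmul.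
Qed.

Lemma labelled_lmo_tree l : labelled l (lmo_tree K l).
Proof.
rewrite /lmo_tree; case sl: (size l) => [|[|n]] W F F' h; rewrite ?linear0 //.
rewrite !linear_sum; apply: eq_bigr => s _; rewrite !linearZ; congr (_ *: _).
have := @labelled_gen (comb s l) (diag_ok_comb _ _ sl); apply=> E hE; apply: h.
have e1 : unzip1 (leg (comb s l)) = l.
  by apply: unzip1_zip; rewrite sl /= size_rcons size_iota.
by rewrite e1 in hE.
Qed.

End Action.

Section Pairing.
Variables (K : fieldType) (V : lmodType K).
Variable cl : {linear {malg K[diag true void]} -> V}.
Hypothesis cl_rel : forall v, graph_rel v -> cl v = 0.

(** Gluing shifts the edges of [D] and insertion those of [E]; the results agree
    up to renaming. *)
Lemma glue_ins (X : eqType) (E D : graph X)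
    (f : {ffun 'I_(size (leg E)) -> 'I_(size (leg D))}) :
  circ E = 0%N -> circ D = 0%N ->
  cl (gen K true (glue f)) =
  ins (Graph (tri E) [seq (leg_edge (f i), leg_edge i) | i <- enum 'I_(size (leg E))] 0)
    (ev cl) (tri D) [::].
Proof.
move=> cE cD; rewrite /glue /join cE cD.
pose b := bound E; pose ps := [seq (leg_edge i, (b + leg_edge (f i))%N) | i <- enum 'I_(size (leg E))].
rewrite -[LHS]/(ev cl (tri (dunion E D)) ps).
set E' := Graph _ _ _.
have endE' : ends E' = ends E.
  rewrite /ends /E' /=; congr (_ ++ _).
  by rewrite -[RHS]leg_edges /unzip2 -map_comp.
have [N hN] := belowP (avoid [::] E' (tri D) [::] ++ ends D).
move: hN; rewrite below_cat => /andP[hN /allP hD].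
rewrite (ins_below (ev_good cl_rel) hN) /attach cats0.
(* [h0] undoes the shift of [E] in the insertion and performs that of [D] in the
   gluing. *)
pose h0 n := if n \in ends D then (b + n)%N else (n - N)%N.
have hE a : a \in ends E -> h0 (N + a)%N = a.
  move=> aE; rewrite /h0 addKn; case: ifP => // /hD; by rewrite ltnNge leq_addr.
have [h hI hh] : exists2 h, injective h & {in ends D ++ map (addn N) (ends E), forall a, h a = h0 a}.
  apply: inj_extend => x y; rewrite !(mem_cat _ (ends D)).
  case/orP => [xD|/mapP[x' xE ->]] /orP[yD|/mapP[y' yE ->]].
  - by rewrite /h0 xD yD => /addnI.
  - rewrite hE // /h0 xD => e; have := ends_lt yE; by rewrite -e ltnNge leq_addr.
  - rewrite hE // /h0 yD => e; have := ends_lt xE; by rewrite e ltnNge leq_addr.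
  - by rewrite !hE // => ->.
rewrite -[RHS](ev_ren cl_rel _ _ hI) map_cat -!map_comp.
have hD' a : a \in ends D -> h a = (b + a)%N.
  by move=> aD; rewrite hh ?(mem_cat _ (ends D)) ?aD // /h0 aD.
have hE' a : a \in ends E -> h (N + a)%N = a.
  by move=> aE; rewrite hh ?hE // (mem_cat _ (ends D)) map_f ?orbT.
congr (ev cl _ _); last first.
  rewrite /ps /E' [leg _]/= -!map_comp; apply/eq_in_map => i _; rewrite /map_pair /= hE' ?hD' //.
    by rewrite /ends mem_cat; apply/orP; right; apply: map_f; apply: mem_tnth.
  by rewrite /ends mem_cat; apply/orP; right; apply: map_f; apply: mem_tnth.
rewrite /dunion /=; congr (_ ++ _).
  rewrite -[RHS]/(map (map_tri (h \o addn N)) (tri E)) map_tri_id_in // => a aE.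
  by rewrite /= hE' // mem_cat aE.
by apply: eq_in_map_tri => a aD; rewrite hD' // mem_cat aD.
Qed.

Lemma circ0 (X : choiceType) (D : diag false X) : circ (val D) = 0%N.
Proof. by have := valP D; rewrite /diag_ok /= => /andP[_ /eqP]. Qed.

Lemma pairing_gen o (X : choiceType) (u : {malg K[diag false X]}) (D : diag o X) :
  cl (pairing u << D >>) =
  linext (fun E : diag false X => \sum_(f | gluing f) cl (gen K true (@glue X (val E) (val D) f))) u.
Proof.
rewrite /pairing linext_comp; apply: eq_linext => E /=.
by rewrite linextU linear_sum.
Qed.

(** Once the legs are numbered, there is just one way of gluing. *)
Lemma pairing_act (X : choiceType) (D : diag false X)
    (u : {malg K[diag false 'I_(size (leg (val D)))]}) :
  labelled (enum 'I_(size (leg (val D)))) u ->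
  cl (pairing u (gen K false (number_legs (val D)))) =
  act (@leg_edge X (val D)) u (ev cl) (tri (val D)) [::].
Proof.
set n := size _; move=> lu.
have okN := diag_ok_number_legs (valP D).
rewrite /gen; case: insubP => [N' _ eN|/negP//].
rewrite pairing_gen eN /act; apply: lu => E hE.
set N := number_legs (val D).
have zN : size (leg N) = n by rewrite size_map size_enum_ord.
have nthN (j : 'I_(size (leg N))) :
    tnth (in_tuple (leg N)) j = (cast_ord zN j, leg_edge (cast_ord zN j)).
  rewrite (tnth_nth (cast_ord zN j, 0%N)) /= (nth_map (cast_ord zN j)).
    by rewrite -[X in nth _ _ X]/(nat_of_ord (cast_ord zN j)) nth_ord_enum.
  by rewrite size_enum_ord -[X in (_ < X)%N]zN.
have zE : size (leg (val E)) = n.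
  by rewrite -(size_map fst) (perm_size hE) size_enum_ord.
pose f0 := [ffun i : 'I_(size (leg (val E))) => cast_ord (esym zN) (leg_label i)].
have lab_f0 i : leg_label (f0 i) = leg_label i.
  by rewrite {1}/leg_label nthN /= ffunE; apply: val_inj.
have glE f : gluing f = (f == f0 :> {ffun 'I_(size (leg (val E))) -> 'I_(size (leg N))}).
  apply/and3P/eqP => [[_ _ /forallP h]|->].
    apply/ffunP => i; apply: val_inj; have /eqP := h i.
    by rewrite {1}/leg_label nthN /= ffunE => <-.
  split; last by apply/forallP => i; rewrite lab_f0.
    apply/injectiveP => i j /(congr1 (@leg_label _ N)); rewrite !lab_f0.
    move=> e; apply: val_inj.
    have uL : uniq (unzip1 (leg (val E))) by rewrite (perm_uniq hE) enum_uniq.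
    have nthE (k : 'I_(size (leg (val E)))) : nth (leg_label i) (unzip1 (leg (val E))) k = leg_label k.
      rewrite (nth_map (leg_label i, 0%N)) //.
      by rewrite [in RHS]/leg_label [in RHS](tnth_nth (leg_label i, 0%N)).
    have /eqP : nth (leg_label i) (unzip1 (leg (val E))) i = nth (leg_label i) (unzip1 (leg (val E))) j.
      by rewrite !nthE e.
    by rewrite nth_uniq ?size_map // => /eqP.
  by rewrite zE zN.
rewrite (big_pred1 f0) // glue_ins; [|exact: circ0|exact: (circ0 D)].
have -> : [seq (leg_edge (f0 i), leg_edge i) | i <- enum 'I_(size (leg (val E)))] =
    leg (relabel (@leg_edge X (val D)) (val E)).
  have -> : leg (relabel (@leg_edge X (val D)) (val E)) =
      map (fun l => (leg_edge l.1, l.2)) (map (tnth (in_tuple (leg (val E)))) (enum 'I__)).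
    by rewrite map_tnth_enum.
  rewrite -[RHS]map_comp.
  apply: eq_map => i /=; rewrite -[in RHS]/(leg_label i) -lab_f0.
  by congr (_, _); rewrite /leg_edge /leg_label !nthN.
by rewrite /relabel circ0.
Qed.

End Pairing.

(** * Partitions and colourings of the legs *)

Section Colourings.
Variables (X I : finType) (m : nat) (lab : I -> X).

(** A colouring of the legs by ['I_m] cuts the legs with a given label into [m]
    numbered blocks. *)
Definition block (c : {ffun I -> 'I_m}) (q : X * 'I_m) : {set I} :=
  [set i | (lab i == q.1) && (c i == q.2)].

Definition blocks_of (c : {ffun I -> 'I_m}) : {ffun X -> {set {set I}}} :=
  [ffun x => [set block c (x, j) | j : 'I_m]].

Definition full (c : {ffun I -> 'I_m}) : bool := [forall q, block c q != finset.set0].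

Definition is_blocks (p : {ffun X -> {set {set I}}}) : bool :=
  [forall x, finset.partition (p x) [set i | lab i == x] && (#|p x| == m)].

Lemma block_inj c x : full c -> injective (fun j => block c (x, j)).
Proof.
move=> /forallP fc j j' e; have /set0Pn[i] := fc (x, j).
rewrite inE /= => /andP[lx cj].
have : i \in block c (x, j') by rewrite -e inE lx.
by rewrite inE /= => /andP[_ /eqP <-]; rewrite (eqP cj).
Qed.

Lemma blocks_of_is_blocks c : full c -> is_blocks (blocks_of c).
Proof.
move=> fc; apply/forallP => x; rewrite ffunE; apply/andP; split; last first.
  by rewrite card_imset ?card_ord //; exact: block_inj.
apply/and3P; split.
- apply/eqP/setP => i; rewrite inE; apply/bigcupP/idP => [[B /imsetP[j _ ->]]|lx].
    by rewrite inE => /andP[].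
  by exists (block c (x, c i)); [apply: imset_f|rewrite inE /= lx eqxx].
- apply/finset.trivIsetP => A B /imsetP[j _ ->] /imsetP[j' _ ->] ne.
  apply/pred0P => i /=; apply/negP; rewrite !inE /= => /andP[/andP[_ /eqP e1] /andP[_ /eqP e2]].
  by move: ne; rewrite -e1 -e2 eqxx.
- apply/imsetP => -[j _ e]; have := forallP fc (x, j); by rewrite -e eqxx.
Qed.

(** A colouring with the given blocks is a numbering of the [m] blocks of each
    label. *)
Lemma card_blocks_of p : is_blocks p ->
  #|[set c | full c && (blocks_of c == p)]| = (m`! ^ #|X|)%N.
Proof.
move=> /forallP hp.
pose F x := [pred g : {ffun 'I_m -> {set I}} | (g \in ffun_on (mem (p x))) && injectiveb g].
pose Phi (c : {ffun I -> 'I_m}) : {ffun X -> {ffun 'I_m -> {set I}}} :=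
  [ffun x => [ffun j => block c (x, j)]].
have Phi_inj : injective Phi.
  move=> c c' e; apply/ffunP => i.
  have : i \in block c (lab i, c i) by rewrite inE !eqxx.
  have /ffunP/(_ (lab i))/ffunP/(_ (c i)) := e.
  by rewrite !ffunE => ->; rewrite inE /= eqxx /= => /eqP.
rewrite -(card_imset _ Phi_inj).
have -> : Phi @: [set c | full c && (blocks_of c == p)] = [set q in family F].
  apply/setP => q; apply/imsetP/idP => [[c]|].
    rewrite inE => /andP[fc /eqP ep] ->; rewrite inE; apply/familyP => x.
    rewrite inE; apply/andP; split; last first.
      apply/injectiveP => j j'; rewrite !ffunE; exact: block_inj.
    by apply/ffun_onP => j; rewrite !ffunE -ep ffunE; apply: imset_f.
  rewrite inE => /familyP qF.
  have qP x : (forall j, q x j \in p x) /\ injective (q x).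
    by have := qF x; rewrite inE => /andP[/ffun_onP h /injectiveP].
  have ontoq x B : B \in p x -> exists j, B = q x j.
    have -> : p x = q x @: 'I_m.
      have /andP[_ /eqP cpx] := hp x; apply/esym/eqP.
      rewrite eqEcard cpx card_imset ?card_ord ?leqnn ?andbT; last by case: (qP x).
      by apply/fintype.subsetP => _ /imsetP[j _ ->]; case: (qP x).
    by case/imsetP => j _ ->; exists j.
  have cov x i : lab i = x -> exists j, i \in q x j.
    move=> lx; have /andP[/and3P[/eqP cv _ _] _] := hp x.
    have : i \in finset.cover (p x) by rewrite cv inE lx eqxx.
    by case/bigcupP => B /ontoq[j ->] ij; exists j.
  have sub x j i : i \in q x j -> lab i = x.
    move=> ij; have /andP[/and3P[/eqP cv _ _] _] := hp x.
    have : i \in finset.cover (p x) by apply/bigcupP; exists (q x j) => //; case: (qP x).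
    by rewrite cv inE => /eqP.
  have uni x j j' i : i \in q x j -> i \in q x j' -> j = j'.
    move=> ij ij'; have /andP[/and3P[_ /finset.trivIsetP tI _] _] := hp x.
    have [hq qi] := qP x; apply: qi; apply/eqP; apply/negPn/negP => ne.
    by have /pred0P/(_ i) := tI _ _ (hq j) (hq j') ne; rewrite /= ij ij'.
  have /fin_all_exists[c0 hc0] i : exists j, i \in q (lab i) j by exact: cov.
  pose c := [ffun i => c0 i].
  have bE x j : block c (x, j) = q x j.
    apply/setP => i; rewrite inE /= ffunE; apply/andP/idP => [[/eqP <- /eqP <-] //|ij].
    have lx := sub _ _ _ ij; rewrite lx eqxx; split=> //; apply/eqP.
    by apply: (uni x _ _ i _ ij); rewrite -lx.
  exists c; last by apply/ffunP => x; apply/ffunP => j; rewrite !ffunE bE.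
  have fc : full c.
    apply/forallP => -[x j]; rewrite bE; have /andP[/and3P[_ _ n0] _] := hp x.
    by apply: contraNneq n0 => <-; case: (qP x).
  rewrite inE fc /=; apply/eqP/ffunP => x; rewrite ffunE.
  apply/setP => B; apply/imsetP/idP => [[j _ ->]|/ontoq[j ->]].
    by rewrite bE; case: (qP x).
  by exists j; rewrite ?bE.
rewrite cardsE card_family /image_mem.
have e x : #|F x| = m`!.
  have := card_inj_ffuns_on 'I_m (mem (p x)).
  rewrite card_ord; have /andP[_ /eqP ->] := hp x; rewrite ffactnn => <-.
  by rewrite cardsE; apply: eq_card => g; rewrite !inE.
rewrite cardT; elim: (enum X) => //= x s ->.
by rewrite e expnS.
Qed.

End Colourings.

Section Forests.
Variables (K : fieldType) (V : lmodType K).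
Hypothesis charK : [pchar K] =i pred0.
Variable cl : {linear {malg K[diag true void]} -> V}.
Hypothesis cl_rel : forall v, graph_rel v -> cl v = 0.
Implicit Types (t : seq (nat * nat * nat)) (ps : seq (nat * nat)).

Definition forest (bl : seq (seq nat)) := foldr (fun l G => lmo_ins l G) (ev cl) bl.

Lemma good_forest bl : good (flatten bl) (forest bl).
Proof. by elim: bl => [|l bl IH] /=; [exact: ev_good|exact: good_lmo_ins]. Qed.

Lemma forest_perm bl bl' : perm_eq bl bl' -> forest bl = forest bl'.
Proof.
apply: (perm_adjacent_ind (R := fun s s' => forest s = forest s')) => [//|s1 s2 s3 -> //|u x y v].
rewrite /forest !foldr_cat /=; congr foldr.
by rewrite (lmo_ins_comm _ _ (good_forest v)).
Qed.

Lemma lmo_ins0 l : lmo_ins l (fun _ _ => 0 : V) = fun _ _ => 0.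
Proof.
apply/funext => t; apply/funext => ps; rewrite /lmo_ins.
by case: (size l) => [|[|n]] //; rewrite big1 // => s _; rewrite ins0 scaler0.
Qed.

Lemma forest_small bl l : l \in bl -> (size l < 2)%N -> forest bl = fun _ _ => 0.
Proof.
elim: bl => //= l' bl IH; rewrite inE => /orP[/eqP<-|/IH h] sl.
  exact: lmo_ins_small.
by rewrite h // lmo_ins0.
Qed.

Lemma foldr_flatten (T : Type) (s : seq T) (f : T -> seq (seq nat)) G :
  foldr (fun x H => foldr (fun l H => lmo_ins l H : seq (nat * nat * nat) -> seq (nat * nat) -> V) H (f x)) G s =
  foldr (fun l H => lmo_ins l H) G (flatten (map f s)).
Proof. by elim: s => //= x s ->; rewrite foldr_cat. Qed.

Variables (X : finType) (m : nat).

Lemma perm_blocks (n : nat) (p : X -> {set {set 'I_n}}) (lab : 'I_n -> X) :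
  (forall x, finset.partition (p x) [set i | lab i == x]) ->
  perm_eq (flatten [seq flatten [seq enum (B : {set _}) | B <- index_enum {set 'I_n} & B \in p x] | x <- index_enum X])
    (enum 'I_n).
Proof.
move=> hp; apply/seq.permP => P.
rewrite count_flatten -map_comp sumnE big_map.
transitivity (\sum_(x : X) \sum_(B in p x) \sum_(i in B | P i) 1)%N.
  apply: eq_bigr => x _ /=; rewrite count_flatten -map_comp sumnE big_map big_filter.
  by apply: eq_bigr => B _ /=; rewrite -big_enum_cond /= sum1_count.
transitivity (\sum_(x : X) \sum_(i | lab i == x) P i)%N.
  apply: eq_bigr => x _; have /and3P[/eqP cv tI _] := hp x.
  under eq_bigr => B _ do rewrite big_mkcondr /=.
  rewrite -(finset.big_trivIset _ tI) cv /=; apply: eq_big => i; rewrite ?inE //.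
have -> : count P (enum 'I_n) = (\sum_(i < n) P i)%N.
  by rewrite -sum1_count big_mkcond /= big_enum; apply: eq_bigr => i _; case: (P i).
by rewrite [RHS](partition_big lab xpredT).
Qed.

(** Partitions into [m] blocks are replaced by colourings with [m] colours, each
    partition being counted [m`!] times for every label. The colourings with an
    empty block do not matter because [T_0 = 0]. *)
Lemma jm_forest (D : diag false X) :
  cl (jm_diag K m D) = ((m`! ^ #|X|)%:R)^-1 *:
   \sum_(c : {ffun 'I_(size (leg (val D))) -> 'I_m})
     forest [seq map (@leg_edge X (val D)) (enum (block (@leg_label X (val D)) c q)) | q <- enum {: X * 'I_m}]
       (tri (val D)) [::].
Proof.
set n := size _; set e := @leg_edge X (val D); set lab := @leg_label X (val D).
set t := tri (val D).
pose W p := forest (flatten [seq [seq map e (enum (B : {set 'I_n})) | B <- index_enum {set 'I_n} & B \in (p : {ffun X -> {set {set 'I_n}}}) x] | x <- index_enum X]) t [::].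
have e1 : cl (jm_diag K m D) = \sum_(p | is_blocks m lab p) W p.
  rewrite /jm_diag linear_sum; apply: eq_bigr => p /forallP hp.
  rewrite pairing_act //; last first.
    apply: labelled_perm (perm_blocks (p := p) (lab := lab) _) _.
      by move=> x; case/andP: (hp x).
    have h := @labelled_big K _ X (index_enum X) xpredT
      (fun x => flatten [seq enum (B : {set 'I_n}) | B <- index_enum {set 'I_n} & B \in p x])
      (fun x => \big[@dmul K false 'I_n/dunit K false 'I_n]_(B in p x) lmo_tree K (enum (B : {set _}))).
    rewrite filter_predT in h; apply: h => x.
    apply: (labelled_big (L := fun B : {set 'I_n} => enum B)) => B; exact: labelled_lmo_tree.
  have gE : good (map e (enum 'I_n)) (ev cl) by apply: good_sub (ev_good cl_rel).
  rewrite act_big // filter_predT /W /forest -foldr_flatten.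
  have step (s : seq X) : foldr (fun x => act e (\big[@dmul K false 'I_n/dunit K false 'I_n]_(B in p x) lmo_tree K (enum (B : {set _})))) (ev cl) s =
     foldr (fun x H => foldr (fun l H => lmo_ins l H) H [seq map e (enum (B : {set 'I_n})) | B <- index_enum {set 'I_n} & B \in p x]) (ev cl) s
     /\ good (map e (enum 'I_n)) (foldr (fun x => act e (\big[@dmul K false 'I_n/dunit K false 'I_n]_(B in p x) lmo_tree K (enum (B : {set _})))) (ev cl) s).
    elim: s => //= x s [<- gs]; split; last exact: good_act.
    rewrite act_big // foldr_map.
    elim: [seq B <- _ | _] => //= B r IH.
    rewrite IH act_lmo_tree // -IH.
    by elim: (r) => //= B' r' IH'; exact: good_act.
  by case: (step (index_enum X)) => ->.
rewrite e1.
set Z := \sum_c _.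
have -> : Z = \sum_(c | full lab c) forest [seq map e (enum (block lab c q)) | q <- enum {: X * 'I_m}] t [::].
  rewrite /Z (bigID (full lab)) /= [X in _ + X]big1 ?addr0 // => c /forallPn[q].
  rewrite negbK => /eqP h; rewrite (@forest_small _ [::]) //.
  by apply/mapP; exists q; rewrite ?mem_enum // h enum_set0.
rewrite (partition_big (blocks_of lab) (is_blocks m lab)) /=; last first.
  by move=> c; exact: blocks_of_is_blocks.
have e2 p : is_blocks m lab p ->
    \sum_(c | full lab c && (blocks_of lab c == p))
      forest [seq map e (enum (block lab c q)) | q <- enum {: X * 'I_m}] t [::] =
    (m`! ^ #|X|)%:R *: W p.
  move=> hp; rewrite -(card_blocks_of hp) scaler_nat -sumr_const.
  apply: eq_big => [c|c /andP[fc /eqP <-]]; first by rewrite inE.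
  rewrite /W; congr (_ t [::]); apply: forest_perm.
  pose h (B : {set 'I_n}) := map e (enum B).
  have -> : [seq map e (enum (block lab c q)) | q <- enum {: X * 'I_m}] =
      map h (map (block lab c) (enum {: X * 'I_m})) by rewrite -[RHS]map_comp.
  have -> : flatten [seq [seq h B | B <- index_enum {set 'I_n} & B \in blocks_of lab c x] | x <- index_enum X]
      = map h (flatten [seq [seq B <- index_enum {set 'I_n} | B \in blocks_of lab c x] | x <- index_enum X]).
    by rewrite map_flatten -[in RHS]map_comp.
  apply: perm_map; apply/seq.permP => P.
  rewrite count_map count_flatten -map_comp sumnE big_map.
  have countE (T : Type) (s : seq T) (a b : pred T) :
      count a (filter b s) = (\sum_(x <- s | b x) a x)%N.
    by elim: s => [|x s IH]; rewrite ?big_nil // big_cons /=; case: (b x); rewrite //= IH.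
  have -> : count (preim (block lab c) P) (enum {: X * 'I_m}) =
      (\sum_(x : X) \sum_(j < m) P (block lab c (x, j)))%N.
    rewrite -[enum _]filter_predT countE big_enum pair_bigA.
    by apply: eq_bigr => -[].
  apply: eq_bigr => x _ /=; rewrite countE ffunE big_imset //= => j j' _ _.
  exact: block_inj.
rewrite (eq_bigr _ e2) -scaler_sumr scalerA mulVf ?scale1r //.
by rewrite natr_neq0 // expn_gt0 fact_gt0.
Qed.

End Forests.

(** * The map j_m as a function of the list of legs *)

Section ColouredLists.
Variables (K : fieldType) (V : lmodType K) (T : Type) (m : nat).
Implicit Types (F : seq (T * 'I_m) -> V).

(** The sum over the colourings of [ls] (see [sum_col_ffun]), by recursion so as
    to isolate the colours of two neighbours. *)
Fixpoint sum_col (ls : seq T) F : V :=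
  if ls is l :: r then \sum_(j < m) sum_col r (fun cs => F ((l, j) :: cs)) else F [::].

Lemma eq_sum_col ls F F' : (forall cs, unzip1 cs = ls -> F cs = F' cs) ->
  sum_col ls F = sum_col ls F'.
Proof.
elim: ls F F' => [|l r IH] F F' h /=; first exact: h.
by apply: eq_bigr => j _; apply: IH => cs e; apply: h; rewrite /= e.
Qed.

Lemma sum_col_cat l1 l2 F :
  sum_col (l1 ++ l2) F = sum_col l1 (fun s1 => sum_col l2 (fun s2 => F (s1 ++ s2))).
Proof. by elim: l1 F => //= l r IH F; apply: eq_bigr => j _; rewrite IH. Qed.

Lemma sum_col_linear ls (c : K) F F' :
  sum_col ls (fun cs => c *: F cs + F' cs) = c *: sum_col ls F + sum_col ls F'.
Proof.
elim: ls F F' => //= l r IH F F'; rewrite scaler_sumr -big_split /=.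
by apply: eq_bigr => j _; rewrite IH.
Qed.

Lemma sum_col0 ls : sum_col ls (fun=> 0) = 0.
Proof. by elim: ls => //= l r ->; rewrite big1. Qed.

Lemma sum_colD ls F F' : sum_col ls (fun cs => F cs + F' cs) = sum_col ls F + sum_col ls F'.
Proof.
rewrite -[in RHS](scale1r (sum_col ls F)) -sum_col_linear.
by apply: eq_sum_col => cs _; rewrite scale1r.
Qed.

Lemma sum_colB ls F F' : sum_col ls (fun cs => F cs - F' cs) = sum_col ls F - sum_col ls F'.
Proof.
rewrite addrC -scaleN1r -sum_col_linear.
by apply: eq_sum_col => cs _; rewrite scaleN1r addrC.
Qed.

Lemma sum_colN ls F : sum_col ls (fun cs => - F cs) = - sum_col ls F.
Proof.
rewrite -[RHS]add0r -(sum_col0 ls) -sum_colB.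
by apply: eq_sum_col => cs _; rewrite add0r.
Qed.

Lemma sum_ffun_cons n (H : {ffun 'I_n.+1 -> 'I_m} -> V) :
  \sum_c H c = \sum_(j < m) \sum_(c : {ffun 'I_n -> 'I_m})
    H [ffun i => if unlift ord0 i is Some k then c k else j].
Proof.
rewrite pair_bigA /=.
pose g (p : 'I_m * {ffun 'I_n -> 'I_m}) : {ffun 'I_n.+1 -> 'I_m} :=
  [ffun i => if unlift ord0 i is Some k then p.2 k else p.1].
pose g' (c : {ffun 'I_n.+1 -> 'I_m}) := (c ord0, [ffun k => c (lift ord0 k)]).
have gK : cancel g g'.
  move=> [j c]; rewrite /g' /g !ffunE unlift_none /=; congr (_, _).
  by apply/ffunP => k; rewrite !ffunE liftK.
have g'K : cancel g' g.
  move=> c; apply/ffunP => i; rewrite /g !ffunE /=.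
  by case: unliftP => [k ->|->]; rewrite ?ffunE.
by rewrite (reindex g) //=; exists g' => c _; [exact: gK|exact: g'K].
Qed.

Lemma sum_col_ffun ls F :
  sum_col ls F = \sum_(c : {ffun 'I_(size ls) -> 'I_m})
    F (zip ls [seq c i | i <- enum 'I_(size ls)]).
Proof.
elim: ls F => [|l r IH] F /=.
  transitivity (\sum_(c in {: {ffun 'I_0 -> 'I_m}}) F [::]); last first.
    by apply: eq_big => [c|c _]; rewrite ?inE //; case: (map _ _).
  by rewrite sumr_const card_ffun !card_ord.
rewrite sum_ffun_cons; apply: eq_bigr => j _; rewrite IH; apply: eq_bigr => c _.
congr F; rewrite enum_ordSl /= ffunE unlift_none; congr (_ :: zip _ _).
by rewrite -map_comp; apply: eq_map => i /=; rewrite ffunE liftK.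
Qed.

End ColouredLists.

Section JM.
Variables (K : fieldType) (V : lmodType K).
Hypothesis charK : [pchar K] =i pred0.
Variable cl : {linear {malg K[diag true void]} -> V}.
Hypothesis cl_rel : forall v, graph_rel v -> cl v = 0.
Variables (X : finType) (m : nat).
Implicit Types (t : seq (nat * nat * nat)) (ps : seq (nat * nat)).
Implicit Types (cs : seq ((X * nat) * 'I_m)) (ls : seq (X * nat)).

Definition colour_block (q : X * 'I_m) cs : seq nat :=
  [seq c.1.2 | c <- cs & (c.1.1, c.2) == q].

Definition colour_forest cs := forest cl [seq colour_block q cs | q <- enum {: X * 'I_m}].

(** The value of j_m up to a factor (see [jm_sumE]), as a function of an arbitrary
    list of legs. *)
Definition jm_sum ls t : V := sum_col ls (fun cs => colour_forest cs t [::]).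

Lemma jm_sum_blocks n (lt : n.-tuple (X * nat)) t :
  jm_sum lt t = \sum_(c : {ffun 'I_n -> 'I_m})
    forest cl [seq [seq (tnth lt i).2 | i <- enum (block (fun i => (tnth lt i).1) c q)]
              | q <- enum {: X * 'I_m}] t [::].
Proof.
have main ls : jm_sum ls t = \sum_(c : {ffun 'I_(size ls) -> 'I_m})
    forest cl [seq [seq (tnth (in_tuple ls) i).2
                   | i <- enum (block (fun i => (tnth (in_tuple ls) i).1) c q)]
              | q <- enum {: X * 'I_m}] t [::].
  rewrite /jm_sum sum_col_ffun; apply: eq_bigr => c _; congr (forest _ _ _ _).
  apply: eq_map => q.
  have -> : zip ls [seq c i | i <- enum 'I_(size ls)] =
      [seq (tnth (in_tuple ls) i, c i) | i <- enum 'I_(size ls)].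
    by rewrite -zip_map map_tnth_enum.
  rewrite /colour_block filter_map -map_comp /block.
  have -> : enum [set i | ((tnth (in_tuple ls) i).1 == q.1) && (c i == q.2)] =
    [seq i <- enum 'I_(size ls) | ((tnth (in_tuple ls) i).1 == q.1) && (c i == q.2)].
    by rewrite enumT; apply: eq_filter => i; rewrite !inE.
  by congr map; apply: eq_filter => i /=; case: q.
have sz := size_tuple lt; move: lt sz => [ls hls] /= sz; subst n.
by rewrite main; have -> : in_tuple ls = Tuple hls by apply: val_inj.
Qed.

Lemma jm_sumE (D : diag false X) :
  cl (jm_diag K m D) = ((m`! ^ #|X|)%:R)^-1 *: jm_sum (leg (val D)) (tri (val D)).
Proof. by rewrite (jm_forest charK cl_rel) (jm_sum_blocks (in_tuple (leg (val D)))). Qed.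

Lemma good_colour_forest cs : good (unzip2 (unzip1 cs)) (colour_forest cs).
Proof.
apply: good_sub (good_forest cl_rel _) => a /flattenP[bl /mapP[q _ ->]].
rewrite /colour_block => /mapP[c]; rewrite mem_filter => /andP[_ ccs] ->.
by rewrite /unzip2 /unzip1 -map_comp; apply: (map_f (fun c => c.1.2)).
Qed.

Lemma jm_sum_perm ls t t' : perm_eq t t' -> jm_sum ls t = jm_sum ls t'.
Proof.
by move=> h; apply: eq_sum_col => cs _; apply: (g_t (good_colour_forest cs)).
Qed.

Lemma jm_sum_rot ls a b c t : jm_sum ls ((a, b, c) :: t) = jm_sum ls ((b, c, a) :: t).
Proof. by apply: eq_sum_col => cs _; apply: (g_rot (good_colour_forest cs)). Qed.

Lemma jm_sum_as ls a b c t : jm_sum ls ((a, b, c) :: t) = - jm_sum ls ((b, a, c) :: t).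
Proof.
rewrite /jm_sum -sum_colN.
by apply: eq_sum_col => cs _; apply: (g_as (good_colour_forest cs)).
Qed.

Lemma jm_sum_ihx ls a b c d e t :
  jm_sum ls [:: (a, b, e), (e, c, d) & t] + jm_sum ls [:: (b, c, e), (e, a, d) & t]
  + jm_sum ls [:: (c, a, e), (e, b, d) & t] = 0.
Proof.
rewrite /jm_sum -!sum_colD -[RHS](sum_col0 V m ls).
by apply: eq_sum_col => cs _; apply: (g_ihx (good_colour_forest cs)).
Qed.

Lemma sum_col_pair ls1 p p' ls2 (F : seq ((X * nat) * 'I_m) -> V) :
  sum_col (ls1 ++ p :: p' :: ls2) F =
  sum_col ls1 (fun s1 => \sum_(j < m) \sum_(j' < m)
     sum_col ls2 (fun s2 => F (s1 ++ (p, j) :: (p', j') :: s2))).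
Proof. by rewrite sum_col_cat. Qed.

(** Neighbours in different blocks are not compared in any block. *)
Lemma colour_forest_swap s1 p p' (j j' : 'I_m) s2 :
  (p.1, j) != (p'.1, j') ->
  colour_forest (s1 ++ (p, j) :: (p', j') :: s2) =
  colour_forest (s1 ++ (p', j') :: (p, j) :: s2).
Proof.
move=> ne; congr forest; apply: eq_map => q; rewrite /colour_block !filter_cat !map_cat.
congr (_ ++ _) => /=; case: eqP => [e|_]; case: eqP => [e'|_] //=.
by rewrite e e' eqxx in ne.
Qed.

Lemma jm_sum_swap ls1 p p' ls2 t : p.1 != p'.1 ->
  jm_sum (ls1 ++ p :: p' :: ls2) t = jm_sum (ls1 ++ p' :: p :: ls2) t.
Proof.
move=> ne; rewrite /jm_sum !sum_col_pair; apply: eq_sum_col => s1 _.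
rewrite exchange_big /=; apply: eq_bigr => j _; apply: eq_bigr => j' _.
apply: eq_sum_col => s2 _; rewrite colour_forest_swap //.
by apply: contra ne => /eqP[->].
Qed.

(** [jm_sum] respects STU: in the colourings that put the two legs into the same
    block this is the behaviour of [T_k], while the others cancel. *)
Lemma jm_sum_stu ls1 x a b s ls2 t :
  s \notin a :: b :: unzip2 (ls1 ++ ls2) ++ tri_ends t ->
  jm_sum (ls1 ++ (x, a) :: (x, b) :: ls2) t - jm_sum (ls1 ++ (x, b) :: (x, a) :: ls2) t =
  jm_sum (ls1 ++ (x, s) :: ls2) ((s, b, a) :: t).
Proof.
move=> sf; rewrite /jm_sum !sum_col_pair -sum_colB sum_col_cat.
apply: eq_sum_col => s1 e1 /=.
rewrite [X in _ - X]exchange_big -sumrB; apply: eq_bigr => j _.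
(* The terms with different colours cancel. *)
rewrite -sumrB (bigD1 j) //= [X in _ + X]big1 ?addr0 => [|j' jj']; last first.
  apply/eqP; rewrite subr_eq0; apply/eqP; apply: eq_sum_col => s2 _.
  by rewrite colour_forest_swap // xpair_eqE eqxx eq_sym.
rewrite -sum_colB; apply: eq_sum_col => s2 e2.
pose q0 := (x, j); pose r := rem q0 (enum {: X * 'I_m}).
have pq : perm_eq (enum {: X * 'I_m}) (q0 :: r) by apply: perm_to_rem; rewrite mem_enum.
have splitF cs : colour_forest cs =
    lmo_ins (colour_block q0 cs) (forest cl [seq colour_block q cs | q <- r]).
  rewrite /colour_forest -[RHS]/(forest cl [seq colour_block q cs | q <- q0 :: r]).
  by apply: (forest_perm cl_rel); apply: perm_map.
have restE cs : {subset cs <= [:: ((x, a), j); ((x, b), j); ((x, s), j)]} ->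
    [seq colour_block q (s1 ++ cs ++ s2) | q <- r] = [seq colour_block q (s1 ++ s2) | q <- r].
  move=> hcs; apply/eq_in_map => q qr; rewrite /colour_block !filter_cat.
  have /eq_in_filter -> : {in cs, (fun c => (c.1.1, c.2) == q) =1 pred0}.
    move=> c /hcs cin; have -> : (c.1.1, c.2) = q0.
      by move: cin; rewrite !inE => /or3P[] /eqP->.
    apply/negbTE; apply: contraTneq qr => <-; rewrite /r mem_rem_uniq ?enum_uniq //.
    by rewrite !inE eqxx.
  by rewrite filter_pred0.
have blockE cs : (forall c, c \in cs -> (c.1.1, c.2) = q0) ->
   colour_block q0 (s1 ++ cs ++ s2) =
   colour_block q0 s1 ++ map (fun c => c.1.2) cs ++ colour_block q0 s2.
  move=> h; rewrite /colour_block !filter_cat !map_cat; congr (_ ++ (_ ++ _)).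
  have /all_filterP-> // : all (fun c : (X * nat) * 'I_m => (c.1.1, c.2) == q0) cs.
  by apply/allP => c /h ->.
rewrite !splitF -[(_, j) :: _ :: s2]/([:: ((x, a), j); ((x, b), j)] ++ s2).
rewrite -[(_, j) :: _ :: s2]/([:: ((x, b), j); ((x, a), j)] ++ s2).
rewrite -[(_, j) :: s2]/([:: ((x, s), j)] ++ s2).
have pair_eq c (l l' : X * nat) : c \in [:: (l, j); (l', j)] -> c = (l, j) \/ c = (l', j).
  by rewrite !inE => /orP[] /eqP; [left|right].
have single_eq c (l : X * nat) : c \in [:: (l, j)] -> c = (l, j) by rewrite inE => /eqP.
rewrite !restE; try by move=> c /pair_eq[] ->; rewrite !inE eqxx ?orbT.
  2: by move=> c /single_eq ->; rewrite !inE eqxx ?orbT.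
rewrite !blockE; try by move=> c /pair_eq[] ->.
  2: by move=> c /single_eq ->.
rewrite /=; apply: (lmo_ins_swap charK (good_forest cl_rel _)).
have sub (s' : seq ((X * nat) * 'I_m)) q : {subset colour_block q s' <= unzip2 (unzip1 s')}.
  move=> c /mapP[d]; rewrite mem_filter => /andP[_ ds] ->.
  by rewrite /unzip2 /unzip1 -map_comp; apply: (map_f (fun c => c.1.2)).
have uz : unzip2 (ls1 ++ ls2) = unzip2 (unzip1 s1) ++ unzip2 (unzip1 s2).
  by rewrite -e1 -e2 /unzip2 map_cat.
apply: contra sf; rewrite uz /names cats0 !inE mem_cat => /orP[/flattenP[l /mapP[q _ ->]]|].
  rewrite /colour_block filter_cat map_cat mem_cat.
  by case/orP => /sub h; rewrite !mem_cat h ?orbT.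
rewrite mem_cat => /orP[|h]; last by rewrite mem_cat h !orbT.
rewrite mem_cat => /orP[/sub h|]; first by rewrite !mem_cat h ?orbT.
by rewrite !inE => /or3P[->|->|/sub h]; rewrite ?mem_cat ?h ?orbT //.
Qed.

(** * Renaming of the edges *)

Lemma ins_relabel E0 G G' (h : nat -> nat) E t ps : injective h ->
  good E0 G -> good (map h E0) G' ->
  (forall t ps, G' (map (map_tri h) t) (map (map_pair h) ps) = G t ps) ->
  ins (relabel h E) G' (map (map_tri h) t) (map (map_pair h) ps) = ins E G t ps :> V.
Proof.
move=> hI gG gG' e.
have [N hN] := belowP (avoid E0 E t ps).
have [inj fr] := fresh_addn E hN.
have eE : ends (relabel h E) = ends E.
  by rewrite /ends /= /unzip2 -map_comp.
rewrite (ins_below gG hN) (ins_any (rho := h \o addn N) gG'); last first.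
  rewrite /fresh eE; split=> [a b aE bE /hI|a aE /=]; first exact: inj.
  have -> : avoid (map h E0) (relabel h E) (map (map_tri h) t) (map (map_pair h) ps) =
      map h (avoid E0 E t ps).
    by rewrite /avoid names_map labs_relabel !map_cat.
  by rewrite mem_map //; exact: fr.
rewrite /attach -e !map_cat -!map_comp; congr (G' (_ ++ _) (_ ++ _)).
Qed.

Lemma lmo_ins_relabel E0 G G' (h : nat -> nat) l t ps : injective h ->
  good E0 G -> good (map h E0) G' ->
  (forall t ps, G' (map (map_tri h) t) (map (map_pair h) ps) = G t ps) ->
  lmo_ins (map h l) G' (map (map_tri h) t) (map (map_pair h) ps) = lmo_ins l G t ps :> V.
Proof.
move=> hI gG gG' e; rewrite /lmo_ins size_map; case: (size l) => [|[|n]] //.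
apply: eq_bigr => s _; rewrite -(ins_relabel (comb s l) t ps hI gG gG' e); congr (_ *: _).
have zipE (s' : seq nat) : [seq (h p.1, p.2) | p <- zip l s'] = zip (map h l) s'.
  by elim: (l) s' => [|x l' IH] [|y s'] //=; rewrite IH.
by rewrite /comb -zipE.
Qed.

Lemma forest_relabel (h : nat -> nat) bl t ps : injective h ->
  forest cl (map (map h) bl) (map (map_tri h) t) (map (map_pair h) ps) = forest cl bl t ps.
Proof.
move=> hI; elim: bl t ps => [|l bl IH] t ps /=; first exact: ev_ren.
apply: (lmo_ins_relabel (E0 := flatten bl)) => //; first exact: good_forest.
by rewrite map_flatten; exact: good_forest.
Qed.

Lemma sum_col_map (T T' : Type) (f : T -> T') (ls : seq T) (F : seq (T' * 'I_m) -> V) :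
  sum_col (map f ls) F = sum_col ls (fun us => F [seq (f c.1, c.2) | c <- us]).
Proof. by elim: ls F => //= l r IH F; apply: eq_bigr => j _; rewrite IH. Qed.

Lemma jm_sum_relabel (h : nat -> nat) ls t : injective h ->
  jm_sum [seq (l.1, h l.2) | l <- ls] (map (map_tri h) t) = jm_sum ls t.
Proof.
move=> hI; rewrite /jm_sum sum_col_map; apply: eq_sum_col => cs _.
rewrite /colour_forest -(@forest_relabel h _ t [::]) // -map_comp.
congr (forest _ _ _ _); apply: eq_map => q /=.
by rewrite /colour_block filter_map -!map_comp.
Qed.

End JM.

(** * The map j_m respects the relations of the source *)

Section JMRelations.
Variables (K : fieldType) (V : lmodType K).
Hypothesis charK : [pchar K] =i pred0.
Variable cl : {linear {malg K[diag true void]} -> V}.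
Hypothesis cl_rel : forall v, graph_rel v -> cl v = 0.
Variables (X : finType) (m : nat).
Implicit Types (t : seq (nat * nat * nat)) (ps : seq (nat * nat)).
Implicit Types (cs : seq ((X * nat) * 'I_m)) (ls : seq (X * nat)).

Local Notation jms := (@jm_sum K V cl X m).

Lemma first_leg x l w ls : [seq l <- ls | l.1 == x] = l :: w ->
  exists u v, [/\ ls = u ++ l :: v, all (fun p => p.1 != x) u, l.1 = x
                & w = [seq l <- v | l.1 == x]].
Proof.
elim: ls => //= p ls IH; case: eqP => [px [<- <-]|/eqP px /IH[u [v [-> hu lx ->]]]].
  by exists [::], ls.
by exists (p :: u), v; rewrite /= px hu.
Qed.

Lemma jm_sum_bubble p u l v t : all (fun q => q.1 != l.1) u ->
  jms (p ++ u ++ l :: v) t = jms (p ++ l :: u ++ v) t.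
Proof.
elim/last_ind: u v => //= u q IH v; rewrite all_rcons => /andP[ql hu].
rewrite cat_rcons catA (jm_sum_swap cl m _ _ _ ql) -catA IH //.
by rewrite cat_rcons.
Qed.

(** Lists with the same orders along all arrows are related by exchanges of
    neighbours on different arrows. *)
Lemma jm_sum_legs p ls ls' t :
  (forall x, [seq l <- ls | l.1 == x] = [seq l <- ls' | l.1 == x]) ->
  jms (p ++ ls) t = jms (p ++ ls') t.
Proof.
elim: ls p ls' => [|l ls IH] p ls' h.
  case: ls' h => // l' ls' /(_ l'.1) /=; by rewrite eqxx.
have := h l.1; rewrite /= eqxx => /esym/first_leg[u [v [e hu _ _]]].
rewrite e jm_sum_bubble // -!cat_rcons; apply: IH => x.
have := h x; rewrite e filter_cat /= filter_cat; case: eqP => [<-|_] //=.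
have -> : [seq q <- u | q.1 == l.1] = [::].
  by apply/eqP; rewrite -(negbK (_ == _)) -has_filter -all_predC.
by case.
Qed.

Lemma jm_relA v : relA v -> cl (linext (@jm_diag K X m) v) = 0.
Proof.
have J (D : diag false X) : cl (linext (@jm_diag K X m) << D >>) =
    ((m`! ^ #|X|)%:R)^-1 *: jms (leg (val D)) (tri (val D)).
  by rewrite linextU jm_sumE.
have JB u w : cl (linext (@jm_diag K X m) (u - w)) =
    cl (linext (@jm_diag K X m) u) - cl (linext (@jm_diag K X m) w).
  by rewrite 2!linearB.
have JD u w : cl (linext (@jm_diag K X m) (u + w)) =
    cl (linext (@jm_diag K X m) u) + cl (linext (@jm_diag K X m) w).
  by rewrite 2!linearD.
have J2 D D' : cl (linext (@jm_diag K X m) (<< D >> - << D' >>)) =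
    ((m`! ^ #|X|)%:R)^-1 *: (jms (leg (val D)) (tri (val D)) - jms (leg (val D')) (tri (val D'))).
  rewrite JB scalerBr; congr (_ - _); exact: J.
have J2' D D' : cl (linext (@jm_diag K X m) (<< D >> + << D' >>)) =
    ((m`! ^ #|X|)%:R)^-1 *: (jms (leg (val D)) (tri (val D)) + jms (leg (val D')) (tri (val D'))).
  rewrite JD scalerDr; congr (_ + _); exact: J.
case=> [{}v|D D' t ls ls' k eD eD' h|D1 D2 D3 x a b s t ls1 ls2 k e1 e2 e3].
- case=> [h D D' hI eD'|D D' t t' ls k eD eD' tt'|D D' a b c t ls k eD eD'
    |D D' a b c t ls k eD eD'|D1 D2 D3 a b c d e t ls k e1 e2 e3].
  + by apply: etrans (J2 _ _) _; rewrite eD' jm_sum_relabel // subrr scaler0.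
  + by apply: etrans (J2 _ _) _; rewrite eD eD' /= (jm_sum_perm cl_rel m _ tt') subrr scaler0.
  + by apply: etrans (J2 _ _) _; rewrite eD eD' /= jm_sum_rot // subrr scaler0.
  + by apply: etrans (J2' _ _) _; rewrite eD eD' /= jm_sum_as // addNr scaler0.
  + rewrite JD; apply: etrans (congr2 +%R (J2' _ _) (J _)) _.
    by rewrite -scalerDr e1 e2 e3 /= jm_sum_ihx // scaler0.
- apply: etrans (J2 _ _) _.
  by rewrite eD eD' /= (jm_sum_legs [::] t h) subrr scaler0.
- rewrite JB; apply: etrans (congr2 (fun u w => u - w) (J2 _ _) (J _)) _.
  rewrite -scalerBr e1 e2 e3 /= (@jm_sum_stu _ _ charK _ cl_rel X m ls1 x a b s) ?subrr ?scaler0 //.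
  have /andP[/wfP/(_ s)] := valP D3.
  have -> : ends (val D3) = [:: s, b, a & tri_ends t ++ unzip2 ls1 ++ s :: unzip2 ls2].
    by rewrite e3 /ends /unzip2 /= map_cat.
  move=> h _; apply/negP; rewrite /unzip2 map_cat -has_pred1 has_count.
  by move: h; rewrite !inE /= !count_cat /= eqxx /unzip2 => /orP[] /eqP; lia.
Qed.

(** * Degrees *)

Lemma ev_size d t : (forall D : diag true void, ~~ has_deg d (val D) -> cl << D >> = 0) ->
  forall ps, size t != d.*2 -> ev cl t ps = 0.
Proof.
move=> h ps st; rewrite /ev /value /gen; case: insubP => [D _ eD|_]; last exact: linear0.
by apply: h; rewrite /has_deg eD /= size_map addn0.
Qed.

Lemma lmo_ins_size E0 G c k l t ps : good E0 G ->
  (forall t ps, (size t + c != k)%N -> G t ps = 0 :> V) ->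
  (size t + (size l + c) != k.+2)%N -> lmo_ins l G t ps = 0.
Proof.
move=> gG h; rewrite /lmo_ins; case sl: (size l) => [|[|n]] // ne.
rewrite big1 // => s _.
have [N hN] := belowP (avoid E0 (comb s l) t ps).
rewrite (ins_below gG hN) /attach h ?scaler0 //.
have szc : size (tri (comb s l)) = n by rewrite /comb /= size_map size_enum_ord.
rewrite size_cat size_map szc; apply: contra ne => /eqP <-; lia.
Qed.

(** A block of size [k] removes [k] legs and adds [k - 2] vertices. *)
Lemma forest_size d bl t ps :
  (forall D : diag true void, ~~ has_deg d (val D) -> cl << D >> = 0) ->
  (size t + size (flatten bl) != d.*2 + (size bl).*2)%N -> forest cl bl t ps = 0.
Proof.
move=> h; elim: bl t ps => [|l bl IH] t ps /=; first by rewrite !addn0; exact: ev_size.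
rewrite size_cat doubleS !addnS => ne.
exact: (lmo_ins_size ps (good_forest cl_rel bl) IH ne).
Qed.

Lemma size_colour_blocks cs :
  size (flatten [seq colour_block q cs | q <- enum {: X * 'I_m}]) = size cs.
Proof.
rewrite size_flatten /shape sumnE 2!big_map big_enum /=.
elim: cs => [|c cs IH]; first by rewrite big1.
transitivity (size cs).+1 => //; rewrite -IH.
rewrite (bigD1 (c.1.1, c.2)) //= [in RHS](bigD1 (c.1.1, c.2)) //= /colour_block /= eqxx /= addSn.
congr (_ + _).+1; apply: eq_bigr => q; rewrite eq_sym => /negbTE -> //.
Qed.

Lemma jm_sum_size d ls t :
  (forall D : diag true void, ~~ has_deg d (val D) -> cl << D >> = 0) ->
  (size t + size ls != (d + m * #|X|).*2)%N -> jms ls t = 0.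
Proof.
move=> h ne; rewrite /jm_sum -[RHS](sum_col0 V m ls); apply: eq_sum_col => cs e.
apply: forest_size h _; rewrite size_colour_blocks size_map -cardE card_prod card_ord.
by move: ne; rewrite -e size_map -doubleD mulnC.
Qed.

Lemma jm_at_deg d v :
  (forall D : diag true void, ~~ has_deg d (val D) -> cl << D >> = 0) ->
  at_deg (@relA K X) (d + m * #|X|)%N v -> cl (linext (@jm_diag K X m) v) = 0.
Proof.
move=> h; case=> [{}v|D]; first exact: jm_relA.
move=> ne; rewrite linextU jm_sumE // (jm_sum_size h) ?scaler0 //.
Qed.

End JMRelations.

(** * Symmetrization over the orders of the legs *)

Definition permuted X n (lt : n.-tuple (X * nat)) (s : 'S_n) :=
  [seq tnth lt (s i) | i <- enum 'I_n].

Section LabelPerms.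
Variables (K : fieldType) (V : lmodType K) (X : eqType) (n : nat).
Implicit Types (lt : n.-tuple (X * nat)) (F : seq (X * nat) -> V).

Definition label_perms lt : {set 'S_n} :=
  [set s : 'S_n | [forall i, (tnth lt (s i)).1 == (tnth lt i).1]].

Definition symmetrized F lt : V :=
  (#|label_perms lt|%:R)^-1 *: \sum_(s in label_perms lt) F (permuted lt s).

Lemma label_permP lt (s : 'S_n) :
  reflect (forall i, (tnth lt (s i)).1 = (tnth lt i).1) (s \in label_perms lt).
Proof. by rewrite inE; apply: (iffP forallP) => h i; apply/eqP. Qed.

Lemma eq_symmetrized F F' lt : F =1 F' -> symmetrized F lt = symmetrized F' lt.
Proof. by move=> e; congr (_ *: _); apply: eq_bigr => s _. Qed.

Lemma symmetrizedD F F' lt :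
  symmetrized (fun ls => F ls + F' ls) lt = symmetrized F lt + symmetrized F' lt.
Proof. by rewrite /symmetrized big_split scalerDr. Qed.

Lemma symmetrized0 lt : symmetrized (fun=> 0) lt = 0.
Proof. by rewrite /symmetrized big1 // scaler0. Qed.

Lemma permuted_map (f : nat -> nat) lt (s : 'S_n) :
  permuted (map_tuple (fun l => (l.1, f l.2)) lt) s =
  [seq (l.1, f l.2) | l <- permuted lt s].
Proof. by rewrite /permuted -[RHS]map_comp; apply: eq_map => i; rewrite tnth_map. Qed.

Lemma symmetrized_map F (f : nat -> nat) lt :
  symmetrized F (map_tuple (fun l => (l.1, f l.2)) lt) =
  symmetrized (fun ls => F [seq (l.1, f l.2) | l <- ls]) lt.
Proof.
have eS : label_perms (map_tuple (fun l => (l.1, f l.2)) lt) = label_perms lt.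
  by apply/setP => s; rewrite !inE; apply: eq_forallb => i; rewrite !tnth_map.
by rewrite /symmetrized eS; congr (_ *: _); apply: eq_bigr => s _; rewrite permuted_map.
Qed.

Lemma enum_adjacent (i0 i1 : 'I_n) : i1 = i0.+1 :> nat ->
  exists e1 e2, enum 'I_n = e1 ++ i0 :: i1 :: e2.
Proof.
move=> e; exists (take i0 (enum 'I_n)), (drop i1.+1 (enum 'I_n)).
rewrite -[LHS](cat_take_drop i0); congr (_ ++ _).
rewrite (drop_nth i0) ?size_enum_ord // nth_ord_enum; congr (_ :: _).
by rewrite -e (drop_nth i0) ?size_enum_ord // nth_ord_enum.
Qed.

Lemma map_tperm (T : Type) (f : 'I_n -> T) (i0 i1 : 'I_n) : i1 = i0.+1 :> nat ->
  exists u v, map f (enum 'I_n) = u ++ f i0 :: f i1 :: v /\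
    map (f \o tperm i0 i1) (enum 'I_n) = u ++ f i1 :: f i0 :: v.
Proof.
case/enum_adjacent => e1 [e2 e]; have := enum_uniq 'I_n.
rewrite e -[_ ++ _]/(e1 ++ [:: i0; i1] ++ e2) uniq_catCA /= inE negb_or mem_cat negb_or.
rewrite mem_cat negb_or -!andbA => /and5P[_ n01 n02 n11 /andP[n12 _]].
have same (r : seq 'I_n) : i0 \notin r -> i1 \notin r -> map (f \o tperm i0 i1) r = map f r.
  move=> h0 h1; apply/eq_in_map => i ir /=.
  by rewrite tpermD //; apply: contraTneq ir => <-.
exists (map f e1), (map f e2); rewrite !map_cat /= tpermL tpermR.
by rewrite !same.
Qed.

(** Exchanging two neighbouring legs of [lt] exchanges two neighbouring legs of its
    rearrangements if the labels differ, and rearranges the rearrangements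
    otherwise. *)
Lemma symmetrized_tperm F lt lt' (i0 i1 : 'I_n) : i1 = i0.+1 :> nat ->
  (forall i, tnth lt' i = tnth lt (tperm i0 i1 i)) ->
  (forall u p q v, p.1 != q.1 -> F (u ++ p :: q :: v) = F (u ++ q :: p :: v)) ->
  symmetrized F lt' = symmetrized F lt.
Proof.
move=> e10 e hF; set tau := tperm i0 i1 in e.
have tauK : (tau * tau = 1)%g by rewrite tperm2.
have cl s : ((s ^ tau)%g \in label_perms lt') = (s \in label_perms lt).
  apply/label_permP/label_permP => h i; last first.
    by rewrite !e /conjg !permM tpermV !tpermK h.
  have := h (tau i); rewrite !e /conjg !permM tpermV !tpermK //.
have clI : injective (fun s : 'S_n => (s ^ tau)%g) by exact: conjg_inj.
have eS : #|label_perms lt'| = #|label_perms lt|.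
  rewrite -(card_imset (mem (label_perms lt)) clI); apply: eq_card => s.
  apply/idP/imsetP => [h|[s' h ->]]; last by rewrite cl.
  by exists (s ^ tau^-1)%g; rewrite ?conjgKV // -cl conjgKV.
rewrite /symmetrized eS; congr (_ *: _).
rewrite (reindex_inj clI) /= (eq_bigl _ _ cl).
have pE s : permuted lt' (s ^ tau)%g = map ((fun i => tnth lt (s i)) \o tau) (enum 'I_n).
  by apply: eq_map => i; rewrite e /conjg !permM tpermV tpermK.
have [lab|lab] := eqVneq (tnth lt i0).1 (tnth lt i1).1; last first.
  apply: eq_bigr => s /label_permP h; rewrite pE.
  have [u [v [e1 e2]]] := map_tperm (fun i => tnth lt (s i)) e10.
  by rewrite e2 /permuted e1 hF // !h eq_sym.
have labt i : (tnth lt (tau i)).1 = (tnth lt i).1.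
  by rewrite /tau; case: tpermP => [->|->|].
rewrite [RHS](reindex_inj (mulgI tau)) /=; apply: eq_big => [s|s _].
  apply/label_permP/label_permP => h i; first by rewrite permM h labt.
  by have := h (tau i); rewrite permM tpermK labt.
by rewrite pE; congr F; apply: eq_map => i /=; rewrite permM.
Qed.

End LabelPerms.

(** The length of the tuple is part of the type of the permutations, so this is
    not just a rewriting. *)
Lemma symmetrized_cast (K : fieldType) (V : lmodType K) (X : eqType) n n'
    (F : seq (X * nat) -> V) (lt : n.-tuple (X * nat)) (lt' : n'.-tuple (X * nat)) :
  lt = lt' :> seq _ -> symmetrized F lt = symmetrized F lt'.
Proof.
move=> e; have en : n = n' by rewrite -(size_tuple lt) -(size_tuple lt') e.
by subst n'; congr symmetrized; apply: val_inj.
Qed.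

Lemma symmetrized_perm (K : fieldType) (V : lmodType K) (X : eqType)
    (F : seq (X * nat) -> V) ls ls' :
  (forall u p q v, p.1 != q.1 -> F (u ++ p :: q :: v) = F (u ++ q :: p :: v)) ->
  perm_eq ls ls' -> symmetrized F (in_tuple ls) = symmetrized F (in_tuple ls').
Proof.
move=> hF; apply: (perm_adjacent_ind (R := fun ls ls' => symmetrized F (in_tuple ls)
   = symmetrized F (in_tuple ls'))) => [//|l1 l2 l3 -> //|u a b v].
pose n := size (u ++ a :: b :: v).
have sz : size (u ++ b :: a :: v) == n by rewrite /n !size_cat.
have hn : n = (size u + (size v).+2)%N by rewrite /n size_cat.
have h0 : (size u < n)%N by lia.
have h1 : ((size u).+1 < n)%N by lia.
rewrite (symmetrized_cast F (lt := in_tuple (u ++ b :: a :: v)) (lt' := Tuple sz)) //.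
apply/esym; apply: (@symmetrized_tperm _ _ _ _ _ _ _ (Ordinal h0) (Ordinal h1)) => // i.
rewrite !(tnth_nth a) /= !nth_cat.
case: tpermP => [->|->|/eqP n0 /eqP n1] /=.
- by rewrite !ltnn subnn ltnNge leqnSn /= subSnn.
- by rewrite !ltnn subnn ltnNge leqnSn /= subSnn.
move: n0 n1; rewrite -!val_eqE /= => n0 n1; case: ltnP => // hi.
case ek: (i - size u)%N => [|[|k]] //.
all: by exfalso; move: n0 n1 hi ek; move: (size u) (nat_of_ord i) => k j; lia.
Qed.

(** * The map chi *)

Section Chi.
Variables (K : fieldType) (V : lmodType K) (X : finType).
Variable cl : {linear {malg K[diag false X]} -> V}.
Hypothesis cl_rel : forall v, relA v -> cl v = 0.
Implicit Types (t : seq (nat * nat * nat)) (ls : seq (X * nat)).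

Lemma arrow_swap t u p q v : p.1 != q.1 ->
  value cl t (u ++ p :: q :: v) 0 = value cl t (u ++ q :: p :: v) 0.
Proof.
move=> ne; apply: value_eq => [|D D' e e'].
  by apply: diag_ok_perm => //; rewrite perm_cat2l -(cat1s p) -(cat1s q) perm_catCA.
apply: cl_rel; apply: A_legs e e' _ => x; rewrite !filter_cat /=.
by case: eqP => // <-; case: eqP => // h; rewrite h eqxx in ne.
Qed.

Lemma arrow_stu t u x a b s v : s \notin ends (Graph t (u ++ [:: (x, a), (x, b) & v]) 0) ->
  value cl t (u ++ [:: (x, a), (x, b) & v]) 0 - value cl t (u ++ [:: (x, b), (x, a) & v]) 0 =
  value cl ((s, b, a) :: t) (u ++ (x, s) :: v) 0.
Proof.
move=> sf.
have ok2 : diag_ok false (Graph t (u ++ [:: (x, b), (x, a) & v]) 0) =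
    diag_ok false (Graph t (u ++ [:: (x, a), (x, b) & v]) 0).
  by apply: diag_ok_perm => //; rewrite perm_cat2l -(cat1s (x, a)) -(cat1s (x, b)) perm_catCA.
have ok3 : diag_ok false (Graph ((s, b, a) :: t) (u ++ (x, s) :: v) 0) =
    diag_ok false (Graph t (u ++ [:: (x, a), (x, b) & v]) 0).
  rewrite /diag_ok /= !andbT.
  have cnt y : count_mem y (ends (Graph ((s, b, a) :: t) (u ++ (x, s) :: v) 0)) =
     ((s == y).*2 + count_mem y (ends (Graph t (u ++ [:: (x, a), (x, b) & v]) 0)))%N.
    rewrite /ends /= /unzip2 !map_cat !count_cat /= -/(tri_ends t); lia.
  apply/wfP/wfP => h y; have := h y; rewrite cnt.
    by case: eqP => [<-|_]; rewrite ?add0n // (count_memPn sf).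
  by case: eqP => [<-|_]; rewrite ?add0n // (count_memPn sf).
case: (value_okP false t (u ++ [:: (x, a), (x, b) & v]) 0) => [[D1 e1]|n]; last first.
  by rewrite !value_nok ?ok2 ?ok3 // subrr.
case: (value_okP false t (u ++ [:: (x, b), (x, a) & v]) 0) => [[D2 e2]|n]; last first.
  by rewrite !value_nok ?ok3 -?ok2 // subrr.
case: (value_okP false ((s, b, a) :: t) (u ++ (x, s) :: v) 0) => [[D3 e3]|n]; last first.
  by rewrite !value_nok ?ok2 -?ok3 // subrr.
rewrite (value_ok cl e1) (value_ok cl e2) (value_ok cl e3).
apply/eqP; rewrite -subr_eq0 -!linearB /=; apply/eqP; apply: cl_rel.
exact: (STU K e1 e2 e3).
Qed.

Lemma chi_value (D : diag false X) :
  cl (chi_diag K D) =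
  symmetrized (fun ls => value cl (tri (val D)) ls 0) (in_tuple (leg (val D))).
Proof.
rewrite /chi_diag linearZ linear_sum; congr (_ *: _); apply: eq_bigr => s _.
by rewrite /value /permute_legs (circ0 D).
Qed.

Lemma chi_relB v : relB v -> cl (linext (@chi_diag K X) v) = 0.
Proof.
have cl_gr u : graph_rel u -> cl u = 0 by move=> h; apply/cl_rel/A_graph.
have J (D : diag false X) : cl (linext (@chi_diag K X) << D >>) =
    symmetrized (fun ls => value cl (tri (val D)) ls 0) (in_tuple (leg (val D))).
  by rewrite linextU chi_value.
have JB (D D' : diag false X) : cl (linext (@chi_diag K X) (<< D >> - << D' >>)) =
    symmetrized (fun ls => value cl (tri (val D)) ls 0) (in_tuple (leg (val D))) -
    symmetrized (fun ls => value cl (tri (val D')) ls 0) (in_tuple (leg (val D'))).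
  by rewrite 2!linearB; congr (_ - _); exact: J.
have JD u (D' : diag false X) : cl (linext (@chi_diag K X) (u + << D' >>)) =
    cl (linext (@chi_diag K X) u) +
    symmetrized (fun ls => value cl (tri (val D')) ls 0) (in_tuple (leg (val D'))).
  by rewrite 2!linearD; congr (_ + _); exact: J.
case=> [{}v|D D' t ls ls' k eD eD' h]; last first.
  apply: etrans (JB _ _) _; rewrite eD eD' /= (symmetrized_perm _ h) ?subrr // => u p q w.
  exact: arrow_swap.
case=> [h D D' hI eD'|D D' t t' ls k eD eD' tt'|D D' a b c t ls k eD eD'
    |D D' a b c t ls k eD eD'|D1 D2 D3 a b c d e t ls k e1 e2 e3].
- apply: etrans (JB _ _) _; rewrite eD' /=.
  have eT : in_tuple [seq (l.1, h l.2) | l <- leg (val D)] =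
    map_tuple (fun l => (l.1, h l.2)) (in_tuple (leg (val D))) :> seq _ by [].
  rewrite (symmetrized_cast _ eT).
  rewrite symmetrized_map; apply/eqP; rewrite subr_eq0; apply/eqP; apply: eq_symmetrized => ls.
  by rewrite (value_ren cl_gr) // => a b _ _; exact: hI.
- apply: etrans (JB _ _) _; rewrite eD eD' /=; apply/eqP; rewrite subr_eq0; apply/eqP.
  by apply: eq_symmetrized => us; apply: (value_perm cl_gr).
- apply: etrans (JB _ _) _; rewrite eD eD' /=; apply/eqP; rewrite subr_eq0; apply/eqP.
  by apply: eq_symmetrized => us; apply: (value_rot cl_gr).
- apply: etrans (JD _ _) _; apply: etrans (congr1 (fun z => z + _) (J _)) _.
  rewrite eD eD' /= -symmetrizedD -[RHS](symmetrized0 _ (in_tuple ls)).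
  by apply: eq_symmetrized => us; rewrite (value_as cl_gr) addNr.
- apply: etrans (JD _ _) _; apply: etrans (congr1 (fun z => z + _) (JD _ _)) _.
  apply: etrans (congr1 (fun z => z + _ + _) (J _)) _.
  rewrite e1 e2 e3 /= -!symmetrizedD -[RHS](symmetrized0 _ (in_tuple ls)).
  by apply: eq_symmetrized => us; apply: (value_ihx cl_gr).
Qed.

Lemma chi_at_deg d v : (forall D : diag false X, ~~ has_deg d (val D) -> cl << D >> = 0) ->
  at_deg (@relB K X) d v -> cl (linext (@chi_diag K X) v) = 0.
Proof.
move=> h; case=> [{}v|D nd]; first exact: chi_relB.
rewrite linextU chi_value -[RHS](symmetrized0 _ (in_tuple (leg (val D)))).
rewrite /symmetrized; congr (_ *: _); apply: eq_bigr => s _.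
case: (value_okP false (tri (val D)) (permuted (in_tuple (leg (val D))) s) 0) => [[D' e]|n].
  rewrite (value_ok cl e) h //; move: nd; rewrite /has_deg e /=.
  by rewrite /permuted size_map size_enum_ord.
by rewrite value_nok.
Qed.

(** Up to diagrams with fewer legs a diagram does not depend on the order of its
    legs at all, by STU, and thus equals its own symmetrization. *)
Lemma chi_onto : [pchar K] =i pred0 ->
  (forall w, cl (linext (@chi_diag K X) w) = 0) -> forall D, cl << D >> = 0.
Proof.
move=> charK h.
suff H n t ls : (size ls < n)%N -> value cl t ls 0 = 0.
  move=> D; rewrite -(value_ok (t := tri (val D)) (ls := leg (val D)) (k := 0) cl (D := D)).
    exact: (H _ _ _ (ltnSn _)).
  by case: (val D) (circ0 D) => ? ? ? /= ->.
elim: n t ls => // n IH t ls; rewrite ltnS => sz.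
case: (value_okP false t ls 0) => [[D e]|nok]; last by rewrite value_nok.
have ind ls1 ls2 : perm_eq ls1 ls2 ->
    (size ls1 <= n)%N -> value cl t ls1 0 = value cl t ls2 0 /\ size ls1 = size ls2.
  apply: (perm_adjacent_ind (R := fun ls1 ls2 => (size ls1 <= n)%N ->
    value cl t ls1 0 = value cl t ls2 0 /\ size ls1 = size ls2)) => [//|l1 l2 l3 h1 h2 s1|u p q v sl].
    by case: (h1 s1) => -> e12; rewrite e12 in s1 *; exact: h2.
  split; last by rewrite !size_cat.
  have [pq|] := eqVneq p.1 q.1; last exact: arrow_swap.
  have [N hN] := belowP (ends (Graph t (u ++ p :: q :: v) 0)).
  apply/eqP; rewrite -subr_eq0; apply/eqP.
  case: p q pq sl hN => [x a] [_ b] /= <- sl hN.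
  rewrite (@arrow_stu _ _ _ _ _ N); last by apply/negP => /(allP hN); rewrite ltnn.
  by apply: IH; move: sl; rewrite !size_cat /= !addnS.
have := h << D >>; rewrite linextU chi_value e /= => <-.
have pe s : value cl t (permuted (in_tuple ls) s) 0 = value cl t ls 0.
  apply/esym; case: (ind ls (permuted (in_tuple ls) s) _ sz) => //.
  rewrite -[X in perm_eq X _](map_tnth_enum (in_tuple ls)) /permuted perm_sym.
  rewrite (map_comp (tnth (in_tuple ls)) s); apply: perm_map; exact: perm_enum_perm.
rewrite /symmetrized (eq_bigr _ (fun s _ => pe s)) sumr_const -scaler_nat scalerA mulVf ?scale1r //.
apply: natr_neq0 => //; rewrite lt0n cards_eq0; apply/set0Pn; exists 1%g.
by apply/label_permP => i; rewrite perm1.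
Qed.

End Chi.

(** * Surjectivity of chi on the completions *)

Section Completion.
Variables (K : fieldType) (X : finType).
Hypothesis charK : [pchar K] =i pred0.

Lemma span_at_deg (o : bool) (Y : choiceType) (R : {malg K[diag o Y]} -> Prop) d
    (D : diag o Y) : ~~ has_deg d (val D) -> cls (at_deg R d) << D >> = 0.
Proof. by move=> h; apply/cls_eq0/Deg_other. Qed.

Lemma chi_span d v : span (at_deg (@relB K X) d) v ->
  span (at_deg (@relA K X) d) (linext (@chi_diag K X) v).
Proof.
move=> h; rewrite -[linext _ v]subr0; apply/cls_eq; rewrite linear0.
apply: (span_kernel (f := cls _ \o linext (@chi_diag K X)) _ h) => u Ru /=.
apply: chi_at_deg Ru => [w Rw|D]; last exact: span_at_deg.
exact/cls_eq0/Deg_rel.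
Qed.

(** [chi_onto] for the quotient by the relations together with the image of chi,
    which is therefore zero. *)
Lemma chi_lift d v : exists w, span (at_deg (@relA K X) d) (v - linext (@chi_diag K X) w).
Proof.
pose R u := at_deg (@relA K X) d u \/ exists w, u = linext (@chi_diag K X) w.
have R0 u : cls R u = 0.
  rewrite linear_linext /linext big1 // => D _.
  rewrite (chi_onto (cl := cls R)) ?scaler0 // => w.
    by move=> h; apply: cls_eq0; left; apply: Deg_rel.
  by apply: cls_eq0; right; exists w.
have : span R v by rewrite -[v]subr0; apply/cls_eq; rewrite !R0.
elim=> [|c u {}v Ru _ [w hw]]; first by exists 0; rewrite linear0 subr0; exact: span0.
case: Ru => [Ru|[w' ->]]; first by exists w; rewrite -addrA; apply: span_add.
by exists (c *: w' + w); rewrite linearP opprD addrACA subrr add0r.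
Qed.

Lemma chi_surjective (D : spaceA K X) : exists G, chi G = D.
Proof.
have [w hw] := boolp.choice (fun d => chi_lift d (repr (D d))).
exists (fun d => cls (at_deg (@relB K X) d) (w d)).
apply: functional_extensionality_dep => d; rewrite /chi /induced.
move: (d + 0)%N (addn0 d) => d' ->.
rewrite -[RHS](cls_repr (D d)); apply/cls_eq.
set u := repr (cls _ _).
have hu : span (at_deg (@relB K X) d) (u - w d) by apply/cls_eq; rewrite cls_repr.
have := chi_span hu; rewrite linearB => h1.
have : cls (at_deg (@relA K X) d) (linext (@chi_diag K X) u) = cls (at_deg (@relA K X) d) (repr (D d)).
  transitivity (cls (at_deg (@relA K X) d) (linext (@chi_diag K X) (w d))).
    exact/cls_eq.
  exact/esym/cls_eq/hw.
by move/cls_eq.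
Qed.

(** As chi is onto, the choice in the definition of [sigma] succeeds. *)
Lemma sigmaK (D : spaceA K X) : chi (sigma D) = D.
Proof.
have [G hG] := chi_surjective D.
exact: (xgetPex (fun=> 0) (P := fun G => chi G = D) (ex_intro _ G hG)).
Qed.

End Completion.

(** * The map j_m on symmetrized diagrams *)

Section Symmetrization.
Variables (K : fieldType) (V : lmodType K).
Hypothesis charK : [pchar K] =i pred0.
Variable cl : {linear {malg K[diag true void]} -> V}.
Hypothesis cl_rel : forall v, graph_rel v -> cl v = 0.
Variables (X : finType) (m n : nat) (lab : 'I_n -> X) (t : seq (nat * nat * nat)).
Implicit Types (c : {ffun 'I_n -> 'I_m}) (f : 'I_n -> nat).

Definition block_forest f c : V :=
  forest cl [seq map f (enum (block lab c q)) | q <- enum {: X * 'I_m}] t [::].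

Definition pairs_only c : bool := [forall q, #|block lab c q| == 2].

Lemma self_opp0 (x : V) : x = - x -> x = 0.
Proof.
move=> e; have : (2%:R : K) *: x = 0 by rewrite scaler_nat mulr2n {1}e addNr.
by move/eqP; rewrite scaler_eq0 (negbTE (natr_neq0 charK _)) // => /eqP.
Qed.

Lemma spine_tperm f i0 i1 r z (bl : seq (seq 'I_n)) (g := f \o tperm i0 i1) :
  uniq (i0 :: i1 :: rcons r z) ->
  {in bl, forall B, (i0 \notin B) && (i1 \notin B)} ->
  spine (g i0) (map g (i1 :: r)) (g z) (forest cl (map (map g) bl)) t [::] =
  - spine (f i0) (map f (i1 :: r)) (f z) (forest cl (map (map f) bl)) t [::].
Proof.
move=> u hbl.
have same (l : seq 'I_n) : i0 \notin l -> i1 \notin l -> map g l = map f l.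
  move=> h0 h1; apply/eq_in_map => i il; rewrite /g /= tpermD //.
    by apply: contraNneq h0 => ->.
  by apply: contraNneq h1 => ->.
have -> : map (map g) bl = map (map f) bl.
  by apply/eq_in_map => B /hbl/andP[h0 h1]; exact: same.
move: u; rewrite /= !inE !mem_rcons !inE rcons_uniq !negb_or.
move=> /andP[/andP[n01 /andP[n0z n0r]] /andP[/andP[n1z n1r] _]].
rewrite (spine_antisym (good_forest cl_rel _)) same // /g /= tpermL tpermR.
by rewrite tpermD // eq_sym.
Qed.

Definition label_stab : {set 'S_n} := [set s : 'S_n | [forall i, lab (s i) == lab i]].

Lemma label_stabP (s : 'S_n) : reflect (forall i, lab (s i) = lab i) (s \in label_stab).
Proof. by rewrite inE; apply: (iffP forallP) => h i; apply/eqP. Qed.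

(** Each comb in [T_k], [k > 2], changes sign when its first leaf is exchanged
    with the one next to it. These two legs have the same label, so that the sum
    over all orders is its own negative. *)
Lemma sum_block_forest0 f c q0 : (2 < #|block lab c q0|)%N ->
  \sum_(s in label_stab) block_forest (f \o s) c = 0.
Proof.
rewrite cardE; case eB: (enum (block lab c q0)) => [//|i0 l].
case: (lastP l) eB => [//|bs z] eB; rewrite /= size_rcons !ltnS => sb.
pose r := rem q0 (enum {: X * 'I_m}).
have pq : perm_eq (enum {: X * 'I_m}) (q0 :: r) by apply: perm_to_rem; rewrite mem_enum.
pose bl := [seq enum (block lab c q) | q <- r].
have uB : uniq (i0 :: rcons bs z) by rewrite -eB enum_uniq.
have inB i : i \in i0 :: rcons bs z -> lab i = q0.1 /\ c i = q0.2.
  by rewrite -eB mem_enum inE => /andP[/eqP-> /eqP->].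
have hbl i : i \in i0 :: rcons bs z -> {in bl, forall B, i \notin B}.
  move=> /inB[h1 h2] B /mapP[q qr ->]; rewrite mem_enum inE h1 h2.
  apply: contraTN qr => /andP[/eqP e1 /eqP e2].
  by rewrite /r mem_rem_uniq ?enum_uniq // !inE [q]surjective_pairing -e1 -e2 -surjective_pairing eqxx.
have expand g : block_forest g c = \sum_(w <- words (size bs)) coef K (size bs).+1 (des w) *:
    spine (g i0) (map g (map (nth i0 bs) w)) (g z) (forest cl (map (map g) bl)) t [::].
  rewrite /block_forest (forest_perm cl_rel (bl' := map g (enum (block lab c q0)) :: map (map g) bl)).
    rewrite eB /= map_rcons -/(enclose _ _ _) (lmo_ins_words (good_forest cl_rel _) _ _ _ _ (size_map _ _)).
    apply: eq_big_seq => w wW.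
    have -> // : map (nth 0%N (map g bs)) w = map g (map (nth i0 bs) w).
    rewrite -map_comp; apply/eq_in_map => i; rewrite (words_mem _ wW) => ib.
    by rewrite /= (nth_map i0).
  have -> : map (map g) bl = [seq map g (enum (block lab c q)) | q <- r].
    by rewrite /bl -[LHS]map_comp.
  exact: (perm_map (fun q => map g (enum (block lab c q))) pq).
under eq_bigr => s _ do rewrite expand.
rewrite exchange_big /= big_seq big1 // => w wW.
rewrite -scaler_sumr; apply/eqP; rewrite scaler_eq0; apply/orP; right; apply/eqP.
case: w wW => [|h w] wW; first by have := words_size wW; move: sb => /[swap] <-.
apply: self_opp0; rewrite -sumrN.
have hb : (h < size bs)%N by rewrite -(words_mem _ wW) mem_head.
have pw : perm_eq (map (nth i0 bs) (h :: w)) bs.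
  rewrite -[X in perm_eq _ X](mkseq_nth i0) /mkseq; apply: perm_map.
  by rewrite -mem_words.
set i1 := nth i0 bs h.
have i1B : i1 \in i0 :: rcons bs z by rewrite inE mem_rcons inE mem_nth ?orbT.
have uR : uniq (i0 :: i1 :: rcons (map (nth i0 bs) w) z).
  have -> : i0 :: i1 :: rcons (map (nth i0 bs) w) z = i0 :: rcons (map (nth i0 bs) (h :: w)) z by [].
  rewrite (perm_uniq (s2 := i0 :: rcons bs z)) // perm_cons perm_rcons.
  by rewrite perm_sym perm_rcons perm_cons perm_sym.
pose tau := tperm i0 i1.
rewrite [LHS](reindex_inj (mulgI tau)) /=; apply: eq_big => [s|s _].
  have lt i : lab (tau i) = lab i.
    rewrite /tau; case: tpermP => [->|->|] //.
      by case: (inB i1 i1B) (inB i0 (mem_head _ _)) => -> _ [->].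
    by case: (inB i1 i1B) (inB i0 (mem_head _ _)) => -> _ [->].
  apply/label_stabP/label_stabP => hs i; last by rewrite permM hs lt.
  by have := hs (tau i); rewrite permM tpermK lt.
have e : (f \o (tau * s)%g) = (f \o s) \o tau.
  by apply/funext => i; rewrite /= permM.
have := @spine_tperm (f \o s) i0 i1 (map (nth i0 bs) w) z bl uR; rewrite -e; apply=> B hB; rewrite (hbl i0) ?mem_head //; exact: hbl hB.
Qed.

Lemma lmo_ins2_sym E0 G a b : good E0 G -> lmo_ins [:: a; b] G = lmo_ins [:: b; a] G :> (_ -> _ -> V).
Proof.
move=> gG; rewrite !lmo_ins2; apply/funext => t'; apply/funext => ps.
by rewrite (spine_rev gG) /= expr0 scale1r.
Qed.

Lemma lmo_ins2_perm E0 G l l' : good E0 G -> size l = 2 -> perm_eq l l' ->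
  lmo_ins l G = lmo_ins l' G :> (_ -> _ -> V).
Proof.
move=> gG; case: l => [|a [|b [|? ?]]] // _.
case: l' => [|a' [|b' [|? ?]]] /[dup] /perm_size //= _ /[dup] /perm_mem/(_ a).
rewrite !inE eqxx /= => /esym/orP[] /eqP <- h.
  by have [->] : [:: b] = [:: b'] by apply: perm_small_eq; rewrite // -(perm_cons a).
have : perm_eq [:: a; b] [:: a; a'].
  by apply: perm_trans h _; exact: (permEl (perm_catC [:: a'] [:: a])).
rewrite perm_cons => h'; have [->] : [:: b] = [:: a'] by exact: perm_small_eq.
exact: lmo_ins2_sym gG.
Qed.

Lemma forest_pairs (Q : Type) (r : seq Q) (F F' : Q -> seq nat) :
  (forall q, size (F q) = 2) -> (forall q, perm_eq (F q) (F' q)) ->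
  forest cl (map F r) = forest cl (map F' r).
Proof.
move=> h2 hp; elim: r => //= q r IH.
by rewrite -/(forest cl _) (lmo_ins2_perm (good_forest cl_rel _) (h2 q) (hp q)) IH.
Qed.

(** Blocks of size less than two do not contribute since [T_0 = T_1 = 0], those of
    size greater than two by [sum_block_forest0]. The strut [T_2] is symmetric, so
    that for blocks of size two a reordering of the legs amounts to a change of
    the colouring. *)
Lemma sum_block_forest f :
  \sum_(s in label_stab) \sum_c block_forest (f \o s) c =
  #|label_stab|%:R *: \sum_(c | pairs_only c) block_forest f c.
Proof.
have e1 s : s \in label_stab -> \sum_(c | pairs_only c) block_forest (f \o s) c =
    \sum_(c | pairs_only c) block_forest f c.
  move=> sS; pose h c : {ffun 'I_n -> 'I_m} := [ffun i => c (s i)].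
  have hI : injective h.
    move=> c c' /ffunP e; apply/ffunP => i; have := e ((s^-1)%g i).
    by rewrite !ffunE permKV.
  have bh c q : block lab (h c) q = s @^-1: block lab c q.
    by apply/setP => i; rewrite !inE ffunE (label_stabP _ sS).
  rewrite (reindex_inj hI) /=.
  have ph c : pairs_only (h c) = pairs_only c.
    by apply: eq_forallb => q; rewrite bh card_preimset //; exact: perm_inj.
  rewrite (eq_bigl _ _ ph); apply: eq_bigr => c /forallP tc.
  rewrite /block_forest; congr (_ t [::]); apply: forest_pairs => q.
    by rewrite size_map -cardE bh card_preimset ?(eqP (tc q)) //; exact: perm_inj.
  rewrite map_comp; apply: perm_map; apply: uniq_perm; rewrite ?enum_uniq //.
    by rewrite map_inj_uniq ?enum_uniq //; exact: perm_inj.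
  move=> i; rewrite mem_enum bh; apply/mapP/idP => [[j]|iB].
    by rewrite mem_enum inE => jB ->.
  by exists ((s^-1)%g i); rewrite ?permKV // mem_enum inE permKV.
rewrite exchange_big /= (bigID pairs_only) /= [X in _ + X]big1 ?addr0.
  rewrite exchange_big /= (eq_bigr _ e1) sumr_const scaler_nat //.
move=> c /forallPn[q nq]; have [big|] := ltnP 2 #|block lab c q|.
  exact: sum_block_forest0 big.
rewrite leq_eqVlt (negbTE nq) /= => small; rewrite big1 // => s _.
rewrite /block_forest (@forest_small _ _ _ _ (map (f \o s) (enum (block lab c q)))) //.
  by apply/mapP; exists q; rewrite ?mem_enum.
by rewrite size_map -cardE.
Qed.

End Symmetrization.

Section JMChi.
Variables (K : fieldType) (V : lmodType K).
Hypothesis charK : [pchar K] =i pred0.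
Variable cl : {linear {malg K[diag true void]} -> V}.
Hypothesis cl_rel : forall v, graph_rel v -> cl v = 0.
Variables (X : finType) (m : nat).

Lemma jm_chi (D : diag false X) :
  cl (linext (@jm_diag K X m) (chi_diag K D)) =
  ((m`! ^ #|X|)%:R)^-1 *: \sum_(c | pairs_only (@leg_label X (val D)) c)
     block_forest cl (@leg_label X (val D)) (tri (val D)) (@leg_edge X (val D)) (c : {ffun _ -> 'I_m}).
Proof.
set lab := @leg_label X _; set e := @leg_edge X _; set t := tri _.
set n := size (leg (val D)) in lab e *.
have J s : s \in label_stab lab ->
    cl (linext (@jm_diag K X m) (gen K false (permute_legs s))) =
    ((m`! ^ #|X|)%:R)^-1 *: \sum_(c : {ffun 'I_n -> 'I_m}) block_forest cl lab t (e \o s) c.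
  move=> /label_stabP sS; rewrite /gen.
  case: insubP => [D' _ eD'|]; last by rewrite diag_ok_permute_legs ?(valP D).
  rewrite linextU (jm_sumE charK cl_rel) eD' /=; congr (_ *: _).
  pose lt := [tuple tnth (in_tuple (leg (val D))) (s i) | i < n].
  apply: etrans (jm_sum_blocks cl m lt t) _; apply: eq_bigr => c _.
  rewrite /block_forest; congr (forest _ _ _ _); apply: eq_map => q.
  have -> : block (fun i => (tnth lt i).1) c q = block lab c q.
    by apply/setP => i; rewrite !inE tnth_mktuple -[(tnth _ _).1]/(lab (s i)) sS.
  by apply: eq_map => i /=; rewrite tnth_mktuple.
have -> : cl (linext (@jm_diag K X m) (chi_diag K D)) = (#|label_stab lab|%:R)^-1 *:
    \sum_(s in label_stab lab) cl (linext (@jm_diag K X m) (gen K false (permute_legs s))).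
  rewrite /chi_diag.
  rewrite linearZ.
  rewrite linearZ.
  rewrite -/(label_stab lab).
  apply: (congr1 ( *:%R _)).
  by rewrite -linear_sum; congr (cl _); rewrite -linear_sum.
rewrite (eq_bigr _ J) -scaler_sumr (sum_block_forest charK cl_rel).
have nz : #|label_stab lab|%:R != 0 :> K.
  apply: natr_neq0 => //; rewrite lt0n cards_eq0; apply/set0Pn; exists 1%g.
  by apply/label_stabP => i; rewrite perm1.
by rewrite !scalerA mulrCA mulVf // mulr1.
Qed.

End JMChi.

(** * Attaching struts to legs *)

Section Orderings.
Variables (K : fieldType) (V : lmodType K).
Variable cl : {linear {malg K[diag true void]} -> V}.
Hypothesis cl_rel : forall v, graph_rel v -> cl v = 0.
Variables (X : finType) (m n : nat) (lab : 'I_n -> X) (e : 'I_n -> nat).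
Variable t : seq (nat * nat * nat).
Local Notation Q := (X * 'I_m)%type.
Implicit Types (c : {ffun 'I_n -> 'I_m}) (g : {ffun Q * bool -> 'I_n}).

Lemma in_block c q i : (i \in block lab c q) = (q == (lab i, c i)).
Proof. by rewrite inE; case: q => x j; rewrite xpair_eqE /= ![_ == lab _]eq_sym ![_ == c _]eq_sym. Qed.

(** [g] attaches the ends of the strut [q] to the legs [g (q, true)] and
    [g (q, false)]. *)
Definition attaches g : bool :=
  [&& injectiveb g, #|{: Q * bool}| == n & [forall r, lab (g r) == r.1.1]].

Definition induces g c : bool := [forall r, g r \in block lab c r.1].

Lemma attaches_onto g : attaches g -> forall i, exists r, i = g r.
Proof.
case/and3P => /injectiveP gI /eqP sz _ i.
have le : (#|'I_n| <= #|{: Q * bool}|)%N by rewrite card_ord sz.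
by have /codomP[r ->] := inj_card_onto gI le i; exists r.
Qed.

Lemma attaches_block g c q : attaches g -> induces g c ->
  block lab c q = [set g (q, true); g (q, false)].
Proof.
move=> ag /forallP gc; apply/setP => i; rewrite !inE.
have [r ->] := attaches_onto ag i; have /and3P[/injectiveP gI _ _] := ag.
have := gc r; rewrite -[X in _ = X]orbC !(inj_eq gI) in_block => /eqP e1.
have -> : (lab (g r) == q.1) && (c (g r) == q.2) = (r.1 == q).
  by rewrite e1; case: (q) => x j; rewrite xpair_eqE.
case: (r) => q' b; rewrite !xpair_eqE /= -andb_orr; case: b; by rewrite andbT.
Qed.

Lemma attaches_pairs g c : attaches g -> induces g c -> pairs_only lab c.
Proof.
move=> ag gc; apply/forallP => q; rewrite (attaches_block _ ag gc) cards2.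
by have /and3P[/injectiveP gI _ _] := ag; rewrite (inj_eq gI) xpair_eqE andbF.
Qed.

(** The leg [g r] has to get the number of the strut [r.1]. *)
Lemma induced_colouring g : attaches g -> exists c0, induces g =1 pred1 c0.
Proof.
move=> ag; have /fin_all_exists[h hg] := attaches_onto ag.
have /and3P[/injectiveP gI _ /forallP gl] := ag.
exists [ffun i => (h i).1.2] => c /=; apply/forallP/eqP => [gc|-> r].
  apply/ffunP => i; rewrite ffunE {1}(hg i).
  by have := gc (h i); rewrite in_block => /eqP ->.
rewrite in_block ffunE; have -> : h (g r) = r by apply: gI; rewrite -hg.
by rewrite (eqP (gl r)) -surjective_pairing eqxx.
Qed.

(** Each block can be attached to its strut in two ways. *)
Lemma card_orderings c : pairs_only lab c ->
  #|[set g | attaches g && induces g c]| = (2 ^ #|{: Q}|)%N.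
Proof.
move=> /forallP pc.
have /fin_all_exists2[u uv1 uv2] q : exists2 uv : 'I_n * 'I_n, uv.1 != uv.2 &
    block lab c q = [set uv.1; uv.2].
  by have /cards2P[a [b [ne eb]]] := pc q; exists (a, b).
pose gb (b : {ffun Q -> bool}) : {ffun Q * bool -> 'I_n} :=
  [ffun r => if r.2 == b r.1 then (u r.1).1 else (u r.1).2].
have gbI : injective gb.
  move=> b b' /ffunP eb; apply/ffunP => q; have := eb (q, true); rewrite !ffunE /=.
  by case: (b q); case: (b' q) => //= h; have := uv1 q; rewrite h eqxx.
have gbc b r : gb b r \in block lab c r.1.
  by rewrite ffunE uv2 !inE; case: ifP; rewrite eqxx ?orbT.
have inj b : injective (gb b).
  move=> r r' h; have := gbc b r; have := gbc b r'; rewrite -h !in_block => /eqP <- /eqP e1.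
  case: r r' e1 h => q d [q' d'] /= <-; rewrite !ffunE /=.
  by case: d; case: d'; case: (b q) => //= h; have := uv1 q; rewrite h eqxx.
have -> : [set g | attaches g && induces g c] = [set gb b | b in {: {ffun Q -> bool}}].
  apply/setP => g; rewrite inE; apply/andP/imsetP => [[/and3P[/injectiveP gI _ _] /forallP gc]|[b _ ->]].
    exists [ffun q => g (q, true) == (u q).1] => //; apply/ffunP => -[q d].
    rewrite !ffunE /=; have := gc (q, true); have := gc (q, false); rewrite /= uv2 !inE.
    have : g (q, true) != g (q, false) by rewrite (inj_eq gI) xpair_eqE andbF.
    case: d; case: (g (q, true) =P (u q).1) => [->|_] //= ne.
    - by move=> _ /eqP.
    - by rewrite eq_sym (negbTE ne) /= => /eqP.
    by move=> /orP[/eqP -> //|/eqP e1] /eqP e2; rewrite e1 e2 eqxx in ne.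
  split; last by apply/forallP.
  apply/and3P; split; first by apply/injectiveP.
    apply/eqP; rewrite -[RHS]card_ord; apply/eqP; rewrite eqn_leq (leq_card _ (inj b)) /=.
    pose h i : Q * bool := ((lab i, c i), ((u (lab i, c i)).1 == i) == b (lab i, c i)).
    have hK : cancel h (gb b).
      move=> i; rewrite /h ffunE /=; have : i \in block lab c (lab i, c i) by rewrite in_block.
      rewrite uv2 !inE; have := uv1 (lab i, c i).
      case: ((u (lab i, c i)).1 =P i) => [ei|ne] _; rewrite ?eqxx /=.
        by case: (b (lab i, c i)).
      case/orP => /eqP ei; first by case: ne.
      by case: (b (lab i, c i)).
    exact: leq_card (can_inj hK).
  by apply/forallP => r; have := gbc b r; rewrite in_block => /eqP ->.
by rewrite card_imset // card_ffun card_bool.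
Qed.

(** The power of two cancels the factors [1/2] of the struts in the kernel. *)
Lemma sum_orderings (Ql : seq Q) : perm_eq Ql (enum {: Q}) ->
  \sum_(g | attaches g) forest cl [seq [:: e (g (q, true)); e (g (q, false))] | q <- Ql] t [::] =
  (2 ^ (m * #|X|))%:R *: \sum_(c : {ffun 'I_n -> 'I_m} | pairs_only lab c) block_forest cl lab t e c.
Proof.
move=> hQ.
transitivity (\sum_(g | attaches g) \sum_(c : {ffun 'I_n -> 'I_m} | pairs_only lab c && induces g c) block_forest cl lab t e c).
  apply: eq_bigr => g ag; have [c0 hc0] := induced_colouring ag.
  have gc0 : induces g c0 by rewrite hc0 /= eqxx.
  rewrite (big_pred1 c0) => [|c]; last first.
    rewrite hc0 /=; apply/andb_idl => /eqP ->; exact: attaches_pairs gc0.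
  rewrite /block_forest; congr (_ t [::]).
  rewrite (forest_perm cl_rel (perm_map _ hQ)); apply: (forest_pairs cl_rel) => // q.
  rewrite -[X in perm_eq X _]/(map e [:: g (q, true); g (q, false)]); apply: perm_map.
  have /and3P[/injectiveP gI _ _] := ag.
  apply: uniq_perm; rewrite ?enum_uniq //= ?inE ?(inj_eq gI) ?xpair_eqE ?andbF // => i.
  by rewrite mem_enum (attaches_block _ ag gc0) !inE.
rewrite (exchange_big_dep (pairs_only lab)) /=; last by move=> g c _ /andP[].
rewrite scaler_sumr; apply: eq_bigr => c pc.
have -> : (m * #|X| = #|{: Q}|)%N by rewrite card_prod card_ord mulnC.
rewrite -(card_orderings pc) scaler_nat -sumr_const; apply: eq_bigl => g.
by rewrite inE pc.
Qed.

End Orderings.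

(** * The kernel of the integral *)

Section Kernel.
Variables (K : fieldType) (X : finType) (m : nat).

Lemma linextZ (A : choiceType) (V : lmodType K) (f : A -> V) (c : K) v :
  linext f (c *: v) = c *: linext f v.
Proof. exact: linearZ. Qed.

Lemma dmul_scale_gen c d (E1 E2 : graph X) :
  diag_ok false E1 -> diag_ok false E2 ->
  dmul (c *: gen K false E1) (d *: gen K false E2) = (c * d) *: gen K false (dunion E1 E2).
Proof.
move=> ok1 ok2.
pose D1 : diag false X := Sub E1 ok1; pose D2 : diag false X := Sub E2 ok2.
rewrite -[E1]/(val D1) -[E2]/(val D2) !gen_val /dmul linextZ linextU linextZ linextU.
by rewrite scalerA.
Qed.

(** [(x, a)] stands for a strut along the edge [a], both of its ends being
    labelled [x]. *)
Definition struts (ps : seq (X * nat)) : graph X :=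
  Graph [::] (flatten [seq [:: p; p] | p <- ps]) 0.

Lemma ends_struts ps : ends (struts ps) = flatten [seq [:: a; a] | a <- unzip2 ps].
Proof. by rewrite /ends /= /unzip2 map_flatten -!map_comp. Qed.

Lemma struts_ok o ps : uniq (unzip2 ps) -> diag_ok o (struts ps).
Proof.
move=> u; rewrite /diag_ok orbT andbT; apply/wfP => a.
rewrite ends_struts; have -> : count_mem a (flatten [seq [:: b; b] | b <- unzip2 ps]) =
  (count_mem a (unzip2 ps)).*2.
  by elim: (unzip2 ps) => //= b r ->; lia.
by rewrite count_uniq_mem //; case: (_ \in _).
Qed.

Definition is_struts (xs : seq X) (c : K) (u : {malg K[diag false X]}) : Prop :=
  exists ps, [/\ uniq (unzip2 ps), unzip1 ps = xs & u = c *: gen K false (struts ps)].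

Lemma is_struts_dunit : is_struts [::] 1 (dunit K false X).
Proof. by exists [::]; rewrite scale1r. Qed.

Lemma is_struts_scale xs c d u : is_struts xs c u -> is_struts xs (d * c) (d *: u).
Proof. by case=> ps [h1 h2 ->]; exists ps; rewrite scalerA. Qed.

Lemma is_struts_strut x : is_struts [:: x] 1 (gen K false (strut [:: x; x])).
Proof. by exists [:: (x, 0%N)]; rewrite scale1r. Qed.

Lemma is_struts_dmul xs ys c d u v : is_struts xs c u -> is_struts ys d v ->
  is_struts (xs ++ ys) (c * d) (dmul u v).
Proof.
case=> ps [u1 <- ->] [qs [u2 <- ->]].
exists (ps ++ [seq (q.1, (bound (struts ps) + q.2)%N) | q <- qs]); split.
- rewrite /unzip2 map_cat cat_uniq u1 -map_comp.
  have -> : map (snd \o (fun q => (q.1, (bound (struts ps) + q.2)%N))) qs =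
    map (addn (bound (struts ps))) (unzip2 qs) by rewrite /unzip2 -[RHS]map_comp.
  rewrite (map_inj_uniq (@addnI _)) u2 andbT; apply/hasPn => _ /mapP[b _ ->].
  apply/negP => h; have : (bound (struts ps) + b)%N \in ends (struts ps).
    by rewrite ends_struts; apply/flattenP; exists [:: (bound (struts ps) + b)%N; (bound (struts ps) + b)%N];
      rewrite ?mem_head //; apply/mapP; exists (bound (struts ps) + b)%N.
  by move/ends_lt; rewrite ltnNge leq_addr.
- by rewrite /unzip1 map_cat -map_comp.
- have g1 := struts_ok false u1; have g2 := struts_ok false u2.
  apply: etrans (dmul_scale_gen c d g1 g2) _; congr (_ *: gen _ _ _).
  by rewrite /dunion /struts /= map_cat flatten_cat !map_flatten -!map_comp.
Qed.

Lemma is_struts_dexp x c u k : is_struts [:: x] c u -> is_struts (nseq k x) (c ^+ k) (dexp u k).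
Proof.
move=> h; elim: k => [|k IH]; first exact: is_struts_dunit.
by rewrite exprS; exact: (is_struts_dmul h IH).
Qed.

Lemma is_struts_kernel :
  is_struts (flatten [seq nseq m x | x <- index_enum X])
    (((m`!)%:R^-1 * 2%:R^-1 ^+ m) ^+ #|X|) (nint_kernel K X m).
Proof.
rewrite /nint_kernel; have -> : #|X| = size (index_enum X) by rewrite cardT enumT.
elim: (index_enum X) => [|x r IH]; first by rewrite big_nil; exact: is_struts_dunit.
have := is_struts_scale 2%:R^-1 (is_struts_strut x); rewrite mulr1 => h.
rewrite big_cons /= exprS.
exact: is_struts_dmul (is_struts_scale _ (is_struts_dexp m h)) IH.
Qed.

(** The number below [m] tells the struts with the same label apart. *)
Definition strut_names : seq (X * 'I_m) := [seq (x, j) | x <- index_enum X, j <- enum 'I_m].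

Lemma perm_strut_names : perm_eq strut_names (enum {: X * 'I_m}).
Proof.
apply: uniq_perm; rewrite ?enum_uniq //.
  by apply: allpairs_uniq; rewrite ?index_enum_uniq ?enum_uniq // => -[? ?] [? ?] _ _.
move=> [x j]; rewrite mem_enum; apply/allpairsP; exists (x, j) => /=.
by rewrite mem_index_enum mem_enum.
Qed.

Lemma kernel_struts : exists2 a : X * 'I_m -> nat, injective a &
  nint_kernel K X m = (((m`!)%:R^-1 * 2%:R^-1 ^+ m) ^+ #|X|) *:
    gen K false (struts [seq (q.1, a q) | q <- strut_names]).
Proof.
have [ps [u1 e1 ->]] := is_struts_kernel.
have eN : unzip1 strut_names = unzip1 ps.
  rewrite e1 /strut_names /unzip1 map_flatten -map_comp; congr flatten.
  apply: eq_map => x /=; rewrite -map_comp -[in RHS](size_enum_ord m).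
  by elim: (enum _) => //= j r ->.
have sz : size strut_names = size ps by have := congr1 size eN; rewrite !size_map.
have uN : uniq strut_names by rewrite (perm_uniq perm_strut_names) enum_uniq.
pose a q := nth 0%N (unzip2 ps) (index q strut_names).
have aE : map a strut_names = unzip2 ps.
  apply: (@eq_from_nth _ 0%N) => [|i]; rewrite !size_map ?sz // => ips.
  have [q0 _] : exists q0 : X * 'I_m, true by move: ips; rewrite -sz; case: (strut_names) => // q; exists q.
  by rewrite (nth_map q0) ?sz // /a index_uniq ?sz.
have inN q : q \in strut_names by rewrite (perm_mem perm_strut_names) mem_enum.
exists a.
  move=> q q' /eqP; rewrite /a nth_uniq ?size_map -?sz ?index_mem // => /eqP h.
  by rewrite -(nth_index q (inN q)) h nth_index.
congr (_ *: gen _ _ (struts _)).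
have zipE (s : seq (X * 'I_m)) : [seq (q.1, a q) | q <- s] = zip (unzip1 s) (map a s).
  by elim: s => //= q s ->.
rewrite zipE; by rewrite eN aE zip_unzip.
Qed.

End Kernel.

(** * Gluing the kernel to a diagram *)

Section Gluing.
Variables (K : fieldType) (V : lmodType K).
Variable cl : {linear {malg K[diag true void]} -> V}.
Hypothesis cl_rel : forall v, graph_rel v -> cl v = 0.
Implicit Types (t : seq (nat * nat * nat)) (ps : seq (nat * nat)).

Lemma map_pair_subst_id a b ps : a \notin pair_ends ps -> map (map_pair (subst a b)) ps = ps.
Proof.
move=> h; apply: map_pair_id_in => c cps; rewrite /subst.
by case: eqP => // ca; rewrite -ca cps in h.
Qed.

(** A strut both of whose ends are glued joins the two ends it is glued to. *)
Lemma elim_struts E0 G t (z : seq (nat * (nat * nat))) qs :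
  good E0 G -> uniq (unzip1 z) ->
  {in unzip1 z, forall a, a \notin E0 ++ names t ([seq p.2 | p <- z] ++ qs)} ->
  G t (flatten [seq [:: (p.1, p.2.1); (p.1, p.2.2)] | p <- z] ++ qs) =
  G t ([seq p.2 | p <- z] ++ qs) :> V.
Proof.
move=> gG; elim: z qs => //= -[a [u v]] z IH qs /= /andP[az uz] fr.
have fa := fr a (mem_head _ _); set rest := flatten _.
have fa' : [/\ a \notin E0, a \notin tri_ends t, a != u, a != v & a \notin pair_ends ([seq p.2 | p <- z] ++ qs)].
  by move: fa; rewrite /names /pair_ends /= !mem_cat !inE !negb_or => /and5P[-> -> -> -> ->].
case: fa' => aE at_ au av aps.
rewrite (g_elim gG) // map_tri_subst_id //= {1}/map_pair /= {1 2}/subst eqxx.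
rewrite [v == a]eq_sym (negbTE av) map_pair_subst_id; last first.
  rewrite /pair_ends map_cat flatten_cat mem_cat negb_or; move: aps.
  rewrite /pair_ends map_cat flatten_cat mem_cat negb_or => /andP[h1 ->]; rewrite andbT.
  apply: contra h1 => /flattenP[_ /mapP[p pr ->]].
  have [q qz pq] : exists2 q, q \in z & p = (q.1, q.2.1) \/ p = (q.1, q.2.2).
    move: pr => /flattenP[_ /mapP[q qz ->]]; rewrite !inE => /orP[] /eqP ->; exists q => //; by [left|right].
  have nq : a != q.1 by apply: contraNneq az => ->; exact: map_f.
  move=> h; apply/flattenP; exists [:: q.2.1; q.2.2].
    by rewrite -map_comp; apply/mapP; exists q.
  by move: h; case: pq => -> /=; rewrite !inE (negbTE nq) /= => ->; rewrite ?orbT.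
apply: etrans (g_ps gG _ (_ : perm_eq _ (rest ++ (u, v) :: qs))) _.
  by rewrite -[_ :: _]/([:: (u, v)] ++ rest ++ qs) -(cat1s (u, v) qs) perm_catCA.
apply: etrans (IH ((u, v) :: qs) uz _) _ => [b bz|].
  have := fr b; rewrite inE bz orbT => /(_ isT).
  have pe : perm_eq ([seq p.2 | p <- z] ++ (u, v) :: qs) ((u, v) :: [seq p.2 | p <- z] ++ qs).
    by rewrite -(cat1s (u, v) qs) perm_catCA.
  by rewrite !(mem_cat _ E0) /names !(mem_cat _ (tri_ends t)) (perm_mem (perm_flatten (perm_map _ pe))).
by apply: (g_ps gG); rewrite -(cat1s (u, v) qs) perm_catCA.
Qed.

Lemma forest_of_pairs t (uv qs : seq (nat * nat)) :
  forest cl [seq [:: p.1; p.2] | p <- uv] t qs = ev cl t (uv ++ qs).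
Proof.
elim: uv qs => //= -[u v] uv IH qs /=; rewrite -/(forest cl _) lmo_ins2.
rewrite (spine_path (fs := [::]) (good_forest cl_rel _)) //= IH.
by apply: (g_ps (ev_good cl_rel)); rewrite -(cat1s (u, v)) perm_catCA.
Qed.

Variables (X : finType) (m : nat) (a : X * 'I_m -> nat).
Hypothesis aI : injective a.
Local Notation Q := (X * 'I_m)%type.
Let KG := struts [seq (q.1, a q) | q <- strut_names X m].
Let R : seq (Q * bool) := flatten [seq [:: (q, true); (q, false)] | q <- strut_names X m].

Lemma leg_KG : leg KG = [seq (r.1.1, a r.1) | r <- R].
Proof. by rewrite /R map_flatten /KG /= -!map_comp. Qed.

Lemma uniq_R : uniq R.
Proof.
have : uniq (strut_names X m) by rewrite (perm_uniq (perm_strut_names X m)) enum_uniq.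
rewrite /R; elim: (strut_names X m) => //= q s IH /andP[qs /IH ->].
rewrite !inE xpair_eqE andbF /= andbT -negb_or; apply: contra qs.
by case/orP => /flattenP[_ /mapP[q' q's ->]]; rewrite !inE !xpair_eqE => /orP[] /andP[/eqP ->].
Qed.

Lemma mem_R r : r \in R.
Proof.
apply/flattenP; exists [:: (r.1, true); (r.1, false)].
  by apply: (map_f (fun q => [:: (q, true); (q, false)])); rewrite (perm_mem (perm_strut_names X m)) mem_enum.
by case: r => q [] ; rewrite !inE eqxx ?orbT.
Qed.

Lemma size_KG : size (leg KG) = size R. Proof. by rewrite leg_KG size_map. Qed.

Fact index_KG r : (index r R < size (leg KG))%N.
Proof. by rewrite size_KG index_mem mem_R. Qed.

Definition strut_end r : 'I_(size (leg KG)) := Ordinal (index_KG r).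

Lemma tnth_strut_end r : tnth (in_tuple (leg KG)) (strut_end r) = (r.1.1, a r.1).
Proof.
rewrite (tnth_nth (r.1.1, a r.1)) -[LHS]/(nth (r.1.1, a r.1) (leg KG) (index r R)) leg_KG.
by rewrite (nth_map r) ?index_mem ?mem_R //= nth_index ?mem_R.
Qed.

Lemma strut_end_inj : injective strut_end.
Proof.
by move=> r r' /(congr1 val) /= h; rewrite -(nth_index r (mem_R r)) h nth_index ?mem_R.
Qed.

Lemma enum_strut_end : map strut_end R = enum 'I_(size (leg KG)).
Proof.
apply: (inj_map val_inj); rewrite val_enum_ord -map_comp.
transitivity (iota 0 (size R)); last by rewrite size_KG.
rewrite -[LHS]/(map (index^~ R) R).
apply: (@eq_from_nth _ 0%N) => [|i]; rewrite size_map ?size_iota // => iR.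
have [r0 _] : exists r0 : Q * bool, true by case: (R) iR => // r; exists r.
by rewrite (nth_map r0) //= index_uniq ?uniq_R // nth_iota.
Qed.

Lemma card_strut_end : #|{: Q * bool}| = size (leg KG).
Proof.
rewrite size_KG -(card_uniqP uniq_R); apply: eq_card => r; by rewrite mem_R.
Qed.

Variable D : diag false X.
Let n := size (leg (val D)).
Let lab := @leg_label X (val D).
Let e := @leg_edge X (val D).
Let t := tri (val D).

Lemma glue_struts (f : {ffun 'I_(size (leg KG)) -> 'I_n}) :
  cl (gen K true (glue f)) =
  forest cl [seq [:: e (f (strut_end (q, true))); e (f (strut_end (q, false)))]
            | q <- strut_names X m] t [::].
Proof.
rewrite glue_ins //; last exact: circ0.
set E := Graph _ _ _.
have eE : leg E = [seq (e (f (strut_end r)), a r.1) | r <- R].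
  rewrite /E [leg _]/= -enum_strut_end; apply: etrans (esym (map_comp _ _ _)) _.
  apply: eq_map => r; rewrite /comp.
  by rewrite {2}/leg_edge tnth_strut_end.
have [N hN] := belowP (avoid [::] E t [::]).
rewrite (ins_below (ev_good cl_rel) hN) /attach eE [map _ (tri E) ++ _]/=.
pose z := [seq ((N + a q)%N, (e (f (strut_end (q, true))), e (f (strut_end (q, false))))) | q <- strut_names X m].
have -> : [seq ((N + l.2)%N, l.1) | l <- [seq (e (f (strut_end r)), a r.1) | r <- R]]
    = flatten [seq [:: (p.1, p.2.1); (p.1, p.2.2)] | p <- z].
  by rewrite -[LHS]map_comp /R map_flatten; congr flatten; rewrite -[LHS]map_comp -[RHS]map_comp.
have -> : [seq [:: e (f (strut_end (q, true))); e (f (strut_end (q, false)))] | q <- strut_names X m]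
    = [seq [:: p.1; p.2] | p <- [seq p.2 | p <- z]].
  by rewrite -[RHS]map_comp -[RHS]map_comp.
rewrite forest_of_pairs (elim_struts (ev_good cl_rel)) //.
  have -> : unzip1 z = map (fun q => N + a q)%N (strut_names X m) by rewrite /unzip1 -map_comp.
  rewrite map_inj_uniq; first by rewrite (perm_uniq (perm_strut_names X m)) enum_uniq.
  by move=> q q' /addnI /aI.
move=> b bz; have Nb : (N <= b)%N.
  by move: bz => /mapP[_ /mapP[q _ ->] ->] /=; exact: leq_addr.
apply/negP => h; suff : b \in avoid [::] E t [::] by move/(allP hN); rewrite ltnNge Nb.
move: h; rewrite /avoid /names /= !cats0 !mem_cat => /orP[->|]; first by rewrite orbT.
move=> /flattenP[_ /mapP[_ /mapP[_ /mapP[q _ ->] ->] ->]] /=.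
have -> : labs E = [seq e (f (strut_end r)) | r <- R].
  by rewrite /labs eE /unzip1; apply: (esym (map_comp _ _ _)).
rewrite !inE => /orP[] /eqP ->; apply/orP; left.
  by apply/mapP; exists (q, true); rewrite ?mem_R.
by apply/mapP; exists (q, false); rewrite ?mem_R.
Qed.

Lemma sum_gluings :
  \sum_(f : {ffun 'I_(size (leg KG)) -> 'I_n} | gluing f) cl (gen K true (glue f)) =
  \sum_(g | attaches lab g)
    forest cl [seq [:: e (g (q, true)); e (g (q, false))] | q <- strut_names X m] t [::].
Proof.
have le : (#|'I_(size (leg KG))| <= #|{: Q * bool}|)%N by rewrite card_ord card_strut_end.
have [psi endK psiK] := inj_card_bij strut_end_inj le.
pose F (g : {ffun Q * bool -> 'I_n}) : {ffun 'I_(size (leg KG)) -> 'I_n} := [ffun i => g (psi i)].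
pose F' (f : {ffun 'I_(size (leg KG)) -> 'I_n}) : {ffun Q * bool -> 'I_n} :=
  [ffun r => f (strut_end r)].
have FI : bijective F.
  exists F' => g; apply/ffunP => r.
    by rewrite !ffunE endK.
  by rewrite !ffunE psiK.
rewrite (reindex F) /=; last exact: onW_bij.
apply: eq_big => [g|g _].
  rewrite /gluing /attaches; congr (_ && (_ && _)); last 1 first.
  - apply/forallP/forallP => h r.
      by have := h (strut_end r); rewrite ffunE endK [in X in _ == X]/leg_label tnth_strut_end.
    by rewrite -[r]psiK ffunE endK [in X in _ == X]/leg_label tnth_strut_end; exact: h.
  - apply/injectiveP/injectiveP => gI x y.
      by move=> h; apply: strut_end_inj; apply: gI; rewrite !ffunE !endK.
    by rewrite !ffunE => /gI /(can_inj psiK).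
  by rewrite card_strut_end.
rewrite glue_struts; congr (forest _ _ _ _); apply: eq_map => q.
by rewrite !ffunE !endK.
Qed.

End Gluing.

(** * Comparison of the two maps *)

Section Comparison.
Variables (K : fieldType) (X : finType) (m : nat).
Hypothesis charK : [pchar K] =i pred0.

Lemma pairing_linext o1 o2 (Y : choiceType) (u : {malg K[diag o1 Y]}) (w : {malg K[diag o2 Y]}) :
  pairing u w = linext (fun D => pairing u << D >>) w.
Proof.
rewrite /pairing {1}/linext [RHS]/linext.
transitivity (\sum_(D1 <- msupp u) \sum_(D2 <- msupp w)
   w@_D2 *: (u@_D1 *: (\sum_(f | gluing f) gen K true (@glue Y (val D1) (val D2) f)))).
  apply: eq_bigr => D1 _; rewrite {1}/linext scaler_sumr; apply: eq_bigr => D2 _.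
  by rewrite !scalerA mulrC.
rewrite exchange_big /=; apply: eq_bigr => D2 _; rewrite /linext scaler_sumr.
by apply: eq_bigr => D1 _; rewrite -/(linext _ _) linextU.
Qed.

Variables (V : lmodType K) (cl : {linear {malg K[diag true void]} -> V}).
Hypothesis cl_rel : forall v, graph_rel v -> cl v = 0.

(** Both sides sum over the ways of arranging the legs of each label in [m]
    numbered pairs and joining them. *)
Lemma nint_jm_diag (D : diag false X) :
  cl (pairing (nint_kernel K X m) << D >>) = cl (linext (@jm_diag K X m) (chi_diag K D)).
Proof.
apply: etrans (pairing_gen cl _ D) _; apply: etrans (esym (jm_chi charK cl_rel m D)).
have [a aI ->] := kernel_struts K X m.
set KG := struts _; have ok : diag_ok false KG.
  apply: struts_ok; rewrite /unzip2 -map_comp map_inj_uniq //.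
  by rewrite (perm_uniq (perm_strut_names X m)) enum_uniq.
rewrite linextZ -[gen _ _ _]/(gen K false (val (Sub KG ok : diag false X))) gen_val linextU.
rewrite [X in _ *: X](sum_gluings cl_rel aI D).
rewrite (sum_orderings cl_rel _ _ _ (perm_strut_names X m)) scalerA; congr (_ *: _).
rewrite exprMn -exprM !exprVn !natrX -mulrA mulVf ?mulr1 //.
by rewrite expf_neq0 // natr_neq0.
Qed.

Lemma nint_jm v :
  cl (pairing (nint_kernel K X m) v) = cl (linext (@jm_diag K X m) (linext (@chi_diag K X) v)).
Proof.
apply: etrans (congr1 cl (pairing_linext _ v)) _; apply: etrans (linext_comp cl _ v) _.
apply: etrans _ (congr1 cl (esym (linext_comp (linext (@jm_diag K X m)) _ v))).
by apply: etrans _ (esym (linext_comp cl _ v)); apply: eq_linext => D; exact: nint_jm_diag.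
Qed.

End Comparison.

Theorem lemma1p1 (K : fieldType) (charK : [pchar K]%R =i pred0) (X : finType)
    (m : nat) :
  @nint K X m \o @sigma K X = @projOP K m \o @jm K X m.
Proof.
apply/funext => D; apply: functional_extensionality_dep => d /=.
set G := sigma D; have GD : chi G = D := sigmaK charK D.
set s := (m * #|X|)%N.
pose cl : {linear {malg K[diag true void]} -> quo (at_deg (@relOP K m) d)} :=
  cls (at_deg (@relOP K m) d).
have cl_rel v : graph_rel v -> cl v = 0 by move=> h; apply/cls_eq0/Deg_rel/OP_graph.
have cl_deg (E : diag true void) : ~~ has_deg d (val E) -> cl << E >> = 0.
  exact: span_at_deg.
have cl_span u v : span (at_deg (@relA K X) (d + s)) (u - v) ->
    cl (linext (@jm_diag K X m) u) = cl (linext (@jm_diag K X m) v).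
  move=> h; apply/eqP; rewrite -subr_eq0 -2!linearB; apply/eqP.
  apply: (span_kernel (f := cl \o linext (@jm_diag K X m)) _ h) => w hw /=.
  exact: (jm_at_deg charK cl_rel cl_deg hw).
transitivity (cl (linext (@jm_diag K X m) (repr (D (d + s)%N)))).
  rewrite /nint /induced -/s -[LHS]/(cl _).
  apply: etrans (@nint_jm K X m charK _ cl cl_rel _) _; apply: cl_span.
  apply/cls_eq; rewrite cls_repr -GD /chi /induced.
  by move: (d + s)%N (addn0 (d + s)%N) => k; move: (k + 0)%N => k' ->.
rewrite /projOP /induced /jm /induced -/s.
move: (d + 0)%N (addn0 d) => d' ->.
set u := linext _ _; symmetry; apply/eqP; rewrite -subr_eq0; apply/eqP.
apply: etrans (esym (linearB cl _ _)) _.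
apply: (@span_kernel _ _ (at_deg (@relC K) d) _ cl) => [w|].
  by case=> [{}w h|E h]; [exact: cl_rel|exact: cl_deg].
by apply/cls_eq; rewrite cls_repr.
Qed.
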